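(* There is a first-order formula $\psi$ (over colored graphs, i.e. one binary edge relation together with finitely many unary predicates) which has infinitely many models and infinitely many counter-models among planar graphs with maximum degree at most $4$, and such that if the problem $\psi$-dynamics is $\mathsf{NP}$-hard or $\mathsf{coNP}$-hard, then $\mathbf{SAT}$ is robustly often polynomial.
   Context: The problem $\psi$-dynamics: given a succinct representation $(N,D)$ of a graph, where $D$ is a Boolean circuit that on input the binary encodings of two vertices $x,y\in\{0,\dots,N-1\}$ (and for unary predicates, of one vertex) outputs whether the corresponding relations hold, decide whether the encoded structure satisfies $\psi$ (no restriction/promise). A set $M\subseteq\mathbb N$ is robust if for every $k$ there exists $\ell\ge 2$ with $\{\ell,\ell+1,\dots,\ell^k\}\subseteq M$. A problem is robustly often polynomial if there is a robust set $M$ and a polynomial-time algorithm that solves the problem correctly on every instance whose size lies in $M$. *)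

(* Defs.v *)
From HB Require Import structures.
From mathcomp Require Import all_boot all_order all_algebra.
From mathcomp Require Import all_classical all_reals all_analysis.

Set Implicit Arguments.
Unset Strict Implicit.
Unset Printing Implicit Defensive.

Import numFieldNormedType.Exports.
Local Open Scope classical_set_scope.
Local Open Scope nat_scope.

(** * Colored graphs *)

(* [edge] is an arbitrary binary relation; see [simple_graph]. *)
Record cgraph (r : nat) := CGraph {
  nvert : nat;
  edge : rel 'I_nvert;
  color : 'I_r -> pred 'I_nvert
}.

Definition isomorphic r (G H : cgraph r) : Prop :=
  exists f : 'I_(nvert G) -> 'I_(nvert H),
    [/\ bijective f,
        forall u v, edge (f u) (f v) = edge u v &
        forall c u, color c (f u) = color c u].

Definition infinitely_many r (P : cgraph r -> Prop) : Prop :=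
  exists G : nat -> cgraph r,
    (forall i, P (G i)) /\ (forall i j, i <> j -> ~ isomorphic (G i) (G j)).

Definition simple_graph r (G : cgraph r) : Prop :=
  symmetric (@edge r G) /\ irreflexive (@edge r G).

Definition max_degree_le (d : nat) r (G : cgraph r) : Prop :=
  forall v : 'I_(nvert G), #|[pred u | edge v u]| <= d.

(* A drawing of a simple graph in the plane: [p] places the vertices, and
   each edge {u, v}, taken once with u < v, is the arc [a u v] restricted to
   [0, 1]. *)
Definition is_drawing (R : realType) r (G : cgraph r)
    (p : 'I_(nvert G) -> R * R)
    (a : 'I_(nvert G) -> 'I_(nvert G) -> R -> R * R) : Prop :=
  let E (u v : 'I_(nvert G)) := (u < v) && edge u v in
  [/\ injective p,
      forall u v, E u v ->
        [/\ {within `[0%R, 1%R], continuous (a u v)},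
            {in `[0, 1]%R &, injective (a u v)},
            a u v 0%R = p u & a u v 1%R = p v],
      forall u v w, E u v ->
        forall t : R, t \in `]0, 1[%R -> a u v t <> p w &
      forall u v u' v', E u v -> E u' v' -> (u, v) <> (u', v') ->
        forall t t' : R, t \in `]0, 1[%R -> t' \in `]0, 1[%R ->
          a u v t <> a u' v' t'].

Definition planar (R : realType) r (G : cgraph r) : Prop :=
  exists p a, @is_drawing R r G p a.

(** * First-order logic over colored graphs *)

(* [formula r n] has its free variables among n de Bruijn indices; index 0 is
   the most recently bound variable. *)
Inductive formula (r : nat) : nat -> Type :=
| FEq n : 'I_n -> 'I_n -> formula r n
| FEdge n : 'I_n -> 'I_n -> formula r n
| FColor n : 'I_r -> 'I_n -> formula r n
| FNot n : formula r n -> formula r n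
| FAnd n : formula r n -> formula r n -> formula r n
| FEx n : formula r n.+1 -> formula r n.

Fixpoint holds r (G : cgraph r) n (phi : formula r n) :
    n.-tuple 'I_(nvert G) -> bool :=
  match phi in formula _ n return n.-tuple 'I_(nvert G) -> bool with
  | FEq _ x y => fun s => tnth s x == tnth s y
  | FEdge _ x y => fun s => edge (tnth s x) (tnth s y)
  | FColor _ c x => fun s => color c (tnth s x)
  | FNot _ phi1 => fun s => ~~ holds phi1 s
  | FAnd _ phi1 phi2 => fun s => holds phi1 s && holds phi2 s
  | FEx _ phi1 => fun s => [exists v, holds phi1 [tuple of v :: s]]
  end.

Definition sentence r := formula r 0.

Definition models r (G : cgraph r) (psi : sentence r) : bool :=
  @holds r G 0 psi [tuple].

(** * Turing machines and polynomial time *)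

Inductive move := MoveL | Stay | MoveR.

(* Tape symbols: [None] is the blank, [Some (inl b)] are the bits of the
   input/output alphabet, [Some (inr g)] are auxiliary symbols. *)
Definition cell (X : finType) : Type := option (bool + X).

Record tm := TM {
  tapes : nat;  (* the machine has [tapes.+1] tapes *)
  state : finType;
  aux : finType;
  start : state;
  halting : pred state;
  delta : state -> (tapes.+1).-tuple (cell aux) ->
          state * (tapes.+1).-tuple (cell aux * move)
}.

(* Two-way infinite tape: cells left of the head (nearest first), scanned
   cell, cells right of the head; the cells not represented are blank. *)
Record tape (X : finType) := Tape {
  lpart : seq (cell X);
  scan : cell X;
  rpart : seq (cell X)
}.

Definition tape_of_seq X (s : seq (cell X)) : tape X :=
  Tape [::] (head None s) (behead s).

Definition write_move X (t : tape X) (am : cell X * move) : tape X :=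
  let: (a, m) := am in
  match m with
  | MoveL => Tape (behead (lpart t)) (head None (lpart t)) (a :: rpart t)
  | Stay => Tape (lpart t) a (rpart t)
  | MoveR => Tape (a :: lpart t) (head None (rpart t)) (behead (rpart t))
  end.

Definition config (M : tm) : Type :=
  state M * (tapes M).+1.-tuple (tape (aux M)).

Definition step (M : tm) (c : config M) : config M :=
  let: (q, ts) := c in
  if halting q then c else
  let: (q', acts) := delta q (map_tuple (@scan _) ts) in
  (q', [tuple write_move (tnth ts i) (tnth acts i) | i < (tapes M).+1]).

Definition init (M : tm) (w : seq bool) : config M :=
  (start M,
   [tuple tape_of_seq
      (if i == ord0 then [seq Some (inl b) | b <- w] else [::])
    | i < (tapes M).+1]).

Fixpoint read_bits X (s : seq (cell X)) : seq bool :=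
  if s is Some (inl b) :: s' then b :: read_bits s' else [::].

(* The output is the maximal word of bits on tape 0 starting at the head. *)
Definition output (M : tm) (c : config M) : seq bool :=
  let t := tnth c.2 ord0 in read_bits (scan t :: rpart t).

(* Halting configurations are fixed by [step], so the condition says that the
   machine halts within |w|^d + d steps with output [f w]. *)
Definition polytime (f : seq bool -> seq bool) : Prop :=
  exists (M : tm) (d : nat), forall w : seq bool,
    let c := iter (size w ^ d + d) (@step M) (init M w) in
    halting c.1 /\ output c = f w.

(** * Binary encodings *)

(* The [m] low-order binary digits of [n], least significant first. *)
Definition bin (m n : nat) : seq bool := mkseq (fun i => odd (n %/ 2 ^ i)) m.

Definition enc_seq T (enc : T -> seq bool) (s : seq T) : seq bool :=
  flatten [seq true :: enc x | x <- s] ++ [:: false].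

Definition enc_bits : seq bool -> seq bool := enc_seq (fun b => [:: b]).

(* [up_log 2 n.+1] is the length of [n] in binary. *)
Definition enc_nat (n : nat) : seq bool := enc_bits (bin (up_log 2 n.+1) n).

Definition enc_pair (x y : seq bool) : seq bool := enc_bits x ++ y.

(** * Complexity classes *)

Definition language := seq bool -> Prop.

Definition NP (L : language) : Prop :=
  exists (V : seq bool -> seq bool) (d : nat),
    polytime V /\
    forall x, L x <-> exists y,
      size y <= size x ^ d + d /\ V (enc_pair x y) = [:: true].

Definition coNP (L : language) : Prop := NP (fun x => ~ L x).

Definition reduces (A B : language) : Prop :=
  exists f, polytime f /\ forall x, A x <-> B (f x).

Definition NP_hard (B : language) : Prop := forall A, NP A -> reduces A B.

Definition coNP_hard (B : language) : Prop := forall A, coNP A -> reduces A B.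

Definition robust (M : nat -> Prop) : Prop :=
  forall k, exists2 l, 2 <= l & forall n, l <= n <= l ^ k -> M n.

Definition robustly_often_polynomial (L : language) : Prop :=
  exists (M : nat -> Prop) (f : seq bool -> seq bool),
    [/\ robust M, polytime f &
        forall w, M (size w) -> (f w = [:: true] <-> L w)].

(** * SAT *)

(* The literal [(b, i)] is the variable i if [b], its negation otherwise. *)
Definition literal : Type := bool * nat.
Definition cnf : Type := seq (seq literal).

Definition satisfiable (F : cnf) : Prop :=
  exists a : nat -> bool, all (has (fun l : literal => a l.2 == l.1)) F.

Definition enc_literal (l : literal) : seq bool := l.1 :: enc_nat l.2.
Definition enc_cnf : cnf -> seq bool := enc_seq (enc_seq enc_literal).

Definition SAT : language :=
  fun w => exists2 F, w = enc_cnf F & satisfiable F.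

(** * Boolean circuits and succinct representations *)

(* The arguments of the last three constructors are positions of earlier gates
   in the circuit. *)
Inductive gate :=
| GInput of nat
| GConst of bool
| GNot of nat
| GAnd of nat & nat
| GOr of nat & nat.

(* Gates in topological order; the last one is the output. *)
Definition circuit := seq gate.

Definition gate_ok (n i : nat) (g : gate) : bool :=
  match g with
  | GInput j => j < n
  | GConst _ => true
  | GNot j => j < i
  | GAnd j k | GOr j k => (j < i) && (k < i)
  end.

Definition circuit_ok (n : nat) (C : circuit) : bool :=
  (0 < size C) &&
  all (fun i => gate_ok n i (nth (GConst false) C i)) (iota 0 (size C)).

Definition gate_value (inp vs : seq bool) (g : gate) : bool :=
  match g with
  | GInput j => nth false inp j
  | GConst b => b
  | GNot j => ~~ nth false vs j
  | GAnd j k => nth false vs j && nth false vs k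
  | GOr j k => nth false vs j || nth false vs k
  end.

Definition circuit_eval (C : circuit) (inp : seq bool) : bool :=
  last false (foldl (fun vs g => rcons vs (gate_value inp vs g)) [::] C).

(* The pair (N, D); D consists of one circuit for the edge relation and one
   for each unary predicate. *)
Record succinct (r : nat) := Succinct {
  vertices : nat;
  edge_circuit : circuit;
  color_circuits : r.-tuple circuit
}.

(* A vertex is given by ceil(log2 N) bits. *)
Definition vertex_bits r (S : succinct r) : nat := up_log 2 (vertices S).

Definition succinct_ok r (S : succinct r) : bool :=
  circuit_ok (2 * vertex_bits S) (edge_circuit S) &&
  all (circuit_ok (vertex_bits S)) (color_circuits S).

Definition decode r (S : succinct r) : cgraph r :=
  let b (x : 'I_(vertices S)) := bin (vertex_bits S) x in
  CGraph (fun x y => circuit_eval (edge_circuit S) (b x ++ b y))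
         (fun c x => circuit_eval (tnth (color_circuits S) c) (b x)).

Definition enc_gate (g : gate) : seq bool :=
  match g with
  | GInput j => [:: false; false] ++ enc_nat j
  | GConst b => [:: false; true; b]
  | GNot j => [:: true; false] ++ enc_nat j
  | GAnd j k => [:: true; true; false] ++ enc_nat j ++ enc_nat k
  | GOr j k => [:: true; true; true] ++ enc_nat j ++ enc_nat k
  end.

Definition enc_succinct r (S : succinct r) : seq bool :=
  enc_nat (vertices S) ++
  enc_seq (enc_seq enc_gate) (edge_circuit S :: color_circuits S).

Definition dynamics r (psi : sentence r) : language :=
  fun w => exists S : succinct r,
    [/\ w = enc_succinct S, succinct_ok S & models (decode S) psi].

(* Main.v *)
Require Import Defs.
From mathcomp Require Import all_boot all_order all_algebra.
From mathcomp Require Import all_classical all_reals all_analysis.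
From mathcomp Require Import zify ring lra.

Set Implicit Arguments.
Unset Strict Implicit.
Unset Printing Implicit Defensive.

(* The formula psi describes a complete binary tree whose levels are paths (rows):
   the vertex with heap number a has the parent a/2 and, within its row, the next
   vertex a + 1. Siblings need no edge, which keeps the degree at 4, and placing
   a at the point (a, lg a) gives a straight-line planar drawing. First-order
   logic cannot express connectivity, but here it need not: a row is larger than
   the row of its parents, so no component of a finite model can avoid the root.
   Hence every model has 2^(h+1) - 1 vertices for some height h. Further colors
   run a computation from row to row. A row in which an epoch starts is cut into
   blocks of one vertex; the blocks double with the rows, one more block is
   finished in each row, and the next epoch starts when all are finished. So the
   epochs start at rows t_0 = 0, t_(j+1) = t_j + 2^(t_j), and psi asks the last
   row to start an epoch of even index. The sizes of the models thus leave gaps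
   that are doubly exponential.

   Now let f reduce SAT (or its complement) to psi-dynamics. If |w| lies at the
   lower end of a suitable gap, f w encodes at most 2^(poly |w|) vertices, so
   psi fails unless it encodes at most |w| vertices, and then psi is evaluated by
   brute force. Polynomial-time algorithms are obtained from a class of functions
   between coded data types that is closed under composition, case distinction
   and size-bounded folds; each of them is run by a Turing machine which keeps
   trees, in prefix notation, on stacks. *)

(** * Structured programs for Turing machines *)

(** Only epochs of even index end a model because a single epoch is too short. With l = 2^(t+1) for
    a starting row t, the model ending one epoch later would have about l 2^(l/2) vertices, whereas
    a reduction with output length n^d + d, applied to inputs of length up to l^k, may encode nearly
    2^(l^(kd)) vertices. Skipping one epoch raises the height to at least 2^(2^t) = 2^(l/2), which
    beats every polynomial in l. Robustness asks for one gap that serves all lengths from l to l^k.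
    The lower end serves the brute force: no model has more than l but fewer than the forbidden
    number of vertices, so the models that remain have at most |w| vertices. No promise restricts
    the inputs of psi-dynamics. Hence the gaps must hold for all finite structures, even with a
    non-symmetric edge relation; simplicity, degree and planarity matter only for the exhibited
    models and counter-models. The decision procedure is deterministic, so its answer can be
    negated, which treats NP-hardness and coNP-hardness alike. *)

Section Programs.

Variables (X : finType) (T : nat).

Definition scans := T.+1.-tuple (cell X).
Definition actions := T.+1.-tuple (cell X * move).
Definition tape_tuple := T.+1.-tuple (tape X).

Definition scan_all (ts : tape_tuple) : scans := map_tuple (@scan X) ts.

Definition act_all (ts : tape_tuple) (ac : actions) : tape_tuple :=
  [tuple write_move (tnth ts i) (tnth ac i) | i < T.+1].

Inductive cmd :=
| Act of scans -> actions
| Seq of cmd & cmd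
| If of (scans -> bool) & cmd & cmd
| While of (scans -> bool) & cmd.

(** Program counters. The additional [None] of [If] and [While] is the state in which the test is
    evaluated. *)
Fixpoint label (c : cmd) : finType :=
  match c with
  | Act _ => unit
  | Seq a b => (label a + label b)%type
  | If _ a b => option (label a + label b)
  | While _ a => option (label a)
  end.

Fixpoint entry (c : cmd) : label c :=
  match c with
  | Act _ => tt
  | Seq a b => inl (entry a)
  | If _ a b => None
  | While _ a => None
  end.

Definition idle (sc : scans) : actions := map_tuple (fun x => (x, Stay)) sc.

(* A next label [None] means that the program has terminated. *)
Fixpoint next (c : cmd) : label c -> scans -> option (label c) * actions :=
  match c with
  | Act f => fun _ sc => (None, f sc)
  | Seq a b => fun q sc =>
      match q with
      | inl q => let: (o, ac) := next q sc in
          (Some (if o is Some q' then inl q' else inr (entry b)), ac)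
      | inr q => let: (o, ac) := next q sc in
          (if o is Some q' then Some (inr q') else None, ac)
      end
  | If t a b => fun q sc =>
      match q with
      | None => (Some (Some (if t sc then inl (entry a) else inr (entry b))),
                 idle sc)
      | Some (inl q) => let: (o, ac) := next q sc in
          (if o is Some q' then Some (Some (inl q')) else None, ac)
      | Some (inr q) => let: (o, ac) := next q sc in
          (if o is Some q' then Some (Some (inr q')) else None, ac)
      end
  | While t a => fun q sc =>
      match q with
      | None => (if t sc then Some (Some (entry a)) else None, idle sc)
      | Some q => let: (o, ac) := next q sc in
          (if o is Some q' then Some (Some q') else Some None, ac)
      end
  end.

Definition run (c : cmd) (p : option (label c) * tape_tuple) :=
  if p.1 is Some q then
    let: (o, ac) := next q (scan_all p.2) in (o, act_all p.2 ac)
  else p.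

(** The time is only an upper bound, so that costs can be rounded up when programs are combined. *)
Definition runs (c : cmd) (ts ts' : tape_tuple) (t : nat) : Prop :=
  exists2 t', t' <= t &
    iter t' (@run c) (Some (entry c), ts) = (None, ts').

Lemma act_all_idle ts : act_all ts (idle (scan_all ts)) = ts.
Proof.
apply: eq_from_tnth => i; rewrite tnth_mktuple !tnth_map.
by case: (tnth ts i).
Qed.

(** One simulation argument for all constructs: a subprogram runs inside a larger one with its
    labels renamed by [e]. The renaming is required to commute only with steps from a live label,
    since what follows termination depends on the context. *)
Lemma iter_run_embed (a c : cmd) (e : option (label a) -> option (label c)) :
  (forall q ts, run (e (Some q), ts) =
    (e (run (Some q, ts)).1, (run (Some q, ts)).2)) ->
  forall t q ts ts', iter t (@run a) (Some q, ts) = (None, ts') ->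
  exists2 t', t' <= t & iter t' (@run c) (e (Some q), ts) = (e None, ts').
Proof.
move=> He; elim=> [//|t IH] q ts ts'; rewrite iterSr.
case E: (run (Some q, ts)) => [[q'|] ts1] Hr.
  have [t' le Ht'] := IH _ _ _ Hr; exists t'.+1 => //.
  by rewrite iterSr He E.
(* A terminated run is stationary, so the remaining iterations change nothing. *)
have -> : ts' = ts1.
  move: Hr; have -> : iter t (@run a) (None, ts1) = (None, ts1).
    by elim: t {IH} => //= t ->.
  by case.
by exists 1 => //=; rewrite He E.
Qed.

Lemma runs_weaken c ts ts' t t' : t <= t' -> runs c ts ts' t -> runs c ts ts' t'.
Proof. by move=> le [u lu H]; exists u => //; apply: leq_trans lu le. Qed.

Lemma runs_act f ts : runs (Act f) ts (act_all ts (f (scan_all ts))) 1.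
Proof. by exists 1. Qed.

Lemma runs_seq a b ts ts1 ts2 t1 t2 :
  runs a ts ts1 t1 -> runs b ts1 ts2 t2 -> runs (Seq a b) ts ts2 (t1 + t2).
Proof.
move=> [u1 l1 H1] [u2 l2 H2].
have [|v1 k1 K1] := @iter_run_embed a (Seq a b)
  (fun o => Some (if o is Some q then inl q else inr (entry b))) _ _ _ _ _ H1.
  by move=> q s; rewrite /run /=; case: next.
have [|v2 k2 K2] := @iter_run_embed b (Seq a b)
  (fun o => if o is Some q then Some (inr q) else None) _ _ _ _ _ H2.
  by move=> q s; rewrite /run /=; case: next.
exists (v2 + v1); last by rewrite iterD K1 K2.
by rewrite addnC leq_add // ?(leq_trans k1 l1) ?(leq_trans k2 l2).
Qed.

Lemma runs_if (test : scans -> bool) a b ts ts' t :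
  runs (if test (scan_all ts) then a else b) ts ts' t ->
  runs (If test a b) ts ts' t.+1.
Proof.
case E: (test _) => -[u le Hu].
- have [|v k K] := @iter_run_embed a (If test a b)
    (fun o => if o is Some q then Some (Some (inl q)) else None) _ _ _ _ _ Hu.
    by move=> q s; rewrite /run /=; case: next.
  exists v.+1; first by rewrite ltnS (leq_trans k le).
  by rewrite iterSr {2}/run /= E act_all_idle.
- have [|v k K] := @iter_run_embed b (If test a b)
    (fun o => if o is Some q then Some (Some (inr q)) else None) _ _ _ _ _ Hu.
    by move=> q s; rewrite /run /=; case: next.
  exists v.+1; first by rewrite ltnS (leq_trans k le).
  by rewrite iterSr {2}/run /= E act_all_idle.
Qed.

Lemma runs_while_stop (test : scans -> bool) a ts :
  ~~ test (scan_all ts) -> runs (While test a) ts ts 1.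
Proof. by move=> /negbTE E; exists 1; rewrite //= /run /= E act_all_idle. Qed.

Lemma runs_while_step (test : scans -> bool) a ts ts1 ts2 t1 t2 :
  test (scan_all ts) -> runs a ts ts1 t1 -> runs (While test a) ts1 ts2 t2 ->
  runs (While test a) ts ts2 (t1 + t2).+1.
Proof.
move=> E [u1 l1 H1] [u2 l2 H2].
have [|v k K] := @iter_run_embed a (While test a) (fun o => Some o)
  _ _ _ _ _ H1.
  by move=> q s; rewrite /run /=; case: next => [[]].
exists (u2 + v).+1; last first.
  by rewrite iterSr {2}/run /= E act_all_idle iterD K.
by rewrite ltnS addnC leq_add // (leq_trans k l1).
Qed.

Definition machine (c : cmd) : tm :=
  @TM T (option (label c)) X (Some (entry c)) (fun q => ~~ q)
    (fun q sc => if q is Some q then next q sc else (None, idle sc)).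

Lemma step_machine c : @step (machine c) =1 @run c.
Proof. by case=> -[q|] ts; rewrite /step /run //=; case: next. Qed.

(** Halted configurations are stationary, which turns the time bound into the exact number of steps
    that [polytime] prescribes. *)
Lemma runs_machine c ts ts' t :
  runs c ts ts' t ->
  iter t (@step (machine c)) (Some (entry c), ts) = (None, ts').
Proof.
move=> [u le H]; rewrite (eq_iter (@step_machine c)) -(subnK le) iterD H.
by elim: (t - u) => //= k ->.
Qed.

End Programs.

(** * Stack programs *)

Inductive scmd :=
| Push of 'I_5 & bool
| Pop of 'I_5
| SSeq of scmd & scmd
| SIf of 'I_5 & option bool & scmd & scmd
| SWhile of 'I_5 & pred (option bool) & scmd.

Definition stacks := seq (seq bool).

Definition stack (S : stacks) (j : nat) : seq bool := nth [::] S j.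

(** The costs are those of the compiled programs: a push moves the head and then writes, hence 2; a
    pop or a test takes one step. [exec_weaken] makes them upper bounds. *)
Inductive exec : scmd -> stacks -> stacks -> nat -> Prop :=
| exec_push (j : 'I_5) b S : exec (Push j b) S (set_nth [::] S j (b :: stack S j)) 2
| exec_pop (j : 'I_5) S : exec (Pop j) S (set_nth [::] S j (behead (stack S j))) 1
| exec_seq a b S1 S2 S3 t1 t2 :
    exec a S1 S2 t1 -> exec b S2 S3 t2 -> exec (SSeq a b) S1 S3 (t1 + t2)
| exec_if (j : 'I_5) o a b S S' t :
    exec (if ohead (stack S j) == o then a else b) S S' t ->
    exec (SIf j o a b) S S' t.+1
| exec_while_stop (j : 'I_5) (p : pred (option bool)) a S :
    ~~ p (ohead (stack S j)) -> exec (SWhile j p a) S S 1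
| exec_while_step (j : 'I_5) (p : pred (option bool)) a S S1 S2 t1 t2 :
    p (ohead (stack S j)) -> exec a S S1 t1 ->
    exec (SWhile j p a) S1 S2 t2 -> exec (SWhile j p a) S S2 (t1 + t2).+1
| exec_weaken a S S' t t' : t <= t' -> exec a S S' t -> exec a S S' t'.

(** * Stacks on tapes *)

Section Tapes.

Variables (X : finType) (T : nat).

Definition act1 (k : 'I_T.+1) (g : cell X -> cell X * move)
    (sc : scans X T) : actions X T :=
  [tuple if i == k then g (tnth sc i) else (tnth sc i, Stay) | i < T.+1].

Lemma act1E k g (ts : tape_tuple X T) i :
  tnth (act_all ts (act1 k g (scan_all ts))) i =
  if i == k then write_move (tnth ts i) (g (scan (tnth ts i)))
  else tnth ts i.
Proof.
rewrite tnth_mktuple tnth_mktuple tnth_map; case: eqP => // _.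
by case: (tnth ts i).
Qed.

Definition bit_cell (b : bool) : cell X := Some (inl b).

(* Lists of cells are read up to trailing blanks. *)
Definition tape_at (t : tape X) (u l : seq (cell X)) : Prop :=
  nth None (lpart t) =1 nth None u /\ nth None (scan t :: rpart t) =1 nth None l.

Lemma nth_head_behead (l : seq (cell X)) :
  nth None (head None l :: behead l) =1 nth None l.
Proof. by case: l => //= -[|i] //=; rewrite nth_nil. Qed.

Lemma tape_at_write t u l a mv : tape_at t u l ->
  tape_at (write_move t (a, mv))
    (match mv with MoveL => behead u | Stay => u | MoveR => a :: u end)
    (match mv with
     | MoveL => head None u :: a :: behead l
     | Stay => a :: behead l
     | MoveR => behead l
     end).
Proof.
case: t => tl x tr [/= Hl Hr].
have Hr' : nth None tr =1 nth None (behead l).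
  by move=> i; have /= -> := Hr i.+1; rewrite nth_behead.
have Hl' : nth None (behead tl) =1 nth None (behead u).
  by move=> i; rewrite !nth_behead.
have H0 : head None tl = head None u by rewrite -!nth0 Hl.
by case: mv; split=> //= i; rewrite ?nth_head_behead //;
  case: i => [|[|i]] //=.
Qed.

Lemma tape_at_ext t u l u' l' : nth None u =1 nth None u' ->
  nth None l =1 nth None l' -> tape_at t u l -> tape_at t u' l'.
Proof. by move=> Eu El [Hu Hl]; split=> i; rewrite ?Hu ?Hl. Qed.

Lemma tape_at_scan t u l : tape_at t u l -> scan t = head None l.
Proof. by move=> [_ /(_ 0)] /= ->; rewrite nth0. Qed.

Definition is_stack (t : tape X) (s : seq bool) : Prop :=
  tape_at t [::] (map bit_cell s).

Lemma is_stack_scan t s :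
  is_stack t s -> scan t = if s is b :: _ then bit_cell b else None.
Proof. by move=> /tape_at_scan ->; case: s. Qed.

Lemma is_stack_push t s b : is_stack t s ->
  is_stack (write_move (write_move t (scan t, MoveL)) (bit_cell b, Stay))
           (b :: s).
Proof.
move=> H; have /= := tape_at_write (bit_cell b) Stay (tape_at_write (scan t)
  MoveL H).
apply: tape_at_ext => //= -[|i] //=; have [_ Hr] := H.
by rewrite (tape_at_scan H) nth_head_behead.
Qed.

(** Erasing the cell before moving right keeps everything to the left of the head blank, as
    [is_stack] demands. *)
Lemma is_stack_pop t s :
  is_stack t s -> is_stack (write_move t (None, MoveR)) (behead s).
Proof.
move=> /(tape_at_write None MoveR) /=; apply: tape_at_ext => [[|i]|i] //=.
  by rewrite nth_nil.
by rewrite behead_map.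
Qed.

Variable sk : 'I_5 -> 'I_T.+1.
Hypothesis sk_inj : injective sk.

Definition represents (ts : tape_tuple X T) (S : stacks) : Prop :=
  forall j : 'I_5, is_stack (tnth ts (sk j)) (stack S j).

Definition top_of (j : 'I_5) (sc : scans X T) : option bool :=
  if tnth sc (sk j) is Some (inl b) then Some b else None.

Fixpoint compile (c : scmd) : cmd X T :=
  match c with
  | Push j b => Seq (Act (act1 (sk j) (fun x => (x, MoveL))))
                    (Act (act1 (sk j) (fun _ => (bit_cell b, Stay))))
  | Pop j => Act (act1 (sk j) (fun _ => (None, MoveR)))
  | SSeq a b => Seq (compile a) (compile b)
  | SIf j o a b => If (fun sc => top_of j sc == o) (compile a) (compile b)
  | SWhile j p a => While (fun sc => p (top_of j sc)) (compile a)
  end.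

Lemma represents_top ts S j :
  represents ts S -> top_of j (scan_all ts) = ohead (stack S j).
Proof.
move=> /(_ j) /is_stack_scan; rewrite /top_of tnth_map => ->.
by case: (stack S j).
Qed.

Lemma represents_set ts S ts' (j : 'I_5) s :
  represents ts S -> is_stack (tnth ts' (sk j)) s ->
  (forall i, i != sk j -> tnth ts' i = tnth ts i) ->
  represents ts' (set_nth [::] S j s).
Proof.
move=> rep Hj Hi k; rewrite /stack nth_set_nth /= (inj_eq val_inj).
by case: eqP => [->//|/eqP nkj]; rewrite Hi // (inj_eq sk_inj).
Qed.

(** The last clause is a frame condition: stack programs will share a machine with the tapes of
    another machine, which they must not disturb. *)
Lemma compileP c S S' t : exec c S S' t ->
  forall ts, represents ts S ->
  exists ts', [/\ represents ts' S', runs (compile c) ts ts' t &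
    forall i, (forall j, i != sk j) -> tnth ts' i = tnth ts i].
Proof.
elim=> {c S S' t}
  [j b S|j S|a b S1 S2 S3 t1 t2 _ IH1 _ IH2|j o a b S S' t _ IH
  |j p a S E|j p a S S1 S2 t1 t2 E _ IH1 _ IH2|a S S' t t' le _ IH] ts rep.
- eexists; split; [|exact: (runs_seq (runs_act _ _) (runs_act _ _))|]; last first.
    by move=> i ne; rewrite !act1E (negbTE (ne j)).
  apply: (represents_set rep) => [|i ne].
    by rewrite !act1E eqxx; apply: is_stack_push.
  by rewrite !act1E (negbTE ne).
- eexists; split; [|exact: runs_act|]; last first.
    by move=> i ne; rewrite act1E (negbTE (ne j)).
  apply: (represents_set rep) => [|i ne].
    by rewrite !act1E eqxx; apply: is_stack_pop.
  by rewrite !act1E (negbTE ne).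
- have [ts1 [rep1 r1 s1]] := IH1 _ rep; have [ts2 [rep2 r2 s2]] := IH2 _ rep1.
  by exists ts2; split=> // [|i ne]; [apply: runs_seq r1 r2|rewrite s2 ?s1].
- have [ts1 [rep1 r1 s1]] := IH _ rep; exists ts1; split=> //.
  by apply: runs_if; rewrite (represents_top _ rep); case: ifP r1.
- exists ts; split=> //.
  by apply: runs_while_stop; rewrite (represents_top _ rep).
- have [ts1 [rep1 r1 s1]] := IH1 _ rep; have [ts2 [rep2 r2 s2]] := IH2 _ rep1.
  exists ts2; split=> // [|i ne]; last by rewrite s2 ?s1.
  by apply: runs_while_step r1 r2; rewrite (represents_top _ rep).
- have [ts1 [rep1 r1 s1]] := IH _ rep; exists ts1; split=> //.
  exact: runs_weaken r1.
Qed.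

End Tapes.

(** * Trees on a stack *)

Inductive tree := Leaf | Node of tree & tree.

Fixpoint enc_tree (t : tree) : seq bool :=
  if t is Node a b then true :: enc_tree a ++ enc_tree b else [:: false].

(** [sD] holds the data, [sC] is a unary counter, and [sA], [sB], [sE] are buffers. The programs
    behind [FP] start and end with all stacks but [sD] empty. *)
Definition sD : 'I_5 := @Ordinal 5 0 isT.
Definition sA : 'I_5 := @Ordinal 5 1 isT.
Definition sB : 'I_5 := @Ordinal 5 2 isT.
Definition sC : 'I_5 := @Ordinal 5 3 isT.
Definition sE : 'I_5 := @Ordinal 5 4 isT.

Lemma exec_push_eq (j : 'I_5) b S S' :
  S' = set_nth [::] S j (b :: stack S j) -> exec (Push j b) S S' 2.
Proof. by move=> ->; apply: exec_push. Qed.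

Lemma exec_pop_eq (j : 'I_5) S S' :
  S' = set_nth [::] S j (behead (stack S j)) -> exec (Pop j) S S' 1.
Proof. by move=> ->; apply: exec_pop. Qed.

Lemma exec_if_eq (j : 'I_5) o b c a S S' t :
  (if ohead (stack S j) == o then b else c) = a ->
  exec a S S' t -> exec (SIf j o b c) S S' t.+1.
Proof. by move=> <-; apply: exec_if. Qed.

Definition skip : scmd := SWhile sC pred0 (Pop sC).

Lemma exec_skip S : exec skip S S 1.
Proof. exact: exec_while_stop. Qed.

Definition drain (k : 'I_5) (body : bool -> scmd) : scmd :=
  SWhile k (fun o => o != None)
    (SIf k (Some true) (SSeq (Pop k) (body true)) (SSeq (Pop k) (body false))).

(** The stacks are presented as a function [f] of the content of [k] and of a value [y] for
    everything else. The body acts on [y] alone, so the loop is a fold over the content of [k]. *)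
Lemma exec_drain (k : 'I_5) body (Y : Type) (f : seq bool -> Y -> stacks)
    (upd : bool -> Y -> Y) cost :
  (forall x y, stack (f x y) k = x) ->
  (forall x x' y, set_nth [::] (f x y) k x' = f x' y) ->
  (forall b x y, exec (body b) (f x y) (f x (upd b y)) cost) ->
  forall s y, exec (drain k body) (f s y) (f [::] (foldl (fun y b => upd b y) y s))
                ((cost + 3) * size s + 1).
Proof.
move=> fk fs fb; elim=> [|b s IH] y /=.
  by rewrite muln0; apply: exec_while_stop; rewrite fk.
apply: exec_weaken (exec_while_step _ _ (IH _)); first last.
- apply: exec_if_eq (erefl _) _; rewrite fk /=.
  have -> : (if Some b == Some true then SSeq (Pop k) (body true)
             else SSeq (Pop k) (body false)) = SSeq (Pop k) (body b) by case: b.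
  by apply: exec_seq (fb b s y); apply: exec_pop_eq; rewrite fk fs.
- by rewrite fk.
- by rewrite mulnS; lia.
Qed.

(** The end of a tree in prefix notation is found by counting the subtrees still to be read: [sC]
    holds this number in unary, a node raises it by one and a leaf lowers it by one. The tree
    arrives on [k] reversed, and [move_back] restores the order. *)
Definition move_top (k : 'I_5) : scmd :=
  SSeq (Push sC true)
    (SWhile sC (fun o => o != None)
      (SIf sD (Some true)
        (SSeq (Pop sD) (SSeq (Push k true) (Push sC true)))
        (SSeq (Pop sD) (SSeq (Push k false) (Pop sC))))).

Lemma exec_move_top (k : 'I_5) (f : seq bool -> seq bool -> seq bool -> stacks) :
  (forall d c x, stack (f d c x) sD = d) ->
  (forall d c x, stack (f d c x) sC = c) ->
  (forall d c x, stack (f d c x) k = x) ->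
  (forall d c x y, set_nth [::] (f d c x) sD y = f y c x) ->
  (forall d c x y, set_nth [::] (f d c x) sC y = f d y x) ->
  (forall d c x y, set_nth [::] (f d c x) k y = f d c y) ->
  forall t r x, exec (move_top k) (f (enc_tree t ++ r) [::] x)
    (f r [::] (rev (enc_tree t) ++ x)) (12 * size (enc_tree t) + 3).
Proof.
move=> gD gC gk uD uC uk t r x.
apply: exec_weaken (exec_seq (t1 := 2) (t2 := 12 * size (enc_tree t) + 1)
  (S2 := f (enc_tree t ++ r) [:: true] x) _ _); first by lia.
  by apply: exec_push_eq; rewrite gC uC.
set W := SWhile _ _ _.
(* The remainder of the loop is a hypothesis with an arbitrary cost, so that at a node the two
   induction hypotheses can be chained. *)
suff loop : forall c S' cost,
    exec W (f r c (rev (enc_tree t) ++ x)) S' cost ->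
    exec W (f (enc_tree t ++ r) (true :: c) x) S'
      (12 * size (enc_tree t) + cost).
  by apply: loop; apply: exec_while_stop; rewrite gC.
elim: t r x => [|a IHa b IHb] r x c S' cost H /=.
- apply: exec_weaken (exec_while_step _ (S1 := f r c (false :: x)) (t1 := 5)
    _ H); [by lia|by rewrite gC|].
  apply: exec_if_eq; first by rewrite gD.
  apply: (exec_seq (t1 := 1) (t2 := 3) (S2 := f r (true :: c) x)).
    by apply: exec_pop_eq; rewrite gD uD.
  apply: (exec_seq (t1 := 2) (t2 := 1) (S2 := f r (true :: c) (false :: x))).
    by apply: exec_push_eq; rewrite gk uk.
  by apply: exec_pop_eq; rewrite gC uC.
- apply: (@exec_weaken _ _ _ (6 + (12 * size (enc_tree a) +
    (12 * size (enc_tree b) + cost))).+1); first by rewrite size_cat; lia.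
  rewrite -catA; apply: exec_while_step; first by rewrite gC.
    apply: exec_if_eq; first by rewrite gD.
    apply: (exec_seq (t1 := 1) (t2 := 4)
      (S2 := f (enc_tree a ++ enc_tree b ++ r) (true :: c) x)).
      by apply: exec_pop_eq; rewrite gD uD.
    apply: (exec_seq (t1 := 2) (t2 := 2)
      (S2 := f (enc_tree a ++ enc_tree b ++ r) (true :: c) (true :: x))).
      by apply: exec_push_eq; rewrite gk uk.
    by apply: exec_push_eq; rewrite gC uC.
  apply: IHa; apply: IHb; move: H.
  by rewrite /= rev_cons rev_cat -cats1 -!catA.
Qed.

Definition move_back (k : 'I_5) : scmd := drain k (Push sD).

Lemma foldl_cons (T : Type) (y s : seq T) :
  foldl (fun y b => b :: y) y s = rev s ++ y.
Proof. by elim: s y => //= b s IH y; rewrite IH rev_cons cat_rcons. Qed.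

Lemma exec_move_back (k : 'I_5) (f : seq bool -> seq bool -> stacks) :
  (forall x y, stack (f x y) k = x) ->
  (forall x y, stack (f x y) sD = y) ->
  (forall x x' y, set_nth [::] (f x y) k x' = f x' y) ->
  (forall x y y', set_nth [::] (f x y) sD y' = f x y') ->
  forall s y, exec (move_back k) (f s y) (f [::] (rev s ++ y)) (5 * size s + 1).
Proof.
move=> gk gD uk uD s y; rewrite -foldl_cons.
apply: (exec_drain (f := f) (upd := cons) (cost := 2) gk uk) => b {}x {}y.
by apply: exec_push_eq; rewrite gD uD.
Qed.

Lemma move_topA t r x b e :
  exec (move_top sA) [:: enc_tree t ++ r; x; b; [::]; e]
    [:: r; rev (enc_tree t) ++ x; b; [::]; e] (12 * size (enc_tree t) + 3).
Proof. exact: (exec_move_top (f := fun d c x => [:: d; x; b; c; e])). Qed.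

Lemma move_topB t r a x e :
  exec (move_top sB) [:: enc_tree t ++ r; a; x; [::]; e]
    [:: r; a; rev (enc_tree t) ++ x; [::]; e] (12 * size (enc_tree t) + 3).
Proof. exact: (exec_move_top (f := fun d c x => [:: d; a; x; c; e])). Qed.

Lemma move_topE t r a b x :
  exec (move_top sE) [:: enc_tree t ++ r; a; b; [::]; x]
    [:: r; a; b; [::]; rev (enc_tree t) ++ x] (12 * size (enc_tree t) + 3).
Proof. exact: (exec_move_top (f := fun d c x => [:: d; a; b; c; x])). Qed.

Lemma move_backA s d b c e :
  exec (move_back sA) [:: d; rev s; b; c; e] [:: s ++ d; [::]; b; c; e]
    (5 * size s + 1).
Proof.
rewrite -{2}(revK s) -(size_rev s).
exact: (exec_move_back (f := fun x d => [:: d; x; b; c; e])).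
Qed.

Lemma move_backB s d a c e :
  exec (move_back sB) [:: d; a; rev s; c; e] [:: s ++ d; a; [::]; c; e]
    (5 * size s + 1).
Proof.
rewrite -{2}(revK s) -(size_rev s).
exact: (exec_move_back (f := fun x d => [:: d; a; x; c; e])).
Qed.

Lemma move_backE s d a b c :
  exec (move_back sE) [:: d; a; b; c; rev s] [:: s ++ d; a; b; c; [::]]
    (5 * size s + 1).
Proof.
rewrite -{2}(revK s) -(size_rev s).
exact: (exec_move_back (f := fun x d => [:: d; a; b; c; x])).
Qed.

Definition data (d : seq bool) : stacks := [:: d; [::]; [::]; [::]; [::]].

Lemma exec_popD b d : exec (Pop sD) (data (b :: d)) (data d) 1.
Proof. exact: exec_pop_eq. Qed.

Lemma exec_pushD b d : exec (Push sD b) (data d) (data (b :: d)) 2.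
Proof. exact: exec_push_eq. Qed.

Definition push_word (s : seq bool) : scmd :=
  foldr (fun b c => SSeq c (Push sD b)) skip s.

Lemma exec_push_word s d :
  exec (push_word s) (data d) (data (s ++ d)) (2 * size s + 1).
Proof.
elim: s => [|b s IH] /=; first exact: exec_skip.
by apply: exec_weaken (exec_seq IH (exec_pushD _ _)); lia.
Qed.

Definition drop_top : scmd := SSeq (move_top sA) (drain sA (fun _ => skip)).

Lemma exec_drop_top t r :
  exec drop_top (data (enc_tree t ++ r)) (data r) (16 * size (enc_tree t) + 4).
Proof.
have := @exec_drain sA (fun _ => skip) unit (fun x _ => [:: r; x; [::]; [::]; [::]])
  (fun _ y => y) 1 _ _ _ (rev (enc_tree t)) tt.
rewrite size_rev => H; have := move_topA t r [::] [::] [::].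
rewrite cats0 => H1; apply: exec_weaken (exec_seq H1 (H _ _ _)); first by lia.
- by [].
- by [].
- by move=> *; apply: exec_skip.
Qed.

Definition swap_top : scmd :=
  SSeq (move_top sA) (SSeq (move_top sB) (SSeq (move_back sA) (move_back sB))).

Lemma exec_swap_top t u r :
  exec swap_top (data (enc_tree t ++ enc_tree u ++ r))
    (data (enc_tree u ++ enc_tree t ++ r))
    (17 * (size (enc_tree t) + size (enc_tree u)) + 8).
Proof.
have H1 := move_topA t (enc_tree u ++ r) [::] [::] [::].
have H2 := move_topB u r (rev (enc_tree t)) [::] [::].
rewrite !cats0 in H1 H2.
have H3 := move_backA (enc_tree t) r (rev (enc_tree u)) [::] [::].
have H4 := move_backB (enc_tree u) (enc_tree t ++ r) [::] [::] [::].
apply: exec_weaken (exec_seq H1 (exec_seq H2 (exec_seq H3 H4))); lia.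
Qed.

(** Made for folds: a list [a :: u] above a state [s] reads [a], [u], [s] after one pop, and the
    step function needs the pair of [a] and [s] above [u]. *)
Definition rotate_top : scmd :=
  SSeq (move_top sA) (SSeq (move_top sB) (SSeq (move_top sE)
    (SSeq (move_back sB) (SSeq (move_back sE) (move_back sA))))).

Lemma exec_rotate_top t u v r :
  exec rotate_top (data (enc_tree t ++ enc_tree u ++ enc_tree v ++ r))
    (data (enc_tree t ++ enc_tree v ++ enc_tree u ++ r))
    (17 * (size (enc_tree t) + size (enc_tree u) + size (enc_tree v)) + 12).
Proof.
have H1 := move_topA t (enc_tree u ++ enc_tree v ++ r) [::] [::] [::].
have H2 := move_topB u (enc_tree v ++ r) (rev (enc_tree t)) [::] [::].
have H3 := move_topE v r (rev (enc_tree t)) (rev (enc_tree u)) [::].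
rewrite !cats0 in H1 H2 H3.
have H4 := move_backB (enc_tree u) r (rev (enc_tree t)) [::] (rev (enc_tree v)).
have H5 := move_backE (enc_tree v) (enc_tree u ++ r) (rev (enc_tree t)) [::] [::].
have H6 := move_backA (enc_tree t) (enc_tree v ++ enc_tree u ++ r) [::] [::] [::].
apply: exec_weaken (exec_seq H1 (exec_seq H2 (exec_seq H3 (exec_seq H4
  (exec_seq H5 H6))))); lia.
Qed.

Definition dup_top : scmd :=
  SSeq (move_top sA) (SSeq (drain sA (fun b => SSeq (Push sD b) (Push sB b)))
    (SSeq (drain sB (Push sA)) (move_back sA))).

Lemma exec_dup_top t r :
  exec dup_top (data (enc_tree t ++ r)) (data (enc_tree t ++ enc_tree t ++ r))
    (29 * size (enc_tree t) + 6).
Proof.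
set e := enc_tree t.
have H1 := move_topA t r [::] [::] [::]; rewrite cats0 in H1.
have H2 : exec (drain sA (fun b => SSeq (Push sD b) (Push sB b)))
    [:: r; rev e; [::]; [::]; [::]] [:: e ++ r; [::]; e; [::]; [::]]
    (7 * size e + 1).
  have := @exec_drain sA (fun b => SSeq (Push sD b) (Push sB b))
    (seq bool * seq bool) (fun x y => [:: y.1; x; y.2; [::]; [::]])
    (fun b y => (b :: y.1, b :: y.2)) 4 _ _ _ (rev e) (r, [::]).
  have -> : foldl (fun y b => (b :: y.1, b :: y.2)) (r, [::]) (rev e) =
      (e ++ r, e).
    suff E s x y : foldl (fun (y : seq bool * seq bool) b => (b :: y.1, b :: y.2))
        (x, y) s = (rev s ++ x, rev s ++ y) by rewrite E revK cats0.
    by elim: s x y => //= b s IH x y; rewrite IH !rev_cons !cat_rcons.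
  rewrite size_rev; apply=> // b x [y z].
  by apply: (@exec_seq _ _ _ _ _ 2 2); apply: exec_push_eq.
have H3 : exec (drain sB (Push sA)) [:: e ++ r; [::]; e; [::]; [::]]
    [:: e ++ r; rev e; [::]; [::]; [::]] (5 * size e + 1).
  have := @exec_drain sB (Push sA) (seq bool)
    (fun x y => [:: e ++ r; y; x; [::]; [::]]) cons 2 _ _ _ e [::].
  rewrite foldl_cons cats0; apply=> // b x y.
  exact: exec_push_eq.
have H4 := move_backA e (e ++ r) [::] [::] [::].
apply: exec_weaken (exec_seq H1 (exec_seq H2 (exec_seq H3 H4))); rewrite -/e; lia.
Qed.

(** * Functions computable in polynomial time by stack programs *)

Class code A := code_of : A -> tree.

#[global] Instance code_bool : code bool :=
  fun b => if b then Node Leaf Leaf else Leaf.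
#[global] Instance code_prod A B {cA : code A} {cB : code B} : code (A * B) :=
  fun p => Node (code_of p.1) (code_of p.2).
(** The code of [a :: s] is that of the pair [(a, s)], and an option will be coded as a list of
    length at most one. The programs for pairs thus serve lists and options by conversion. *)
#[global] Instance code_seq A {cA : code A} : code (seq A) :=
  fun s => foldr (fun x t => Node (code_of x) t) Leaf s.
#[global] Instance code_option A {cA : code A} : code (option A) :=
  fun o => if o is Some x then Node (code_of x) Leaf else Leaf.

Definition enc A {cA : code A} (x : A) : seq bool := enc_tree (code_of x).
Definition sz A {cA : code A} (x : A) : nat := size (enc x).

(** With a base of at least 2, a single exponent absorbs constants, sums and products. *)
Definition pbound A {cA : code A} (h : A -> nat) : Prop :=
  exists d, forall x, h x <= (sz x).+2 ^ d.

(** The bound on the output is carried along to bound the cost of a program that continues with it.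
    The arbitrary [r] lets a program run on top of saved data. *)
Definition FP A B {cA : code A} {cB : code B} (f : A -> B) : Prop :=
  pbound (fun x => sz (f x)) /\
  exists c h, pbound h /\ forall x r,
    exec c (data (enc x ++ r)) (data (enc (f x) ++ r)) (h x).

Section Sizes.

Context {A B : Type} {cA : code A} {cB : code B}.

Lemma sz_gt0 (x : A) : 0 < sz x.
Proof. by rewrite /sz /enc; case: code_of. Qed.

Lemma sz_pair (x : A) (y : B) : sz (x, y) = (sz x + sz y).+1.
Proof. by rewrite /sz /enc /= size_cat. Qed.

Lemma sz_nil : sz ([::] : seq A) = 1.
Proof. by []. Qed.

Lemma sz_cons (x : A) s : sz (x :: s) = (sz x + sz s).+1.
Proof. by rewrite /sz /enc /= size_cat. Qed.

Lemma sz_None : sz (None : option A) = 1.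
Proof. by []. Qed.

Lemma sz_Some (x : A) : sz (Some x) = (sz x).+2.
Proof. by rewrite /sz /enc /= size_cat /= addn1. Qed.

Lemma sz_bool (b : bool) : sz b <= 3.
Proof. by case: b. Qed.

Lemma sz_size (s : seq A) : size s < sz s.
Proof. by elim: s => //= x s IH; rewrite sz_cons; lia. Qed.

Lemma sz_take k (s : seq A) : sz (take k s) <= sz s.
Proof.
elim: s k => [|x s IH] [|k] //=; rewrite ?sz_cons ?sz_nil // ltnS.
by rewrite leq_add2l IH.
Qed.

End Sizes.

Section Bounds.

Context {A : Type} {cA : code A}.
Implicit Types h k : A -> nat.

Lemma pbound_le h k : (forall x, h x <= k x) -> pbound k -> pbound h.
Proof. by move=> le [d H]; exists d => x; apply: leq_trans (le x) (H x). Qed.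

Lemma pbound_cst n : pbound (fun _ : A => n).
Proof.
exists n => x; by apply: (@leq_trans (2 ^ n)); [exact: ltnW (ltn_expl _
  _)|case: n => // n; rewrite leq_exp2r].
Qed.

Lemma pbound_sz : pbound (fun x : A => sz x).
Proof. by exists 1 => x; rewrite expn1; lia. Qed.

Lemma pbound_mul h k : pbound h -> pbound k -> pbound (fun x => h x * k x).
Proof. by move=> [d H] [e K]; exists (d + e) => x; rewrite expnD leq_mul. Qed.

Lemma pbound_add h k : pbound h -> pbound k -> pbound (fun x => h x + k x).
Proof.
move=> [d H] [e K]; exists (d + e).+1 => x.
apply: leq_trans (leq_add (H x) (K x)) _.
rewrite expnS; apply: (@leq_trans (2 * (sz x).+2 ^ (d + e))).
  by rewrite mul2n -addnn leq_add // leq_pexp2l ?leq_addr ?leq_addl.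
by rewrite leq_mul.
Qed.

Lemma pbound_S h : pbound h -> pbound (fun x => (h x).+1).
Proof.
by move=> H; apply: pbound_le (pbound_add H (pbound_cst 1)) => x; rewrite addn1.
Qed.

Lemma pbound_exp h d : pbound h -> pbound (fun x => h x ^ d).
Proof. by move=> [e H]; exists (e * d) => x; rewrite expnM; case: d => [|d];
  rewrite ?expn0 ?leq_exp2r. Qed.

End Bounds.
Ltac pb := repeat first
  [ exact: pbound_sz | exact: pbound_cst | assumption
  | apply: pbound_add | apply: pbound_mul | apply: pbound_exp
  | apply: pbound_S ].

Section Closure.

Context {X A B : Type} {cX : code X} {cA : code A} {cB : code B}.

Lemma pbound_comp (h : A -> nat) (f : X -> A) :
  pbound h -> pbound (fun x => sz (f x)) -> pbound (fun x => h (f x)).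
Proof.
by move=> [d H] K; apply: (@pbound_le _ _ _ _ (fun x => H (f x))); pb.
Qed.

Lemma FP_id : FP (fun x : X => x).
Proof.
split; first exact: pbound_sz.
exists skip, (fun=> 1); split; first exact: pbound_cst.
by move=> x r; apply: exec_skip.
Qed.

Lemma FP_comp (f : X -> A) (g : A -> B) : FP g -> FP f -> FP (fun x => g (f x)).
Proof.
move=> [sg [cg [hg [pg Hg]]]] [sf [cf [hf [pf Hf]]]].
split; first exact: (pbound_comp (h := fun y => sz (g y))).
exists (SSeq cf cg), (fun x => hf x + hg (f x)); split.
  by apply: pbound_add => //; apply: (pbound_comp (h := hg)).
by move=> x r; apply: exec_seq (Hf x r) (Hg (f x) r).
Qed.

Lemma FP_cst (b : B) : FP (fun _ : X => b).
Proof.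
split; first exact: pbound_cst.
exists (SSeq drop_top (push_word (enc b))),
  (fun x => 16 * sz x + 4 + (2 * sz b + 1)); split; first by pb.
by move=> x r; apply: exec_seq (exec_drop_top _ _) (exec_push_word _ _).
Qed.

Lemma FP_pair (f : X -> A) (g : X -> B) :
  FP f -> FP g -> FP (fun x => (f x, g x)).
Proof.
move=> [sf [cf [hf [pf Hf]]]] [sg [cg [hg [pg Hg]]]]; split.
  apply: (@pbound_le _ _ _ (fun x => (sz (f x) + sz (g x)).+1)); last by pb.
  by move=> x; rewrite sz_pair.
exists (SSeq dup_top (SSeq cf (SSeq swap_top (SSeq cg (SSeq swap_top
  (Push sD true)))))).
exists (fun x => 29 * sz x + 6 + (hf x + (17 * (sz (f x) + sz x) + 8 + (hg x +
  (17 * (sz (g x) + sz (f x)) + 8 + 2))))); split; last first.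
  move=> x r.
  apply: exec_seq (exec_dup_top _ _) _.
  apply: exec_seq (Hf _ _) _.
  apply: exec_seq (exec_swap_top _ _ _) _.
  apply: exec_seq (Hg _ _) _.
  apply: exec_seq (exec_swap_top _ _ _) _.
  have -> : enc (f x, g x) ++ r = true :: enc (f x) ++ enc (g x) ++ r.
    by rewrite /enc /= -catA.
  exact: exec_pushD.
by pb.
Qed.

End Closure.

Section Destructors.

Context {X A B : Type} {cX : code X} {cA : code A} {cB : code B}.

Lemma FP_fst (f : X -> A * B) : FP f -> FP (fun x => (f x).1).
Proof.
apply: (FP_comp (g := @fst A B)); split.
  by apply: pbound_le pbound_sz => -[a b]; rewrite sz_pair /=; lia.
exists (SSeq (Pop sD) (SSeq swap_top drop_top)),
  (fun p => 1 + (17 * (sz p.1 + sz p.2) + 8 + (16 * sz p.2 + 4))); split.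
  apply: (@pbound_le _ _ _ (fun p => 40 * sz p + 20)).
    by move=> [a b]; rewrite sz_pair /=; lia.
  by pb.
move=> [a b] r.
have -> : enc (a, b) ++ r = true :: enc a ++ enc b ++ r by rewrite /enc /= catA.
apply: exec_seq (exec_popD _ _) _.
exact: exec_seq (exec_swap_top _ _ _) (exec_drop_top _ _).
Qed.

Lemma FP_snd (f : X -> A * B) : FP f -> FP (fun x => (f x).2).
Proof.
apply: (FP_comp (g := @snd A B)); split.
  by apply: pbound_le pbound_sz => -[a b]; rewrite sz_pair /=; lia.
exists (SSeq (Pop sD) drop_top), (fun p => 1 + (16 * sz p.1 + 4)); split.
  apply: (@pbound_le _ _ _ (fun p => 40 * sz p + 20)).
    by move=> [a b]; rewrite sz_pair /=; lia.
  by pb.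
move=> [a b] r.
have -> : enc (a, b) ++ r = true :: enc a ++ enc b ++ r by rewrite /enc /= catA.
exact: exec_seq (exec_popD _ _) (exec_drop_top _ _).
Qed.

Lemma FP_cons (f : X -> A) (g : X -> seq A) :
  FP f -> FP g -> FP (fun x => f x :: g x).
Proof. exact: FP_pair. Qed.

Lemma FP_Some (f : X -> A) : FP f -> FP (fun x => Some (f x)).
Proof. by move=> H; exact: (FP_pair H (FP_cst ([::] : seq A))). Qed.

Lemma FP_if (b : X -> bool) (f g : X -> B) :
  FP b -> FP f -> FP g -> FP (fun x => if b x then f x else g x).
Proof.
move=> [_ [cb [hb [pb Hb]]]] [sf [cf [hf [pf Hf]]]] [sg [cg [hg [pg Hg]]]].
split.
  apply: (@pbound_le _ _ _ (fun x => sz (f x) + sz (g x))); last by pb.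
  by move=> x; case: (b x); lia.
(* The code of [true] has three bits and that of [false] one, hence three pops in one branch and one
   in the other. *)
exists (SSeq dup_top (SSeq cb (SIf sD (Some true)
  (SSeq (Pop sD) (SSeq (Pop sD) (SSeq (Pop sD) cf))) (SSeq (Pop sD) cg)))).
exists (fun x => 29 * sz x + 6 + (hb x + (hf x + hg x + 3).+1)); split; first by pb.
move=> x r.
apply: exec_seq (exec_dup_top _ _) _; apply: exec_seq (Hb _ _) _.
case: (b x) => /=.
- apply: exec_if_eq (erefl _) _.
  apply: exec_weaken (exec_seq (exec_popD _ _) (exec_seq (exec_popD _ _)
    (exec_seq (exec_popD _ _) (Hf _ _)))); lia.
- apply: exec_if_eq (erefl _) _.
  apply: exec_weaken (exec_seq (exec_popD _ _) (Hg _ _)); lia.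
Qed.

(** In the nonempty case nothing is taken apart: [a :: s] has the code of [(a, s)], so swapping it
    below [x] and pushing one bit yields the argument of [h]. *)
Lemma FP_case (f : X -> seq A) (g : X -> B) (h : X * (A * seq A) -> B) :
  FP f -> FP g -> FP h ->
  FP (fun x => if f x is a :: s then h (x, (a, s)) else g x).
Proof.
move=> [sf [cf [hf [pf Hf]]]] [sg [cg [hg [pg Hg]]]].
move=> [[d sh] [ch [hh [[e ph] Hh]]]].
pose (K := fun x : X => sz x + sz (f x)).
have pK : pbound (fun x => (K x).+3) by pb.
have sK x a s : f x = a :: s -> sz (x, (a, s)) = (K x).+1.
  by rewrite !sz_pair /K => ->; rewrite sz_cons; lia.
split.
  apply: (@pbound_le _ _ _ (fun x => sz (g x) + (K x).+3 ^ d)); last by pb.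
  move=> x; case E: (f x) => [|a s]; first by lia.
  by apply: leq_trans (sh _) _; rewrite (sK _ _ _ E); lia.
exists (SSeq dup_top (SSeq cf (SIf sD (Some true)
  (SSeq swap_top (SSeq (Push sD true) ch)) (SSeq (Pop sD) cg)))).
exists (fun x => 29 * sz x + 6 + (hf x + (17 * (sz (f x) + sz x) + 11 + hg x +
  (K x).+3 ^ e).+1)); split; first by pb.
move=> x r.
apply: exec_seq (exec_dup_top _ _) _; apply: exec_seq (Hf _ _) _.
case E: (f x) => [|a s].
- apply: exec_if_eq (erefl _) _.
  apply: exec_weaken (exec_seq (exec_popD _ _) (Hg _ _)); lia.
- apply: (exec_if_eq (a := SSeq swap_top (SSeq (Push sD true) ch))) => //.
  have H3 := Hh (x, (a, s)) r.
  have E3 : enc (x, (a, s)) ++ r = true :: enc x ++ enc (a :: s) ++ r.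
    by rewrite /enc /= -!catA /= -?catA.
  rewrite E3 in H3.
  apply: exec_weaken (exec_seq (exec_swap_top _ _ _) (exec_seq (exec_pushD _ _)
    H3)).
  have := ph (x, (a, s)); rewrite (sK _ _ _ E) /sz /enc; lia.
Qed.

End Destructors.

Lemma FP_eq X A {cX : code X} {cA : code A} (f g : X -> A) :
  f =1 g -> FP f -> FP g.
Proof. by move=> /funext ->. Qed.

Lemma FP_omatch X A B {cX : code X} {cA : code A} {cB : code B}
    (f : X -> option A) (g : X -> B) (h : X -> A -> B) :
  FP f -> FP g -> FP (fun p => h p.1 p.2) ->
  FP (fun x => if f x is Some a then h x a else g x).
Proof.
move=> Hf Hg Hh.
pose f' := fun x => if f x is Some a then [:: a] else [::].
have Hf' : FP f'.
  have E x : enc (f' x) = enc (f x) by rewrite /f' /enc; case: (f x).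
  case: Hf => [sf [cf [hf [pf Hf]]]]; split.
    by apply: pbound_le sf => x; rewrite /sz E.
  by exists cf, hf; split => // x r; rewrite E.
have Hh' : FP (fun p : X * (A * seq A) => h p.1 p.2.1).
  apply: (FP_comp (g := fun p => h p.1 p.2) (f := fun p => (p.1, p.2.1))) => //.
  by apply: FP_pair; do ?apply: FP_fst; [|apply: FP_snd]; apply: FP_id.
by apply: FP_eq (FP_case Hf' Hg Hh') => x; rewrite /f'; case: (f x).
Qed.

Lemma FP_match X A B {cX : code X} {cA : code A} {cB : code B}
    (f : X -> seq A) (g : X -> B) (h : X -> A -> seq A -> B) :
  FP f -> FP g -> FP (fun p => h p.1 p.2.1 p.2.2) ->
  FP (fun x => if f x is a :: s then h x a s else g x).
Proof. by move=> Hf Hg Hh; apply: FP_case Hf Hg Hh. Qed.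

Section Fold.

Context {X A S : Type} {cX : code X} {cA : code A} {cS : code S}.

(** Iterating a polynomial-time step can square the state each time and blow up. The last hypothesis
    therefore bounds the states after all prefixes; the time is then the length of the list times
    the cost of a step on such states. *)
Lemma FP_foldl_aux (l : X -> seq A) (s0 : X -> S) (g : S -> A -> S) :
  FP l -> FP s0 -> FP (fun p : A * S => g p.2 p.1) ->
  pbound (fun x => \max_(k < (size (l x)).+1) sz (foldl g (s0 x) (take k (l x)))) ->
  FP (fun x => foldl g (s0 x) (l x)).
Proof.
move=> Hl Hs [[d sg] [cg [hg [[e pg] Hg]]]] pM.
set (M := fun x : X => _) in pM.
have leM x k : k <= size (l x) -> sz (foldl g (s0 x) (take k (l x))) <= M x.
  rewrite -ltnS => lt; rewrite /M.
  exact: (leq_bigmax (Ordinal lt)).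
split.
  by apply: pbound_le pM => x; rewrite -{1}(take_size (l x)) leM.
have [_ [cp [hp [pp Hp]]]] := FP_pair Hl Hs.
have pl : pbound (fun x => sz (l x)) by case: Hl.
pose (L := fun x => sz (l x) + M x).
pose W := SWhile sD (fun o => o == Some true)
  (SSeq (Pop sD) (SSeq rotate_top (SSeq (Push sD true) (SSeq cg swap_top)))).
exists (SSeq cp (SSeq (Pop sD) (SSeq W (Pop sD)))).
pose (step := fun x : X => 60 * L x + 60 + (L x).+3 ^ e).
exists (fun x => hp x + (1 + ((step x * sz (l x)).+1 + 1))).
have pL : pbound L by apply: pbound_add.
split; first by rewrite /step; pb.
move=> x r; apply: exec_seq (Hp x r) _.
have -> : enc (l x, s0 x) ++ r = true :: enc (l x) ++ enc (s0 x) ++ r.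
  by rewrite /enc /= catA.
apply: exec_seq (exec_popD _ _) _.
(* The exhausted list leaves its code, the single bit [false], above the final state. *)
apply: exec_seq; last exact: (exec_popD false).
enough (loop : forall k u s, k + size u = size (l x) -> drop k (l x) = u ->
    s = foldl g (s0 x) (take k (l x)) ->
    exec W (data (enc u ++ enc s ++ r))
      (data (false :: enc (foldl g s u) ++ r)) (step x * size u).+1).
  have := loop 0 (l x) (s0 x) (add0n _) (drop0 _); rewrite take0.
  move=> /(_ erefl); apply: exec_weaken.
  by rewrite ltnS leq_mul2l ltnW ?orbT //; apply: sz_size.
move=> k u; elim: u k => [|a u IH] k s Ek Ed Es.
  by rewrite muln0; apply: exec_while_stop.
have lk : k < size (l x) by rewrite -Ek /= addnS ltnS leq_addr.
have Eu : drop k.+1 (l x) = u by rewrite -addn1 addnC -drop_drop Ed /= drop0.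
have Et : take k.+1 (l x) = rcons (take k (l x)) a.
  by rewrite (take_nth a) // -[k in nth _ _ k]addn0 -nth_drop Ed.
have Eg : g s a = foldl g (s0 x) (take k.+1 (l x)).
  by rewrite Et -cats1 foldl_cat -Es.
have bs : sz s <= M x by rewrite Es leM // ltnW.
have bg : sz (g s a) <= M x by rewrite Eg leM.
have bu : sz a + sz u < sz (l x).
  rewrite -sz_cons -Ed; elim: k (l x) {lk Et Eu Ek Es bs bg Eg IH Ed} => [|k
    IH] v; first by rewrite drop0.
  case: v => // b v; apply: leq_trans (IH v) _; rewrite sz_cons; lia.
have E3 : enc (a, s) ++ enc u ++ r = true :: enc a ++ enc s ++ enc u ++ r.
  by rewrite /enc /= -!catA.
have E1 : enc (a :: u) ++ enc s ++ r = true :: enc a ++ enc u ++ enc s ++ r.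
  by rewrite /enc /= -!catA.
have H3 : exec cg (data (true :: enc a ++ enc s ++ enc u ++ r))
    (data (enc (g s a) ++ enc u ++ r)) (hg (a, s)) by rewrite -E3; apply: Hg.
rewrite E1.
have ph : hg (a, s) <= (L x).+3 ^ e.
  apply: leq_trans (pg (a, s)) _; rewrite sz_pair.
  by case: (e) => [|n]; rewrite ?expn0 // leq_exp2r // /L; lia.
apply: exec_weaken (exec_while_step _ (exec_seq (exec_popD _ _)
  (exec_seq (exec_rotate_top _ _ _ _) (exec_seq (exec_pushD _ _)
  (exec_seq H3 (exec_swap_top _ _ _))))) (IH k.+1 _ _ Eu Eg)) => //.
- rewrite ltnS /= mulnS addnS -addSn leq_add2r /step.
  rewrite /sz /enc in bs bg bu ph *; rewrite /L /sz /enc in ph *; lia.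
- by rewrite addSn -addnS.
Qed.

End Fold.

Ltac fp_step :=
  lazymatch goal with
  | |- FP (fun x => x) => exact: FP_id
  | |- FP (@fst _ _) => exact: (FP_fst FP_id)
  | |- FP (@snd _ _) => exact: (FP_snd FP_id)
  | |- FP (fun x => fst (@?f x)) => apply: (FP_fst (f := f))
  | |- FP (fun x => snd (@?f x)) => apply: (FP_snd (f := f))
  | |- FP (fun x => (@?f x, @?g x)) => apply: (FP_pair (f := f) (g := g))
  | |- FP (fun x => @?f x :: @?g x) => apply: (FP_cons (f := f) (g := g))
  | |- FP (fun x => Some (@?f x)) => apply: (FP_Some (f := f))
  | |- FP (fun _ => _) => first [assumption | exact: FP_cst | apply: FP_if]
  | |- FP _ => assumption
  end.
Ltac fp := cbv beta; repeat fp_step.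

Section FoldContext.

Context {X A S : Type} {cX : code X} {cA : code A} {cS : code S}.

Lemma FP_foldl_bounded (l : X -> seq A) (s0 : X -> S) (g : X -> S -> A -> S)
    (K : X -> nat) :
  FP l -> FP s0 -> FP (fun p : X * S * A => g p.1.1 p.1.2 p.2) -> pbound K ->
  (forall x k, sz (foldl (g x) (s0 x) (take k (l x))) <= K x) ->
  FP (fun x => foldl (g x) (s0 x) (l x)).
Proof.
move=> Hl Hs Hg pK le.
(* The step may consult the context [x], which is therefore made part of the state. *)
pose (g' := fun (p : X * S) a => (p.1, g p.1 p.2 a)).
have E x s u : foldl g' (x, s) u = (x, foldl (g x) s u).
  by elim: u s => //= a u IH s; rewrite IH.
have H : FP (fun x => foldl g' (x, s0 x) (l x)).
  apply: FP_foldl_aux => //; first by fp.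
    apply: FP_pair; first by fp.
    apply: (FP_comp (g := fun p : X * S * A => g p.1.1 p.1.2 p.2)
      (f := fun p => (p.2, p.1))) => //; fp.
  apply: (@pbound_le _ _ _ (fun x => (sz x + K x).+1)); last by pb.
  move=> x; apply/bigmax_leqP => k _; rewrite E sz_pair ltnS leq_add2l.
  exact: le.
by apply: FP_eq (FP_snd H) => x; rewrite E.
Qed.

(** A growth per step that is additive and independent of the state adds up to a polynomial over the
    length of the list. Only elements smaller than the whole list can occur. *)
Lemma FP_foldl (l : X -> seq A) (s0 : X -> S) (g : X -> S -> A -> S)
    (K : X -> nat) :
  FP l -> FP s0 -> FP (fun p : X * S * A => g p.1.1 p.1.2 p.2) -> pbound K ->
  (forall x s a, sz a < sz (l x) -> sz (g x s a) <= sz s + K x) ->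
  FP (fun x => foldl (g x) (s0 x) (l x)).
Proof.
move=> Hl Hs Hg pK le.
have [ps _] := Hs; have [pl _] := Hl.
apply: (@FP_foldl_bounded _ _ _ (fun x => sz (s0 x) + sz (l x) * K x)) => //.
  by pb.
move=> x k.
enough (H : forall u s, (forall v a w, u = v ++ a :: w -> sz a < sz (l x)) ->
  sz (foldl (g x) s u) <= sz s + size u * K x).
  apply: leq_trans (H _ _ _) _.
    move=> v a w E.
    have: sz (take k (l x)) <= sz (l x) by apply: sz_take.
    rewrite E; elim: v {E} => [|b v IH] /=; rewrite sz_cons; first by lia.
    by move=> H1; apply: IH; lia.
  rewrite leq_add2l leq_mul2r; apply/orP; right.
  by apply: leq_trans (ltnW (sz_size _)); rewrite size_take_min geq_minr.
elim=> [|a u IH] s Hu /=; first by rewrite addn0.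
apply: leq_trans (IH _ _) _.
  by move=> v b w E; apply: (Hu (a :: v) b w); rewrite E.
have := le x s a (Hu [::] a u erefl); lia.
Qed.

End FoldContext.

(** * Booleans, lists and options in the class *)

Lemma FP_negb X {cX : code X} (f : X -> bool) : FP f -> FP (fun x => ~~ f x).
Proof.
by move=> H; apply: (@FP_eq _ _ _ _ (fun x => if f x then false else true)); fp.
Qed.

Lemma FP_andb X {cX : code X} (f g : X -> bool) : FP f -> FP g -> FP (fun x =>
  f x && g x).
Proof.
move=> H1 H2.
by apply: (@FP_eq _ _ _ _ (fun x => if f x then g x else false)); fp.
Qed.

Lemma FP_orb X {cX : code X} (f g : X -> bool) : FP f -> FP g -> FP (fun x => f
  x || g x).
Proof.
move=> H1 H2.
by apply: (@FP_eq _ _ _ _ (fun x => if f x then true else g x)); fp.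
Qed.

Lemma FP_addb X {cX : code X} (f g : X -> bool) : FP f -> FP g -> FP (fun x =>
  f x (+) g x).
Proof.
move=> H1 H2; have H3 := FP_negb H2.
apply: (@FP_eq _ _ _ _ (fun x => if f x then ~~ g x else g x)); last by fp.
by move=> x; case: (f x).
Qed.

Lemma FP_eqb X {cX : code X} (f g : X -> bool) : FP f -> FP g -> FP (fun x => f
  x == g x).
Proof.
move=> H1 H2; have H3 := FP_negb H2.
apply: (@FP_eq _ _ _ _ (fun x => if f x then g x else ~~ g x)); last by fp.
by move=> x; case: (f x); case: (g x).
Qed.

Lemma FP_rev X {cX : code X} A {cA : code A} (f : X -> seq A) : FP f -> FP (fun
  x => rev (f x)).
Proof.
move=> H.
apply: (@FP_eq _ _ _ _ (fun x => foldl (fun y b => b :: y) [::] (f x))).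
  by move=> x; rewrite foldl_cons cats0.
have [pf _] := H.
apply: (@FP_foldl _ _ _ _ _ _ f _ (fun _ y b => b :: y) (fun x => sz (f x))) => //;
  try by fp.
by move=> x s a; rewrite sz_cons; lia.
Qed.

Lemma FP_cat X {cX : code X} A {cA : code A} (f g : X -> seq A) :
  FP f -> FP g -> FP (fun x => f x ++ g x).
Proof.
move=> H1 H2.
apply: (@FP_eq _ _ _ _ (fun x => foldl (fun y b => b :: y) (g x) (rev (f x)))).
  by move=> x; rewrite foldl_cons revK.
have H := FP_rev H1; have [pf _] := H.
apply: (@FP_foldl _ _ _ _ _ _ _ _ (fun _ y b => b :: y)
  (fun x => sz (rev (f x)))) => //; try by fp.
by move=> x s a; rewrite sz_cons; lia.
Qed.

Lemma FP_rcons X {cX : code X} A {cA : code A} (f : X -> seq A) (g : X -> A) :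
  FP f -> FP g -> FP (fun x => rcons (f x) (g x)).
Proof.
move=> H1 H2; apply: (@FP_eq _ _ _ _ (fun x => f x ++ [:: g x])).
  by move=> x; rewrite cats1.
by apply: FP_cat => //; fp.
Qed.

Lemma FP_behead X {cX : code X} A {cA : code A} (f : X -> seq A) :
  FP f -> FP (fun x => behead (f x)).
Proof.
move=> H.
apply: (@FP_eq _ _ _ _ (fun x => if f x is _ :: s then s else [::])).
  by move=> x; case: (f x).
by apply: FP_match => //; fp.
Qed.

Lemma FP_head X {cX : code X} A {cA : code A} (a0 : A) (f : X -> seq A) :
  FP f -> FP (fun x => head a0 (f x)).
Proof.
move=> H.
apply: (@FP_eq _ _ _ _ (fun x => if f x is a :: _ then a else a0)).
  by move=> x; case: (f x).
by apply: FP_match => //; fp.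
Qed.

Lemma FP_nilp X {cX : code X} A {cA : code A} (f : X -> seq A) : FP f -> FP
  (fun x => nilp (f x)).
Proof.
move=> H.
apply: (@FP_eq _ _ _ _ (fun x => if f x is _ :: _ then false else true)).
  by move=> x; case: (f x).
by apply: FP_match => //; fp.
Qed.

Lemma FP_nth X {cX : code X} A {cA : code A} (a0 : A) n (f : X -> seq A) :
  FP f -> FP (fun x => nth a0 (f x) n).
Proof.
elim: n f => [|n IH] f H.
  by apply: FP_eq (FP_head a0 H) => x; case: (f x).
by apply: FP_eq (IH _ (FP_behead H)) => x; rewrite nth_behead.
Qed.

Lemma FP_odflt X {cX : code X} A {cA : code A} (f : X -> option A) (g : X -> A) :
  FP f -> FP g -> FP (fun x => odflt (g x) (f x)).
Proof.
move=> H1 H2.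
apply: (@FP_eq _ _ _ _ (fun x => if f x is Some a then a else g x)).
  by move=> x; case: (f x).
by apply: FP_omatch => //; fp.
Qed.

Lemma FP_isSome X {cX : code X} A {cA : code A} (f : X -> option A) :
  FP f -> FP (fun x => f x : bool).
Proof.
move=> H1.
apply: (@FP_eq _ _ _ _ (fun x => if f x is Some a then true else false)).
  by move=> x; case: (f x).
by apply: FP_omatch => //; fp.
Qed.

Lemma FP_has X {cX : code X} A {cA : code A} (l : X -> seq A) (p : X -> A -> bool) :
  FP l -> FP (fun q : X * A => p q.1 q.2) -> FP (fun x => has (p x) (l x)).
Proof.
move=> Hl Hp.
apply: (@FP_eq _ _ _ _
  (fun x => foldl (fun b a => b || p x a) false (l x))).
  move=> x; rewrite -[RHS]orFb; elim: (l x) false => /= [|a s IH] b.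
    by rewrite orbF.
  by rewrite IH orbA.
apply: (@FP_foldl _ _ _ _ _ _ _ _ (fun x b a => b || p x a) (fun=> 3)) => //.
- by fp.
- cbv beta; apply: FP_orb; first by fp.
  by apply: (FP_comp (g := fun q => p q.1 q.2) (f := fun q => (q.1.1, q.2))) =>
    //; fp.
- by pb.
- by move=> x b a _; apply: leq_trans (sz_bool _) (leq_addl _ _).
Qed.

Lemma FP_all X {cX : code X} A {cA : code A} (l : X -> seq A) (p : X -> A -> bool) :
  FP l -> FP (fun q : X * A => p q.1 q.2) -> FP (fun x => all (p x) (l x)).
Proof.
move=> Hl Hp.
apply: (@FP_eq _ _ _ _ (fun x => ~~ has (fun a => ~~ p x a) (l x))).
  by move=> x; rewrite -all_predC; apply: eq_all => a /=; rewrite negbK.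
by apply: FP_negb; apply: FP_has => //; apply: FP_negb.
Qed.

Lemma sz_bits (s : seq bool) : sz s <= (4 * size s).+1.
Proof. by elim: s => //= b s IH; rewrite sz_cons; have := sz_bool b; lia. Qed.

(** Two words are compared by one fold over the first, whose state is the unread part of the second,
    or [None] after a mismatch. *)
Definition eq_step (o : option (seq bool)) (b : bool) : option (seq bool) :=
  if o is Some s then
    if s is c :: r then if c == b then Some r else None else None
  else None.

Lemma FP_eqbits X {cX : code X} (f g : X -> seq bool) :
  FP f -> FP g -> FP (fun x => f x == g x).
Proof.
move=> H1 H2.
apply: (@FP_eq _ _ _ _
  (fun x => if foldl eq_step (Some (g x)) (f x) is Some s then nilp s else false)).
  have E0 s : foldl eq_step None s = None by elim: s.
  move=> x; elim: (f x) (g x) => [|b s IH] [|c u] //=; first by rewrite E0.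
  by rewrite eqseq_cons (eq_sym b); case: eqP; rewrite ?E0 // IH.
apply: FP_omatch; [|by fp|by cbv beta; apply: FP_nilp; fp].
apply: (@FP_foldl _ _ _ _ _ _ _ _ (fun _ o b => eq_step o b) (fun=> 3)) => //.
- by fp.
- rewrite /eq_step; cbv beta; apply: FP_omatch; [by fp|by fp|].
  cbv beta; apply: FP_match; [by fp|by fp|].
  by cbv beta; apply: FP_if; [apply: FP_eqb; fp|fp|fp].
- by pb.
- move=> x [[|c r]|] b _ //=.
  by case: eqP; rewrite ?sz_Some ?sz_None ?sz_cons; lia.
Qed.

(** * Parsers *)

Definition parser (W : Type) := seq bool -> option (W * seq bool).

(* [p] accepts exactly the prefixes [e v], and returns [rep v]. *)
Definition parses V W (p : parser W) (e : V -> seq bool) (rep : V -> W) : Prop :=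
  (forall v r, p (e v ++ r) = Some (rep v, r)) /\
  (forall s x r, p s = Some (x, r) -> exists v, x = rep v /\ s = e v ++ r).

(** An amortized bound: each bit consumed pays for [c] units of the result, so that the results of a
    whole sequence remain linear in the input. *)
Definition parser_sz W {cW : code W} (p : parser W) : Prop :=
  exists c, forall s x r, p s = Some (x, r) -> sz x + c * size r <= c * size s.

Definition parse_bit : parser bool :=
  fun s => if s is b :: r then Some (b, r) else None.

Definition parse_pair U V (p : parser U) (q : parser V) : parser (U * V) :=
  fun s => if p s is Some u then
             if q u.2 is Some v then Some ((u.1, v.1), v.2) else None
           else None.

(** The flag tells that the closing bit has been read; from then on the state is fixed. *)
Definition seq_step W (p : parser W) (o : option (bool * (seq W * seq bool)))
    : option (bool * (seq W * seq bool)) :=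
  if o is Some st then
    if st.1 then Some st
    else if st.2.2 is b :: r then
      if b then
        if p r is Some v then Some (false, (v.1 :: st.2.1, v.2)) else None
      else Some (true, (st.2.1, r))
    else None
  else None.

(** Folds are the only loops available, so the input itself serves as a clock: every element
    consumes at least its leading bit, and [size s] rounds suffice. *)
Definition parse_seq W (p : parser W) : parser (seq W) :=
  fun s => if foldl (fun o _ => seq_step p o) (Some (false, ([::], s))) s is
    Some st then
             if st.1 then Some (rev st.2.1, st.2.2) else None
           else None.

Lemma parse_bitP : parses parse_bit (fun b => [:: b]) id.
Proof.
split=> //= s x r; case: s => // b s [-> ->]; by exists x.
Qed.

Lemma parse_pairP U V U' V' (p : parser U') (q : parser V') e e' rep rep' :
  parses p e rep -> parses q e' rep' ->
  parses (parse_pair p q) (fun x : U * V => e x.1 ++ e' x.2)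
    (fun x => (rep x.1, rep' x.2)).
Proof.
move=> [p1 p2] [q1 q2]; split=> [[u v] r|s [x y] r] /=; rewrite /parse_pair.
  by rewrite -catA p1 /= q1.
case E: (p s) => [[u t]|] //=; case F: (q t) => [[v t']|] //= [<- <- <-].
have [u' [-> ->]] := p2 _ _ _ E; have [v' [-> ->]] := q2 _ _ _ F.
by exists (u', v'); rewrite catA.
Qed.

Lemma foldl_iter S T (h : S -> S) (l : seq T) s :
  foldl (fun s _ => h s) s l = iter (size l) h s.
Proof. by elim: l s => //= b l IH s; rewrite IH -iterSr. Qed.

Lemma enc_seq_cons T (e : T -> seq bool) x s :
  enc_seq e (x :: s) = true :: e x ++ enc_seq e s.
Proof. by rewrite /enc_seq /= catA. Qed.

Section ParseSeq.

Variables (V W : Type) (p : parser W) (e : V -> seq bool) (rep : V -> W).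
Hypothesis pP : parses p e rep.

Lemma iter_seq_step_end n st :
  iter n (seq_step p) (Some (true, st)) = Some (true, st).
Proof. by elim: n => //= n ->. Qed.

Lemma iter_seq_step_None n : iter n (seq_step p) None = None.
Proof. by elim: n => //= n ->. Qed.

Lemma iter_seq_step_enc n vs acc r : size vs < n ->
  iter n (seq_step p) (Some (false, (acc, enc_seq e vs ++ r))) =
  Some (true, (rev (map rep vs) ++ acc, r)).
Proof.
elim: vs n acc => [|v vs IH] [|n] // acc lt; rewrite iterSr.
  exact: iter_seq_step_end.
by rewrite enc_seq_cons /= -catA pP.1 /= IH // rev_cons cat_rcons.
Qed.

Lemma iter_seq_step_inv n acc s acc' r :
  iter n (seq_step p) (Some (false, (acc, s))) = Some (true, (acc', r)) ->
  exists vs, acc' = rev (map rep vs) ++ acc /\ s = enc_seq e vs ++ r.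
Proof.
elim: n acc s => // n IH acc s; rewrite iterSr /=.
case: s => [|[] s] /=; rewrite ?iter_seq_step_None ?iter_seq_step_end //.
- case E: (p s) => [[x t]|] /=; last by rewrite iter_seq_step_None.
  have [v [-> ->]] := pP.2 _ _ _ E.
  move=> /IH[vs [-> ->]]; exists (v :: vs).
  by rewrite enc_seq_cons /= rev_cons cat_rcons catA.
- by case=> <- <-; exists [::].
Qed.

Lemma size_enc_seq vs : size vs < size (enc_seq e vs).
Proof.
by elim: vs => // v vs IH; rewrite enc_seq_cons /= size_cat; lia.
Qed.

Lemma parse_seqP : parses (parse_seq p) (enc_seq e) (map rep).
Proof.
split=> [vs r|s x r]; rewrite /parse_seq foldl_iter.
  rewrite iter_seq_step_enc ?cats0 ?revK //= size_cat.
  by apply: leq_trans (leq_addr _ _); apply: size_enc_seq.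
case E: (iter _ _ _) => [[b [acc t]]|] //=; case: b E => //= E [<- <-].
have [vs [-> ->]] := iter_seq_step_inv E.
by exists vs; rewrite cats0 revK.
Qed.

End ParseSeq.

Section ParserSizes.

Context {U V : Type} {cU : code U} {cV : code V}.

Lemma parse_bit_sz : parser_sz parse_bit.
Proof.
exists 3 => -[|b s] // x r [<- <-] /=; have := sz_bool b; lia.
Qed.

Lemma parse_pair_sz (p : parser U) (q : parser V) :
  parser_sz p -> parser_sz q -> parser_sz (parse_pair p q).
Proof.
move=> [c Hp] [d Hq]; exists (c + d).+1 => s x r; rewrite /parse_pair.
case E: (p s) => [[u t]|] //=; case F: (q t) => [[v t']|] //= [<- <-].
have := Hp _ _ _ E; have := Hq _ _ _ F; rewrite sz_pair => H1 H2.
have u0 : 0 < sz u by apply: sz_gt0.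
have v0 : 0 < sz v by apply: sz_gt0.
have L1 : d * size t' < d * size t by lia.
have L2 : c * size t < c * size s by lia.
move: L1 L2; rewrite !ltn_mul2l => /andP[_ L1] /andP[_ L2].
have L3 : c * size t' <= c * size t by rewrite leq_mul2l ltnW ?orbT.
have L4 : d * size t <= d * size s by rewrite leq_mul2l ltnW ?orbT.
rewrite !mulSn !mulnDl; lia.
Qed.

Lemma sz_rev (s : seq U) : sz (rev s) = sz s.
Proof.
enough (H : forall a : seq U, sz (catrev s a) + 1 = sz s + sz a).
  by have := H [::]; rewrite sz_nil => /addIn.
elim: s => [|x s IH] a /=; first by rewrite sz_nil addnC.
by rewrite IH !sz_cons; lia.
Qed.

(** A potential argument. The leading bit of an element pays for the extra unit of a cons, hence
    [0 < c]; what the closing bit pays is kept as [c * st.1] and later covers the unit size of the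
    empty list. *)
Lemma iter_seq_step_sz (p : parser U) c : 0 < c ->
  (forall s x r, p s = Some (x, r) -> sz x + c * size r <= c * size s) ->
  forall n acc s st, iter n (seq_step p) (Some (false, (acc, s))) = Some st ->
  sz st.2.1 + c * size st.2.2 + c * st.1 <= sz acc + c * size s.
Proof.
move=> c0 Hp; elim=> [|n IH] acc s st; first by case=> <- /=; lia.
rewrite iterSr /=; case: s => [|[] s] /=; rewrite ?iter_seq_step_None //.
  case E: (p s) => [[x t]|] /=; last by rewrite iter_seq_step_None.
  by move=> /IH; have := Hp _ _ _ E; rewrite sz_cons mulnS /=; lia.
by rewrite iter_seq_step_end => -[<-] /=; rewrite mulnS; lia.
Qed.

Lemma parser_sz_gt0 (p : parser U) : parser_sz p -> exists2 c, 0 < c &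
  forall s x r, p s = Some (x, r) -> sz x + c * size r <= c * size s.
Proof.
move=> [c H]; exists c.+1 => // s x r /H H1.
have x0 : 0 < sz x by apply: sz_gt0.
have: c * size r < c * size s by lia.
by rewrite ltn_mul2l => /andP[_ lt]; rewrite !mulSn; lia.
Qed.

Lemma parse_seq_sz (p : parser U) : parser_sz p -> parser_sz (parse_seq p).
Proof.
move=> /parser_sz_gt0[c c0 Hp]; exists c => s x r.
rewrite /parse_seq foldl_iter.
case E: (iter _ _ _) => [[b [acc t]]|] //=; case: b E => //= E [<- <-].
by have := iter_seq_step_sz c0 Hp E; rewrite sz_rev /= sz_nil; lia.
Qed.

End ParserSizes.

Lemma FP_parse_bit : FP parse_bit.
Proof. by rewrite /parse_bit; apply: FP_match; fp. Qed.

Section FPParsers.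

Context {U V : Type} {cU : code U} {cV : code V}.

Lemma FP_parse_pair (p : parser U) (q : parser V) :
  FP p -> FP q -> FP (parse_pair p q).
Proof.
move=> Hp Hq; rewrite /parse_pair; apply: FP_omatch; [by fp|by fp|cbv beta].
apply: FP_omatch; [|by fp|by fp].
by apply: (FP_comp Hq); fp.
Qed.

Lemma FP_parse_seq (p : parser U) : FP p -> parser_sz p -> FP (parse_seq p).
Proof.
move=> Hp /parser_sz_gt0[c c0 sp]; rewrite /parse_seq.
apply: FP_omatch; [|by fp|by fp; apply: FP_rev; fp].
apply: (@FP_foldl_bounded _ _ _ _ _ _ _ _ (fun _ o _ => seq_step p o)
  (fun s => 10 + (c + 4) * sz s)) => //.
- by fp.
- by fp.
- rewrite /seq_step; cbv beta; apply: FP_omatch; [by fp|by fp|cbv beta].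
  apply: FP_if; [by fp|by fp|].
  apply: FP_match; [by fp|by fp|cbv beta].
  apply: FP_if; [by fp| |by fp].
  apply: FP_omatch; [by apply: (FP_comp Hp); fp|by fp|by fp].
- by pb.
move=> s k; rewrite foldl_iter.
case E: (iter _ _ _) => [st|]; last by rewrite sz_None; lia.
have := iter_seq_step_sz c0 sp E; rewrite sz_nil sz_Some.
have -> : sz st = (sz st.1 + (sz st.2.1 + sz st.2.2).+1).+1.
  by case: st E => [b [x y]] _; rewrite !sz_pair.
move=> H; have H1 : size s < sz s by apply: sz_size.
have H2 : 0 < sz st.2.1 by apply: sz_gt0.
have: c * size st.2.2 <= c * size s by lia.
rewrite leq_mul2l -[c == 0]negbK -lt0n c0 /= => H3.
have: c * size s <= c * sz s by rewrite leq_mul2l ltnW ?orbT.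
have := sz_bool st.1; have := sz_bits st.2.2; rewrite mulnDl; lia.
Qed.

End FPParsers.

(** * Binary numbers *)

Definition cbin (n : nat) : seq bool := bin (up_log 2 n.+1) n.

Definition bval (s : seq bool) : nat := foldr (fun (b : bool) v => b + v.*2) 0 s.

Lemma bin_rec m n : bin m.+1 n = odd n :: bin m n./2.
Proof.
rewrite /bin /mkseq /= expn0 divn1; congr (_ :: _).
rewrite -[1]addn0 iotaDl -map_comp; apply: eq_map => i /=.
by rewrite add1n expnS divnMA divn2.
Qed.

Lemma size_bin m n : size (bin m n) = m.
Proof. by rewrite size_mkseq. Qed.

Lemma bval_bin m n : n < 2 ^ m -> bval (bin m n) = n.
Proof.
elim: m n => [|m IH] n; first by case: n.
rewrite expnS mul2n bin_rec /= => lt; rewrite IH ?odd_double_half //.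
by rewrite ltn_half_double.
Qed.

Lemma bin_bval s : bin (size s) (bval s) = s.
Proof.
elim: s => //= b s IH; rewrite bin_rec oddD odd_double addbF half_bit_double IH.
by rewrite oddb.
Qed.

Lemma bval_lt s : bval s < 2 ^ size s.
Proof.
elim: s => //= b s IH; rewrite expnS; case: b => /=; lia.
Qed.

Lemma bval_ge b s : last true (b :: s) -> 2 ^ size s <= bval (b :: s).
Proof.
elim: s b => [|c s IH] b /=; first by move=> ->.
by move=> /IH /= le; rewrite expnS mul2n (leq_trans _ (leq_addl _ _)) // leq_double.
Qed.

Lemma canonical_cbin s : last true s -> s = cbin (bval s).
Proof.
move=> ls; rewrite -{1}(bin_bval s) /cbin; congr (bin _ _).
case: s ls => [|b s] // ls; rewrite (@up_log_eq 2 (size s)) //.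
by rewrite ltnS bval_ge // (bval_lt (b :: s)).
Qed.

Lemma ltn_cbin n : n < 2 ^ up_log 2 n.+1.
Proof. exact: up_logP. Qed.

Lemma bval_cbin n : bval (cbin n) = n.
Proof. by rewrite bval_bin // ltn_cbin. Qed.

Lemma cbin_inj : injective cbin.
Proof. exact: can_inj bval_cbin. Qed.

Lemma size_cbin n : size (cbin n) = up_log 2 n.+1.
Proof. exact: size_bin. Qed.

Lemma last_cbin n : last true (cbin n).
Proof.
case E: (last true (cbin n)) => //.
have: 0 < size (cbin n) by move: E; case: (cbin n).
case/lastP: (cbin n) (bval_cbin n) E (size_cbin n) => // s b; rewrite
  last_rcons => v b0.
have {v b0} vs : bval s = n.
  by rewrite -v b0; elim: s {v} => //= c s ->.
rewrite size_rcons => es _; have := bval_lt s; rewrite vs => lt.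
by have := @up_log_min 2 n.+1 (size s) isT lt; rewrite -es ltnn.
Qed.

Lemma nth_bin m n i : nth false (bin m n) i = (i < m) && odd (n %/ 2 ^ i).
Proof.
case: ltnP => lt; first by rewrite nth_mkseq.
by rewrite nth_default // size_bin.
Qed.

Fixpoint incr (s : seq bool) : seq bool :=
  if s is b :: r then if b then false :: incr r else true :: r else [:: true].

Lemma incr_cbin n : incr (cbin n) = cbin n.+1.
Proof.
have vS s : bval (incr s) = (bval s).+1.
  by elim: s => //= -[] s //= ->.
have lS s : last true s -> last true (incr s).
  elim: s => //= b [|c s] IH; first by case: b IH.
  by case: b => //= H; move: (IH H); case: c {IH H}.
by rewrite (canonical_cbin (lS _ (last_cbin n))) vS bval_cbin.
Qed.

(** Carrying makes [incr] a single fold, with state the carry and the digits produced so far, in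
    reverse. *)
Lemma FP_incr : FP incr.
Proof.
pose (g := fun (st : bool * seq bool) b => (st.1 && b, st.1 (+) b :: st.2)).
apply: (@FP_eq _ _ _ _ (fun s => let st := foldl g (true, [::]) s in
  rev (if st.1 then true :: st.2 else st.2))).
  move=> s.
  enough (H : forall c a, rev (let st := foldl g (c, a) s in
     if st.1 then true :: st.2 else st.2) = rev a ++ if c then incr s else s).
    by rewrite /= (H true [::]).
  elim: s => [|b s IH] c a /=; first by case: c; rewrite ?cats0 // rev_cons cats1.
  rewrite {}IH /= rev_cons cat_rcons; by case: c; case: b.
have H : FP (fun s => foldl g (true, [::]) s).
  apply: (@FP_foldl _ _ _ _ _ _ _ _ (fun _ st b => g st b) (fun=> 10)) => //.
  - by fp.
  - by fp.
  - rewrite /g; cbv beta; apply: FP_pair; first by apply: FP_andb; fp.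
    by apply: FP_cons; [apply: FP_addb|]; fp.
  - by pb.
  - move=> _ [c a] b _; rewrite /g !sz_pair sz_cons /=.
    have := sz_bool (c && b); have := sz_bool (c (+) b); lia.
by apply: FP_rev; fp.
Qed.

Lemma sz_incr s : sz (incr s) <= sz s + 4.
Proof.
have E1 : sz true = 3 by []. have E2 : sz false = 1 by [].
by elim: s => [|[] s IH] //=; rewrite !sz_cons E1 E2; lia.
Qed.

(** Non-canonical numerals must be rejected: [SAT] and [dynamics] contain exact encodings only. *)
Definition parse_nat : parser (seq bool) :=
  fun s => if parse_seq parse_bit s is Some u then
             if last true u.1 then Some u else None
           else None.

Lemma parse_natP : parses parse_nat enc_nat cbin.
Proof.
have [H1 H2] := parse_seqP parse_bitP.
split=> [n r|s x r]; rewrite /parse_nat.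
  by rewrite H1 /= map_id last_cbin.
case E: (parse_seq _ _) => [[u t]|] //=; case: ifP => // lu [<- <-].
have [v [Eu ->]] := H2 _ _ _ E; rewrite map_id in Eu; rewrite {}Eu in lu *.
by exists (bval v); rewrite /enc_nat /enc_bits -/(cbin _) -canonical_cbin.
Qed.

Lemma parse_nat_sz : parser_sz parse_nat.
Proof.
have [c H] := parse_seq_sz parse_bit_sz; exists c => s x r; rewrite /parse_nat.
by case E: (parse_seq _ _) => [[u t]|] //=; case: ifP => // _ [<- <-]; apply: H.
Qed.

Lemma FP_last X {cX : code X} (f : X -> seq bool) :
  FP f -> FP (fun x => last true (f x)).
Proof.
move=> H; apply: (@FP_eq _ _ _ _ (fun x => foldl (fun _ b => b) true (f x))).
  by move=> x; elim: (f x) true => //=.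
apply: (@FP_foldl _ _ _ _ _ _ _ _ (fun _ _ b => b) (fun=> 3)) => //.
- by fp.
- by fp.
- by pb.
- by move=> x s a _; apply: leq_trans (sz_bool _) (leq_addl _ _).
Qed.

Lemma FP_parse_nat : FP parse_nat.
Proof.
rewrite /parse_nat; apply: FP_omatch.
- exact: FP_parse_seq FP_parse_bit parse_bit_sz.
- by fp.
- by cbv beta; apply: FP_if; [apply: FP_last| |]; fp.
Qed.

(** A binary index may be exponentially larger than its length, so a counter runs along the list
    instead of down from the index. The result [None] is the range check of [gate_ok]: circuits are
    validated while they are evaluated. *)
Definition lookup (j : seq bool) (l : seq bool) : option bool :=
  (foldl (fun st b => (incr st.1, if st.1 == j then Some b else st.2))
         ([::], None) l).2.

Lemma lookup_cbin j l :
  lookup (cbin j) l = if j < size l then Some (nth false l j) else None.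
Proof.
rewrite /lookup -[[::]]/(cbin 0).
enough (H : forall i o,
  (foldl (fun st b => (incr st.1, if st.1 == cbin j then Some b else st.2))
     (cbin i, o) l).2 = if i <= j < i + size l then Some (nth false l (j - i))
       else o).
  by rewrite H /= subn0.
elim: l => [|b l IH] i o /=.
  by rewrite addn0; case: ltngtP.
rewrite incr_cbin IH (inj_eq cbin_inj).
case: (ltngtP i j) => [lt|gt|->] /=.
- by rewrite addSnnS; case: ifP => // _; congr Some; rewrite -[j - i]prednK
  ?subn_gt0 // -subnS.
- by [].
- by rewrite subnn /= addnS ltnS leq_addr.
Qed.

Lemma FP_lookup X {cX : code X} (f g : X -> seq bool) :
  FP f -> FP g -> FP (fun x => lookup (f x) (g x)).
Proof.
move=> H1 H2; rewrite /lookup; apply: FP_snd.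
apply: (@FP_foldl _ _ _ _ _ _ _ _
  (fun x st b => (incr st.1, if st.1 == f x then Some b else st.2)) (fun=> 10))
    => //.
- by fp.
- cbv beta; apply: FP_pair; first by apply: (FP_comp FP_incr); fp.
  apply: FP_if; [|by fp|by fp].
  by apply: FP_eqbits; [fp|apply: (FP_comp H1); fp].
- by pb.
- move=> x [c o] b _; rewrite !sz_pair /=; have := sz_incr c.
  by case: ifP => _; rewrite ?sz_Some; have := sz_bool b; lia.
Qed.

(** * Evaluation of circuits and formulas *)

(* A gate is coded by the bits of its tag, or by the value of a constant gate,
   followed by its arguments; missing components are padded. *)
Definition gate_code : Type := (bool * (bool * (bool * (seq bool * seq
  bool))))%type.

Definition rep_gate (g : gate) : gate_code :=
  match g with
  | GInput j => (false, (false, (false, (cbin j, [::]))))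
  | GConst b => (false, (true, (b, ([::], [::]))))
  | GNot j => (true, (false, (false, (cbin j, [::]))))
  | GAnd j k => (true, (true, (false, (cbin j, cbin k))))
  | GOr j k => (true, (true, (true, (cbin j, cbin k))))
  end.

Definition parse_gate : parser gate_code := fun s =>
  if parse_pair parse_bit parse_bit s is Some u then
    if u.1.1 then
      if u.1.2 then
        if parse_pair parse_bit (parse_pair parse_nat parse_nat) u.2 is Some v
        then Some ((true, (true, v.1)), v.2) else None
      else
        if parse_nat u.2 is Some v
        then Some ((true, (false, (false, (v.1, [::])))), v.2) else None
    else
      if u.1.2 then
        if parse_bit u.2 is Some v
        then Some ((false, (true, (v.1, ([::], [::])))), v.2) else None
      else
        if parse_nat u.2 is Some v
        then Some ((false, (false, (false, (v.1, [::])))), v.2) else None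
  else None.

Lemma parse_gateP : parses parse_gate enc_gate rep_gate.
Proof.
have B2 := parse_pairP parse_bitP parse_bitP.
have N2 := parse_pairP parse_bitP (parse_pairP parse_natP parse_natP).
split=> [g r|s x r]; rewrite /parse_gate.
  have B a b u : parse_pair parse_bit parse_bit (a :: b :: u) = Some ((a, b),
    u) by [].
  case: g => [j|b|j|j k|j k]; rewrite /enc_gate ?cat_cons ?cat0s ?B /=.
  - by rewrite parse_natP.1.
  - by [].
  - by rewrite parse_natP.1.
  - have /= := N2.1 (false, (j, k)) r.
    by rewrite catA => ->.
  - have /= := N2.1 (true, (j, k)) r.
    by rewrite catA => ->.
case E: (parse_pair _ _ s) => [[[b1 b2] t]|] //=.
have [[c1 c2] [[-> ->] ->]] := B2.2 _ _ _ E.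
case: c1; case: c2 => /=.
- case F: (parse_pair _ _ t) => [[v t']|] //= [<- <-].
  have [[b [j k]] [-> ->]] := N2.2 _ _ _ F.
  by case: b {F}; [exists (GOr j k)|exists (GAnd j k)].
- case F: (parse_nat t) => [[v t']|] //= [<- <-].
  by have [j [-> ->]] := parse_natP.2 _ _ _ F; exists (GNot j).
- case: t E => //= b t _ [<- <-]; by exists (GConst b).
- case F: (parse_nat t) => [[v t']|] //= [<- <-].
  by have [j [-> ->]] := parse_natP.2 _ _ _ F; exists (GInput j).
Qed.

Lemma parse_gate_sz : parser_sz parse_gate.
Proof.
have B2 := parse_pairP parse_bitP parse_bitP.
have N2 := parse_pairP parse_bitP (parse_pairP parse_natP parse_natP).
have [c sN] := parse_nat_sz.
have [d sN2] := parse_pair_sz parse_bit_sz (parse_pair_sz parse_nat_sz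
  parse_nat_sz).
have E1 : sz true = 3 by []. have E2 : sz false = 1 by [].
have E3 : sz ([::] : seq bool) = 1 by [].
exists (c + d + 20) => s x r; rewrite /parse_gate.
case E: (parse_pair _ _ s) => [[[b1 b2] t]|] //=.
have [[c1 c2] [[-> ->] ->]] := B2.2 _ _ _ E.
have N t' v : parse_nat t = Some (v, t') -> sz v + (c + d + 20) * size t' <= (c
  + d + 20) * size t.
  move=> F; have := sN _ _ _ F; have [j [_ ->]] := parse_natP.2 _ _ _ F.
  rewrite size_cat !mulnDl !mulnDr; lia.
case: c1; case: c2 => /=.
- case F: (parse_pair _ _ t) => [[v t']|] //= [<- <-].
  have := sN2 _ _ _ F; have [[b [j k]] [_ ->]] := N2.2 _ _ _ F.
  rewrite !sz_pair E1 size_cat !mulnS !mulnDl !mulnDr; lia.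
- case F: (parse_nat t) => [[v t']|] //= [<- <-].
  by have := N _ _ F; rewrite !sz_pair E1 E2 E3 !mulnS; lia.
- case: t E N => //= b t _ _ [<- <-].
  by rewrite !sz_pair E1 E2 E3 !mulnS; have := sz_bool b; lia.
- case F: (parse_nat t) => [[v t']|] //= [<- <-].
  by have := N _ _ F; rewrite !sz_pair E2 E3 !mulnS; lia.
Qed.

Lemma FP_parse_gate : FP parse_gate.
Proof.
have FN := FP_parse_nat.
have FB := FP_parse_bit.
have FN2 := FP_parse_pair FB (FP_parse_pair FN FN).
rewrite /parse_gate; apply: FP_omatch; [exact: FP_parse_pair|by fp|].
cbv beta; apply: FP_if; [by fp| |].
  apply: FP_if; [by fp| |]; (apply: FP_omatch; [|by fp|by fp]).
    by apply: (FP_comp FN2); fp.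
  by apply: (FP_comp FN); fp.
apply: FP_if; [by fp| |]; (apply: FP_omatch; [|by fp|by fp]).
  by apply: (FP_comp FB); fp.
by apply: (FP_comp FN); fp.
Qed.

Definition geval (inp vs : seq bool) (g : gate_code) : option bool :=
  if g.1 then
    if lookup g.2.2.2.1 vs is Some x then
      if g.2.1 then
        if lookup g.2.2.2.2 vs is Some y then
          Some (if g.2.2.1 then x || y else x && y)
        else None
      else Some (~~ x)
    else None
  else if g.2.1 then Some g.2.2.1 else lookup g.2.2.2.1 inp.

Definition ceval_step (inp : seq bool) (o : option (seq bool)) (g : gate_code) :=
  if o is Some vs then
    if geval inp vs g is Some b then Some (rcons vs b) else None
  else None.

Definition ceval (inp : seq bool) (C : seq gate_code) : option bool :=
  if foldl (ceval_step inp) (Some [::]) C is Some vs then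
    if nilp vs then None else Some (last true vs)
  else None.

Lemma geval_rep inp vs g :
  geval inp vs (rep_gate g) =
  if gate_ok (size inp) (size vs) g then Some (gate_value inp vs g) else None.
Proof.
case: g => [j|b|j|j k|j k]; rewrite /geval /= ?lookup_cbin //.
- by case: ltnP.
- by case: (j < _); case: (k < _).
- by case: (j < _); case: (k < _).
Qed.

Lemma ceval_rep inp C :
  ceval inp (map rep_gate C) =
  if circuit_ok (size inp) C then Some (circuit_eval C inp) else None.
Proof.
rewrite /ceval /circuit_eval /circuit_ok.
pose F := fun vs g => rcons vs (gate_value inp vs g); rewrite -/F.
have H : forall vs, foldl (ceval_step inp) (Some vs) (map rep_gate C) =
    if all (fun i => gate_ok (size inp) (size vs + i) (nth (GConst false) C i))
         (iota 0 (size C)) then Some (foldl F vs C) else None.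
  elim: C => //= g C IH vs; rewrite geval_rep addn0.
  case: (gate_ok _ _ _) => /=; last by elim: (C).
  rewrite IH size_rcons -[1]addn0 iotaDl all_map.
  by congr (if _ then _ else _); apply: eq_all => i /=; rewrite addSnnS add1n.
rewrite H; case: all; last by rewrite andbF.
rewrite andbT.
have sF : forall vs, size (foldl F vs C) = size vs + size C.
  by elim: (C) => [|g C' IH] vs; rewrite ?addn0 //= IH size_rcons addSnnS.
have := sF [::]; rewrite add0n; by case: (foldl F [::] C) => [|b u] /= <-.
Qed.

Lemma FP_geval : FP (fun p : seq bool * seq bool * gate_code => geval p.1.1
  p.1.2 p.2).
Proof.
rewrite /geval; apply: FP_if; [by fp| |].
  apply: FP_omatch; [by apply: FP_lookup; fp|by fp|cbv beta].
  apply: FP_if; [by fp| |by apply: FP_Some; apply: FP_negb; fp].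
  apply: FP_omatch; [by apply: FP_lookup; fp|by fp|cbv beta].
  apply: FP_Some; apply: FP_if; [by fp|by apply: FP_orb; fp|by apply: FP_andb; fp].
by apply: FP_if; [by fp|by fp|by apply: FP_lookup; fp].
Qed.

Lemma sz_rcons A {cA : code A} (s : seq A) a : sz (rcons s a) = (sz a + sz s).+1.
Proof. by elim: s => [|b s IH] /=; rewrite ?sz_cons ?sz_nil // IH; lia. Qed.

Lemma FP_ceval X {cX : code X} (f : X -> seq bool) (g : X -> seq gate_code) :
  FP f -> FP g -> FP (fun x => ceval (f x) (g x)).
Proof.
move=> H1 H2; rewrite /ceval; apply: FP_omatch; [|by fp|]; last first.
  by cbv beta; apply: FP_if; [apply: FP_nilp; fp|by fp|apply: FP_Some; apply:
    FP_last; fp].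
apply: (@FP_foldl _ _ _ _ _ _ _ _ (fun x o g => ceval_step (f x) o g) (fun=>
  10)) => //.
- by fp.
- rewrite /ceval_step; cbv beta; apply: FP_omatch; [by fp|by fp|cbv beta].
  apply: FP_omatch; [|by fp|by apply: FP_Some; apply: FP_rcons; fp].
  apply: (FP_comp FP_geval (f := fun p => (f p.1.1.1, p.2, p.1.2))).
  by apply: FP_pair; [apply: FP_pair; [apply: (FP_comp H1)|]|]; fp.
- by pb.
- move=> x [vs|] a _ //=; case: geval => [b|]; rewrite ?sz_Some ?sz_None; last
  by lia.
  by rewrite sz_rcons; have := sz_bool b; lia.
Qed.

Lemma FP_map X A B {cX : code X} {cA : code A} {cB : code B}
    (l : X -> seq A) (h : X -> A -> B) :
  FP l -> FP (fun q : X * A => h q.1 q.2) -> FP (fun x => map (h x) (l x)).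
Proof.
move=> Hl Hh.
apply: (@FP_eq _ _ _ _ (fun x => rev (foldl (fun acc a => h x a :: acc) [::] (l
  x)))).
  move=> x; rewrite -[RHS]cat0s -[[::] in RHS]/(rev (Nil B)).
  elim: (l x) [::] => [|a s IH] acc /=; first by rewrite cats0.
  by rewrite IH rev_cons cat_rcons.
have [[d sh] _] := Hh; have [sl _] := Hl.
apply: FP_rev; apply: (@FP_foldl _ _ _ _ _ _ _ _ (fun x acc a => h x a :: acc)
  (fun x => (sz x + sz (l x)).+3 ^ d + 1)) => //.
- by fp.
- cbv beta; apply: FP_cons; [|by fp].
  by apply: (FP_comp Hh (f := fun p => (p.1.1, p.2))); fp.
- by pb.
move=> x s a lt; rewrite sz_cons.
have := sh (x, a); rewrite sz_pair /= => H.
have : ((sz x + sz a).+1).+2 ^ d <= (sz x + sz (l x)).+3 ^ d.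
  by case: (d) => // n; rewrite leq_exp2r // !ltnS leq_add2l ltnW.
by lia.
Qed.

Lemma FP_size_eq X A {cX : code X} {cA : code A} n (f : X -> seq A) :
  FP f -> FP (fun x => size (f x) == n).
Proof.
elim: n X cX f => [|n IH] X cX f H; first exact: FP_nilp.
apply: (@FP_eq _ _ _ _ (fun x => if f x is _ :: s then size s == n else false)).
  by move=> x; case: (f x).
by apply: FP_match; [by fp|by fp|cbv beta; apply: IH; fp].
Qed.

Definition pad_step (st : seq bool * seq bool) : seq bool * seq bool :=
  (head false st.2 :: st.1, behead st.2).

Definition pad (k x : seq bool) : seq bool :=
  rev (foldl (fun st _ => pad_step st) ([::], x) k).1.

Lemma padE k x : pad k x = mkseq (nth false x) (size k).
Proof.
rewrite /pad foldl_iter.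
have -> : iter (size k) pad_step ([::], x) =
    (rev (mkseq (nth false x) (size k)), drop (size k) x).
  elim: (size k) => [|n /= ->]; first by rewrite drop0.
  rewrite /pad_step /= mkseqS rev_rcons -nth0 nth_drop addn0.
  by rewrite -drop1 drop_drop add1n.
by rewrite revK.
Qed.

Lemma pad_cbin k n : pad k (cbin n) = bin (size k) n.
Proof.
rewrite padE /bin; apply: eq_map => i; rewrite nth_bin.
case: ltnP => //= le; rewrite divn_small //.
by apply: leq_trans (leq_pexp2l _ le) => //; apply: ltn_cbin.
Qed.

Lemma FP_pad X {cX : code X} (f g : X -> seq bool) :
  FP f -> FP g -> FP (fun x => pad (f x) (g x)).
Proof.
move=> H1 H2; apply: FP_rev; apply: FP_fst.
apply: (@FP_foldl _ _ _ _ _ _ _ _ (fun x st _ => pad_step st) (fun=> 10)) => //.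
- by fp.
- by rewrite /pad_step; cbv beta; apply: FP_pair;
    [apply: FP_cons; [apply: FP_head|]|apply: FP_behead]; fp.
- by pb.
- move=> x [s t] b _; rewrite /pad_step !sz_pair sz_cons /=.
  case: t => [|c t] /=; rewrite ?sz_cons ?sz_nil //.
    by have := sz_bool false; lia.
  by have := sz_bool c; lia.
Qed.

(* Edge circuit, color circuits, and vertices in binary. *)
Definition structure : Type :=
  ((seq gate_code * seq (seq gate_code)) * seq (seq bool))%type.

Fixpoint feval r n (phi : formula r n) (M : structure) (env : seq (seq bool)) :
    bool :=
  match phi with
  | FEq _ i j => nth [::] env i == nth [::] env j
  | FEdge _ i j =>
      odflt false (ceval (nth [::] env i ++ nth [::] env j) M.1.1)
  | FColor _ c i => odflt false (ceval (nth [::] env i) (nth [::] M.1.2 c))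
  | FNot _ phi1 => ~~ feval phi1 M env
  | FAnd _ phi1 phi2 => feval phi1 M env && feval phi2 M env
  | FEx _ phi1 => has (fun v => feval phi1 M (v :: env)) M.2
  end.

(** The formula is fixed, so the recursion takes place outside the machine: each quantifier
    contributes one nested scan of the list of vertices, and the degree of the polynomial depends on
    the formula alone. *)
Lemma FP_feval r n (phi : formula r n) :
  FP (fun p : structure * seq (seq bool) => feval phi p.1 p.2).
Proof.
elim: n / phi => [n i j|n i j|n c i|n phi IH|n phi IH1 psi IH2|n phi IH] /=.
- by apply: FP_eqbits; apply: FP_nth; fp.
- apply: FP_odflt; [apply: FP_ceval|]; [apply: FP_cat; apply: FP_nth|fp|]; fp.
- by apply: FP_odflt; [apply: FP_ceval; apply: FP_nth|]; fp.
- exact: FP_negb.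
- exact: FP_andb.
- apply: FP_has; first by fp.
  by apply: (FP_comp IH (f := fun q => (q.1.1, q.2 :: q.1.2))); fp.
Qed.

(** * Brute-force decision of structures with few vertices *)

Definition count_step (N : seq bool) (st : seq (seq bool) * seq bool) :=
  if st.2 == N then st else (st.2 :: st.1, incr st.2).

(** The word [w] acts as a unary bound: the count ends at the minimum of [size w] and the number
    coded by [N], and thus decides whether all vertices can be listed. *)
Definition count_up (w N : seq bool) : seq (seq bool) * seq bool :=
  foldl (fun st _ => count_step N st) ([::], [::]) w.

Lemma count_upE w N :
  count_up w (cbin N) =
  (rev (map cbin (iota 0 (minn (size w) N))), cbin (minn (size w) N)).
Proof.
rewrite /count_up foldl_iter; elim: (size w) => [|k IH]; first by rewrite min0n.
rewrite iterS IH /count_step /= (inj_eq cbin_inj).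
case: (ltnP k N) => [lt|le].
  rewrite (minn_idPl lt) ltn_eqF // incr_cbin.
  by rewrite -[in RHS](addn1 k) iotaD map_cat rev_cat addn1.
by rewrite (minn_idPr (leqW le)) eqxx.
Qed.

Lemma count_up_sz w N : sz (count_up w N) <= 10 * (sz w).+1 * (sz w).+1 + 10.
Proof.
rewrite /count_up foldl_iter.
have H k : sz (iter k (count_step N) ([::], [::])).2 <= 4 * k + 1 /\
    sz (iter k (count_step N) ([::], [::])).1 <= 1 + k * (4 * k + 2).
  elim: k => // k [H1 H2]; rewrite iterS /count_step.
  move: H1 H2; case: (iter k _ _) => [s t] /= H1 H2.
  case: eqP => _ /=; first by nia.
  by rewrite sz_cons; have := sz_incr t; nia.
have lw : size w < sz w by apply: sz_size.
have [H1 H2] := H (size w); move: H1 H2; case: (iter _ _ _) => [s t] /=.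
by rewrite sz_pair; nia.
Qed.

Lemma FP_count_up X {cX : code X} (f g : X -> seq bool) :
  FP f -> FP g -> FP (fun x => count_up (f x) (g x)).
Proof.
move=> H1 H2; have [s1 _] := H1.
apply: (@FP_foldl_bounded _ _ _ _ _ _ _ _ (fun x st _ => count_step (g x) st)
  (fun x => 10 * (sz (f x)).+1 * (sz (f x)).+1 + 10)) => //.
- by fp.
- rewrite /count_step; cbv beta; apply: FP_if; [|by fp|].
    by apply: FP_eqbits; [fp|apply: (FP_comp H2); fp].
  by apply: FP_pair; [fp|apply: (FP_comp FP_incr); fp].
- by pb.
- move=> x k; apply: leq_trans (count_up_sz _ _) _.
  have le : sz (take k (f x)) <= sz (f x) by apply: sz_take.
  by rewrite leq_add2r -!mulnA leq_mul2l /= leq_mul.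
Qed.

(** Whether a circuit is well formed depends only on the length of its input, so evaluating every
    circuit once, at the first vertex of the list, establishes [succinct_ok]. *)
Definition checked_eval r (psi : sentence r) (M : structure) : bool :=
  if M.2 is v :: _ then
    [&& ceval (v ++ v) M.1.1 : bool,
        all (fun C => ceval v C : bool) M.1.2 & feval psi M [::]]
  else false.

(** The vertices are counted in decreasing order, so the head of the list is the largest vertex in
    binary. Its length is the number of bits of a vertex, to which all vertices are padded. *)
Definition decide_parsed r (psi : sentence r) (w N : seq bool)
    (cs : seq (seq gate_code)) : bool :=
  if (count_up w N).2 == N then
    if cs is C :: cs' then
      (size cs' == r) &&
      checked_eval psi (C, cs', map (pad (head [::] (count_up w N).1))
        (count_up w N).1)
    else false
  else false.

Definition parse_succinct : parser (seq bool * seq (seq gate_code)) :=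
  parse_pair parse_nat (parse_seq (parse_seq parse_gate)).

Definition decide r (psi : sentence r) (p : seq bool * seq bool) : bool :=
  if parse_succinct p.2 is Some u then
    nilp u.2 && decide_parsed psi p.1 u.1.1 u.1.2
  else false.

Lemma FP_checked_eval r (psi : sentence r) : FP (checked_eval psi).
Proof.
rewrite /checked_eval; apply: FP_match; [by fp|by fp|cbv beta].
apply: FP_andb.
  by apply: FP_isSome; apply: FP_ceval; [apply: FP_cat|]; fp.
apply: FP_andb.
  by apply: FP_all; [fp|apply: FP_isSome; apply: FP_ceval; fp].
apply: (FP_comp (FP_feval psi) (f := fun q => (q.1, [::]))); fp.
Qed.

Lemma FP_decide_parsed r (psi : sentence r) :
  FP (fun p : seq bool * (seq bool * seq (seq gate_code)) =>
    decide_parsed psi p.1 p.2.1 p.2.2).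
Proof.
rewrite /decide_parsed; apply: FP_if; [|apply: FP_match; [by fp|by fp|cbv
  beta]|by fp].
  by apply: FP_eqbits; [apply: FP_snd; apply: FP_count_up|]; fp.
apply: FP_andb; first by apply: FP_size_eq; fp.
apply: (FP_comp (FP_checked_eval psi)); apply: FP_pair; first by fp.
apply: FP_map; first by apply: FP_fst; apply: FP_count_up; fp.
by apply: FP_pad; [apply: FP_head; apply: FP_fst; apply: FP_count_up|]; fp.
Qed.

Lemma FP_parse_succinct : FP parse_succinct.
Proof.
apply: FP_parse_pair FP_parse_nat (FP_parse_seq (FP_parse_seq FP_parse_gate _) _).
  exact: parse_gate_sz.
exact: parse_seq_sz parse_gate_sz.
Qed.

Lemma FP_decide r (psi : sentence r) : FP (decide psi).
Proof.
rewrite /decide; apply: FP_omatch; [|by fp|].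
  by apply: (FP_comp FP_parse_succinct); fp.
apply: FP_andb; first by apply: FP_nilp; fp.
apply: (FP_comp (FP_decide_parsed psi) (f := fun q => (q.1.1, (q.2.1.1,
  q.2.1.2)))); fp.
Qed.

Lemma parse_succinctP : parses parse_succinct
  (fun x => enc_nat x.1 ++ enc_seq (enc_seq enc_gate) x.2)
  (fun x => (cbin x.1, map (map rep_gate) x.2)).
Proof. exact: parse_pairP parse_natP (parse_seqP (parse_seqP parse_gateP)). Qed.

Section Feval.

Variables (r : nat) (S : succinct r).

Let m := vertex_bits S.
Let N := vertices S.
Let code_vertex (x : 'I_N) : seq bool := bin m x.

Definition rep_structure : structure :=
  (map rep_gate (edge_circuit S), map (map rep_gate) (color_circuits S),
   map (bin m) (rev (iota 0 N))).

Lemma bin_vertex_inj : injective code_vertex.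
Proof.
have lt (x : 'I_N) : x < 2 ^ m.
  exact: leq_trans (ltn_ord x) (up_logP _ _).
by move=> x y E; apply: val_inj; rewrite /= -(bval_bin (lt x)) -(bval_bin (lt
  y)) -[bin m x]/(code_vertex x) E.
Qed.

Lemma has_vertices (P : pred (seq bool)) :
  has P (map (bin m) (rev (iota 0 N))) = [exists x : 'I_N, P (code_vertex x)].
Proof.
rewrite map_rev has_rev has_map; apply/hasP/existsP => [[i]|[x Px]].
  by rewrite mem_iota => /= lt Pi; exists (Ordinal lt).
by exists (val x) => //; rewrite mem_iota ltn_ord.
Qed.

Lemma nth_code n (s : n.-tuple 'I_N) (i : 'I_n) :
  nth [::] (map code_vertex s) i = code_vertex (tnth s i).
Proof. by rewrite (nth_map (tnth_default s i)) ?size_tuple // -tnth_nth. Qed.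

Lemma fevalP n (phi : formula r n) (s : n.-tuple 'I_N) : succinct_ok S ->
  feval phi rep_structure (map code_vertex s) = @holds r (Defs.decode S) n phi s.
Proof.
move=> /andP[okE okC].
elim: n / phi s => [n i j|n i j|n c i|n phi IH|n phi IH1 psi IH2|n phi IH] s.
- by rewrite /= !nth_code (inj_eq bin_vertex_inj).
- rewrite /= !nth_code ceval_rep size_cat !size_bin addnn -mul2n okE.
  by [].
- rewrite /= nth_code (nth_map [::]) ?size_tuple // ceval_rep size_bin.
  have -> : circuit_ok m (nth [::] (color_circuits S) c).
    by apply: (all_nthP [::] okC); rewrite size_tuple.
  by rewrite /= (tnth_nth [::]).
- by rewrite /= IH.
- by rewrite /= IH1 IH2.
- rewrite /= has_vertices; apply: eq_existsb => x.
  exact: (IH [tuple of x :: s]).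
Qed.

End Feval.

Lemma checked_evalP r (psi : sentence r) (S : succinct r) : 0 < vertices S ->
  checked_eval psi (rep_structure S) = succinct_ok S && models (Defs.decode S) psi.
Proof.
move=> N0; rewrite /checked_eval.
case E: (rep_structure S).2 => [|v vs].
  have := congr1 size E; rewrite /= size_map size_rev size_iota => N0'.
  by rewrite N0' in N0.
have sv : size v = vertex_bits S.
  have : v \in (rep_structure S).2 by rewrite E mem_head.
  by case/mapP => i _ ->; rewrite size_bin.
rewrite ceval_rep size_cat sv addnn -mul2n.
have -> : all (fun C => ceval v C : bool) (rep_structure S).1.2 =
    all (circuit_ok (vertex_bits S)) (color_circuits S).
  rewrite /= all_map; apply: eq_all => C /=; rewrite ceval_rep sv.
  by case: circuit_ok.
rewrite /succinct_ok; case okE: (circuit_ok _ (edge_circuit S)) => //=.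
case okC: (all _ _) => //=.
by apply: (@fevalP r S 0 psi [tuple]); rewrite /succinct_ok okE.
Qed.

Lemma decideP r (psi : sentence r) w s :
  decide psi (w, s) <-> exists S : succinct r,
    [/\ s = enc_succinct S, 0 < vertices S <= size w, succinct_ok S &
        models (Defs.decode S) psi].
Proof.
have verts N m : 0 < N -> m = up_log 2 N ->
    map (pad (head [::] (rev (map cbin (iota 0 N))))) (rev (map cbin (iota 0 N))) =
    map (bin m) (rev (iota 0 N)).
  case: N => // N _ ->; rewrite -map_rev -map_comp -addn1 iotaD rev_cat /= add0n.
  rewrite pad_cbin size_cbin; rewrite addn1; congr (_ :: _); apply: eq_map => i /=.
  by rewrite pad_cbin size_cbin.
have [p1 p2] := parse_succinctP.
have dec (S : succinct r) : 0 < vertices S <= size w ->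
    decide_parsed psi w (cbin (vertices S))
      (map (map rep_gate) (edge_circuit S :: color_circuits S)) =
    succinct_ok S && models (Defs.decode S) psi.
  move=> /andP[N0 le]; rewrite /decide_parsed count_upE (minn_idPr le) eqxx /=.
  rewrite size_map size_tuple eqxx (verts _ (vertex_bits S)) //=.
  exact: checked_evalP.
split.
  rewrite /decide /=; case E: (parse_succinct s) => [[[Nb cs] t]|] //=.
  case/andP => /nilP t0; have [[N Cs] [[-> ->] ->]] := p2 _ _ _ E.
  rewrite t0 cats0 /=; case: Cs => [|C Cs]; first by rewrite /decide_parsed if_same.
  case sC: (size Cs == r); last first.
    by rewrite /decide_parsed /= size_map sC /= if_same.
  pose S := Succinct N C (Tuple sC).
  case: (posnP N) => [->|N0].
    rewrite /decide_parsed count_upE minn0 eqxx /= andbC.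
    by rewrite /checked_eval.
  case: (leqP N (size w)) => [le|gt]; last first.
    by rewrite /decide_parsed count_upE (minn_idPl (ltnW gt)) (inj_eq cbin_inj)
      ltn_eqF.
  have NN : 0 < vertices S <= size w by rewrite N0.
  by rewrite (dec S NN) => /andP[ok Mo]; exists S.
move=> [S [-> NN ok Mo]]; rewrite /decide /=.
have := p1 (vertices S, edge_circuit S :: color_circuits S) [::].
by rewrite cats0 /= => ->; rewrite /= dec // ok Mo.
Qed.

(** * Verification of satisfying assignments *)

Definition rep_literal (l : literal) : bool * seq bool := (l.1, cbin l.2).

Definition parse_cnf : parser (seq (seq (bool * seq bool))) :=
  parse_seq (parse_seq (parse_pair parse_bit parse_nat)).

Lemma parse_cnfP : parses parse_cnf enc_cnf (map (map rep_literal)).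
Proof. exact: parse_seqP (parse_seqP (parse_pairP parse_bitP parse_natP)). Qed.

Lemma FP_parse_cnf : FP parse_cnf.
Proof.
have F1 := FP_parse_pair FP_parse_bit FP_parse_nat.
have S1 := parse_pair_sz parse_bit_sz parse_nat_sz.
exact: FP_parse_seq (FP_parse_seq F1 S1) (parse_seq_sz S1).
Qed.

(* The certificate is the list of the true variables. *)
Definition verify (s : seq bool) : bool :=
  if parse_seq parse_bit s is Some u then
    if parse_cnf u.1 is Some F then
      if parse_seq parse_nat u.2 is Some Y then
        nilp F.2 &&
        all (fun c => has (fun l => has (fun v => v == l.2) Y.1 == l.1) c) F.1
      else false
    else false
  else false.

Lemma FP_verify : FP verify.
Proof.
rewrite /verify; apply: FP_omatch; [|by fp|cbv beta].
  exact: FP_parse_seq FP_parse_bit parse_bit_sz.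
apply: FP_omatch; [|by fp|cbv beta].
  by apply: (FP_comp FP_parse_cnf); fp.
apply: FP_omatch; [|by fp|cbv beta].
  by apply: (FP_comp (FP_parse_seq FP_parse_nat parse_nat_sz)); fp.
apply: FP_andb; first by apply: FP_nilp; fp.
apply: FP_all; first by fp.
apply: FP_has; first by fp.
apply: FP_eqb; last by fp.
apply: FP_has; first by fp.
by apply: FP_eqbits; fp.
Qed.

Lemma verifyP x y :
  verify (enc_pair x y) <-> exists F (Y : seq nat) t,
    [/\ x = enc_cnf F, y = enc_seq enc_nat Y ++ t &
        all (has (fun l : literal => (l.2 \in Y) == l.1)) F].
Proof.
have [b1 _] := parse_seqP parse_bitP; have [c1 c2] := parse_cnfP.
have [n1 n2] := parse_seqP parse_natP.
rewrite /verify b1 /= map_id.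
have evalE F (Y : seq nat) :
    all (fun c => has (fun l => has (fun v => v == l.2) (map cbin Y) == l.1) c)
      (map (map rep_literal) F) =
    all (has (fun l : literal => (l.2 \in Y) == l.1)) F.
  rewrite all_map; apply: eq_all => c /=; rewrite has_map; apply: eq_has => l /=.
  congr (_ == _); rewrite has_map -has_pred1; apply: eq_has => v /=.
  by rewrite (inj_eq cbin_inj).
split.
  case E: (parse_cnf x) => [[F' t]|] //=.
  case E': (parse_seq _ y) => [[Y' t']|] //=.
  have [F [-> ->]] := c2 _ _ _ E; have [Y [-> ->]] := n2 _ _ _ E'.
  move=> /andP[/nilP-> H]; exists F, Y, t'; rewrite cats0; split=> //.
  by rewrite -evalE.
move=> [F [Y [t [-> -> H]]]].
have := c1 F [::]; rewrite cats0 => ->; rewrite n1 /=.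
by rewrite evalE.
Qed.

Lemma SAT_verify x :
  SAT x <-> exists y, size y <= size x ^ 1 + 1 /\ verify (enc_pair x y).
Proof.
split; last first.
  move=> [y [_ /verifyP[F [Y [t [-> _ H]]]]]].
  by exists F => //; exists (fun i => i \in Y).
move=> [F -> [a Ha]].
(* Only variables occurring in [F] are listed, at most once per literal. Each numeral is shorter
   than the code of its literal, which bounds the certificate by the length of the formula. *)
pose Y := [seq l.2 | l : literal <- flatten F & a l.2].
exists (enc_seq enc_nat Y ++ [::]); split.
  rewrite cats0 expn1 addn1.
  have sS T (e : T -> seq bool) s : size (enc_seq e s) = (sumn (map (fun x =>
    (size (e x)).+1) s)).+1.
    by elim: s => // x' s IH; rewrite enc_seq_cons /= size_cat IH addnS.
  rewrite /enc_cnf !sS ltnS {}/Y; elim: F {Ha} => //= c F IH.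
  rewrite filter_cat map_cat map_cat sumn_cat sS.
  enough (H : sumn [seq (size (enc_nat x)).+1 | x <- [seq l.2 | l <- c & a l.2]]
    <= sumn [seq (size (enc_literal x)).+1 | x <- c]).
    by apply: leq_trans (leq_add H IH) _; rewrite addnS ltnS leq_add2r !leqW.
  elim: c => //= l c IHc; case: (a l.2) => /=; lia.
apply/verifyP; exists F, Y, [::]; split=> //.
have {}Ha : all (fun c => has (fun l : literal => a l.2 == l.1) c) F by [].
have H : forall l : literal, l \in flatten F -> (l.2 \in Y) = a l.2.
  move=> l lF; apply/mapP/idP => [[l']|al].
    by rewrite mem_filter => /andP[al' _] ->.
  by exists l => //; rewrite mem_filter al.
apply/allP => c cF; have /hasP[l lc /eqP El] := allP Ha c cF.
apply/hasP; exists l => //; rewrite H ?El //.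
by apply/flattenP; exists c.
Qed.

(** * Composition with a Turing machine *)

Lemma pbound_polytime A {cA : code A} (h n : A -> nat) :
  (forall x, sz x <= 4 * n x + 1) -> pbound h ->
  exists d, forall x, h x <= n x ^ d + d.
Proof.
(* The base is at most 4n + 3. This is at most 7 for n at most 1, and at most n^4 for n at least
   2. *)
move=> le [e H]; exists (4 * e + 7 ^ e) => x.
apply: leq_trans (H x) _; apply: (@leq_trans ((4 * n x + 3) ^ e)).
  by case: (e) => // k; rewrite leq_exp2r //; have := le x; lia.
case: (leqP (n x) 1) => [n1|n2].
  apply: (@leq_trans (7 ^ e)); last by lia.
  by case: (e) => // k; rewrite leq_exp2r //; lia.
apply: (@leq_trans ((n x ^ 4) ^ e)).
  case: (e) => // k; rewrite leq_exp2r // !expnS expn0 muln1.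
  have : 8 <= n x * (n x * n x) by rewrite (@leq_mul 2 4) ?(@leq_mul 2 2).
  by nia.
rewrite -expnM; apply: leq_trans (leq_addr _ _).
by rewrite leq_pexp2l ?leq_addr // ltnW.
Qed.

Section OutputSize.

Variable M : tm.

Definition tape_size X (t : tape X) : nat := size (lpart t) + size (rpart t).

Lemma tape_size_write X (t : tape X) am :
  tape_size (write_move t am) <= (tape_size t).+1.
Proof.
by case: t am => l x r [a []]; rewrite /tape_size /= ?size_behead; lia.
Qed.

Lemma tape_size_iter (c : config M) t i :
  tape_size (tnth (iter t (@Defs.step M) c).2 i) <= tape_size (tnth c.2 i) + t.
Proof.
elim: t => [|t IH]; first by rewrite addn0.
rewrite iterS addnS; apply: leq_trans (_ : _ <= (tape_size _).+1) _; last exact: IH.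
case: (iter t _ c) => q ts; rewrite /Defs.step /=; case: halting => //=.
case: delta => q' acts /=; rewrite tnth_mktuple; exact: tape_size_write.
Qed.

Lemma size_read_bits X (s : seq (cell X)) : size (read_bits s) <= size s.
Proof. by elim: s => //= -[[b|]|] s //= IH; lia. Qed.

Lemma size_output t w :
  size (Defs.output (iter t (@Defs.step M) (init M w))) <= (size w + t).+1.
Proof.
apply: leq_trans (size_read_bits _) _; rewrite /= ltnS.
have := tape_size_iter (init M w) t ord0; rewrite tnth_mktuple eqxx.
have : tape_size (tape_of_seq [seq Some (inl b) | b <- w] : tape (aux M)) <= size w.
  by rewrite /tape_size /= size_behead size_map leq_pred.
by rewrite /tape_size; lia.
Qed.

End OutputSize.

(** A step lengthens the stored part of a tape by at most one cell, so the running time bounds the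
    output. *)
Lemma polytime_size f : polytime f -> exists d, forall w, size (f w) <= size w
  ^ d + d.
Proof.
move=> [M [d H]].
have [||e He] := @pbound_polytime (seq bool) _
  (fun w => (size w + (size w ^ d + d)).+1) (fun w => size w).
- by move=> s; rewrite addn1; apply: sz_bits.
- apply: pbound_S; apply: pbound_add; last apply: pbound_add; last by pb.
    by apply: pbound_le pbound_sz => w; apply: ltnW; apply: sz_size.
  apply: pbound_exp; apply: pbound_le pbound_sz => w; apply: ltnW; apply: sz_size.
exists e => w; apply: leq_trans (He w).
by have [_ <-] := H w; apply: size_output.
Qed.

Section Composition.

Variables (M : tm) (cg : scmd).

Let m := tapes M.
(** Structured programs carry no data in their control, so the current state of [M] is written on a
    tape and the states join the alphabet. *)
Definition symbols : finType := (aux M + state M)%type.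
(** There are [T.+1] tapes: the [m.+1] tapes of [M], one for its state, and five stacks. *)
Let T := m + 6.
Notation X := symbols.
Notation tapes_of := (tape_tuple X T).

Definition emb_cell (x : cell (aux M)) : cell X :=
  match x with
  | None => None
  | Some (inl b) => Some (inl b)
  | Some (inr a) => Some (inr (inl a))
  end.

Definition proj_cell (x : cell X) : cell (aux M) :=
  match x with
  | Some (inl b) => Some (inl b)
  | Some (inr (inl a)) => Some (inr a)
  | _ => None
  end.

Lemma emb_cellK : cancel emb_cell proj_cell.
Proof. by case=> [[b|a]|]. Qed.

Lemma le_tapes : m.+1 <= T.+1.
Proof. by rewrite ltnS leq_addr. Qed.

Definition work_tape (i : 'I_m.+1) : 'I_T.+1 := widen_ord le_tapes i.
Definition state_tape : 'I_T.+1 := inord m.+1.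
Definition stack_tape (j : 'I_5) : 'I_T.+1 := inord (m + 2 + j).

Lemma val_state_tape : state_tape = m.+1 :> nat.
Proof. by rewrite inordK // /T; lia. Qed.

Lemma val_stack_tape j : stack_tape j = m + 2 + j :> nat.
Proof. by rewrite inordK // /T; have := ltn_ord j; lia. Qed.

Lemma stack_tape_inj : injective stack_tape.
Proof.
move=> i j /(congr1 val); rewrite /= !val_stack_tape => /addnI; exact: val_inj.
Qed.

Lemma stack_work j i : (stack_tape j == work_tape i) = false.
Proof.
apply/eqP => /(congr1 val); rewrite /= val_stack_tape.
by have := ltn_ord i; rewrite /m; lia.
Qed.

Lemma stack_state j : (stack_tape j == state_tape) = false.
Proof. by apply/eqP => /(congr1 val); rewrite /= val_stack_tape val_state_tape;
  lia. Qed.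

Lemma state_work i : (state_tape == work_tape i) = false.
Proof.
apply/eqP => /(congr1 val); rewrite /= val_state_tape.
by have := ltn_ord i; rewrite /m; lia.
Qed.

Definition main_tape : 'I_T.+1 := work_tape ord0.

Definition is_bit (x : cell X) : bool := if x is Some (inl _) then true else false.

Definition move_main (mv : move) : cmd X T := Act (act1 main_tape (fun x => (x,
  mv))).

Definition copy_main (k : 'I_5) : cmd X T :=
  While (fun sc => is_bit (tnth sc main_tape))
    (Seq (If (fun sc => tnth sc main_tape == bit_cell X true)
            (compile X stack_tape (Push k true)) (compile X stack_tape (Push k
              false)))
         (move_main MoveR)).

Definition rewind_main : cmd X T :=
  Seq (move_main MoveL)
    (Seq (While (fun sc => is_bit (tnth sc main_tape)) (move_main MoveL))
         (move_main MoveR)).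

Definition state_of (sc : scans X T) : option (state M) :=
  if tnth sc state_tape is Some (inr (inr q)) then Some q else None.

Definition simulate_actions (sc : scans X T) : actions X T :=
  if state_of sc is Some q then
    let: (q', acts) := delta q [tuple proj_cell (tnth sc (work_tape i)) | i <
      m.+1] in
    [tuple if i == state_tape then (Some (inr (inr q')), Stay)
           else if i < m.+1 then
             (emb_cell (tnth acts (inord i)).1, (tnth acts (inord i)).2)
           else (tnth sc i, Stay) | i < T.+1]
  else idle sc.

Definition simulate : cmd X T :=
  Seq (Act (act1 state_tape (fun _ => (Some (inr (inr (start M))), Stay))))
    (While (fun sc => if state_of sc is Some q then ~~ halting q else false)
       (Act simulate_actions)).

(** A list element is its code preceded by the bit [true] of the cons; it is pushed from its end. *)
Definition load_bit (b : bool) : scmd :=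
  if b then SSeq (Push sD false) (SSeq (Push sD false) (SSeq (Push sD true)
    (Push sD true)))
  else SSeq (Push sD false) (Push sD true).

Definition load : scmd :=
  SSeq (Push sD false) (SSeq (drain sA load_bit)
    (SSeq (Push sD false) (SSeq (drain sE load_bit) (Push sD true)))).

(** The output is a maximal word of bits, so the cell to the right is blanked before the answer is
    written. *)
Definition answer (b : bool) : cmd X T :=
  Seq (move_main MoveR)
    (Seq (Act (act1 main_tape (fun _ => (None, MoveL))))
         (Act (act1 main_tape (fun _ => (bit_cell X b, Stay))))).

(** The input is saved on [sE] before the simulation of [M], which may overwrite it, because [g]
    reads both the input and the output of [M]. *)
Definition composition : cmd X T :=
  Seq (copy_main sE) (Seq rewind_main (Seq simulate (Seq (copy_main sA)
    (Seq (compile X stack_tape (SSeq load cg))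
       (If (fun sc => top_of stack_tape sD sc == Some true)
          (answer true) (answer false)))))).

Definition on_stack (i : 'I_T.+1) : bool := [exists j, i == stack_tape j].

Definition same_but (P : pred 'I_T.+1) (ts ts' : tapes_of) : Prop :=
  forall i, ~~ P i -> tnth ts' i = tnth ts i.

Lemma on_stackP i : reflect (forall j, i != stack_tape j) (~~ on_stack i).
Proof. by rewrite negb_exists; apply: forallP. Qed.

Lemma represents_same P ts ts' S : same_but P ts ts' ->
  (forall j, ~~ P (stack_tape j)) ->
  represents stack_tape ts S -> represents stack_tape ts' S.
Proof. by move=> same nP rep j; rewrite same. Qed.

Lemma main_not_stack j : stack_tape j != main_tape.
Proof. by rewrite stack_work. Qed.

Lemma move_mainE mv (ts : tapes_of) : exists ts',
  [/\ runs (move_main mv) ts ts' 1,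
      tnth ts' main_tape = write_move (tnth ts main_tape) (scan (tnth ts
        main_tape), mv) &
      same_but (pred1 main_tape) ts ts'].
Proof.
eexists; split; first exact: runs_act.
  by rewrite act1E eqxx.
by move=> i /negbTE ne; rewrite act1E -[i == _]/(pred1 main_tape i) ne.
Qed.

Lemma copy_mainP (k : 'I_5) s rest u ts S :
  is_bit (head None rest) = false ->
  tape_at (tnth ts main_tape) u (map (bit_cell X) s ++ rest) ->
  represents stack_tape ts S ->
  exists ts', [/\ runs (copy_main k) ts ts' (5 * size s + 1),
    tape_at (tnth ts' main_tape) (rev (map (bit_cell X) s) ++ u) rest,
    represents stack_tape ts' (set_nth [::] S k (rev s ++ stack S k)) &
    same_but (fun i => (i == main_tape) || on_stack i) ts ts'].
Proof.
move=> nb; elim: s u ts S => [|b s IH] u ts S Hat Hrep.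
  exists ts; split=> //.
    by apply: runs_while_stop; rewrite tnth_map (tape_at_scan Hat) /= nb.
  move=> j; rewrite /stack nth_set_nth /= (inj_eq val_inj).
  by case: eqP => [->|_]; apply: Hrep.
have [ts1 [rep1 run1 same1]] := compileP stack_tape_inj (exec_push k b S) Hrep.
have [ts2 [run2 main2 same2]] := move_mainE MoveR ts1.
have at2 : tape_at (tnth ts2 main_tape) (bit_cell X b :: u) (map (bit_cell X) s
  ++ rest).
  rewrite main2 same1; last by move=> j; rewrite eq_sym main_not_stack.
  by rewrite (tape_at_scan Hat); apply: (tape_at_write (bit_cell X b) MoveR Hat).
have rep2 : represents stack_tape ts2 (set_nth [::] S k (b :: stack S k)).
  by apply: represents_same same2 _ rep1 => j; apply: main_not_stack.
have [ts3 [run3 at3 rep3 same3]] := IH _ _ _ at2 rep2.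
exists ts3; split.
- have body : runs (Seq (If (fun sc => tnth sc main_tape == bit_cell X true)
      (compile X stack_tape (Push k true)) (compile X stack_tape (Push k false)))
      (move_main MoveR)) ts ts2 (3 + 1).
    apply: runs_seq run2; apply: runs_if.
    rewrite tnth_map (tape_at_scan Hat) /=.
    by case: (b) run1.
  apply: runs_weaken (runs_while_step _ body run3); first by rewrite /=; lia.
  by rewrite tnth_map (tape_at_scan Hat).
- by rewrite /= rev_cons cat_rcons.
- move: rep3; rewrite rev_cons cat_rcons /stack nth_set_nth /= eqxx.
  by rewrite set_set_nth eqxx.
- move=> i ni; rewrite same3 //; move: ni => /norP[n1 /on_stackP n2].
  by rewrite same2 ?same1.
Qed.

Lemma rewind_mainP s u ts :
  tape_at (tnth ts main_tape) (map (bit_cell X) u) (map (bit_cell X) s) ->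
  exists ts', [/\ runs rewind_main ts ts' (2 * size u + 3),
    tape_at (tnth ts' main_tape) [::] (map (bit_cell X) (rev u ++ s)) &
    same_but (pred1 main_tape) ts ts'].
Proof.
move=> Hat.
enough (H : exists ts1 ts', [/\ runs (move_main MoveL) ts ts1 1,
  runs (While (fun sc => is_bit (tnth sc main_tape)) (move_main MoveL)) ts1 ts'
    (2 * size u + 1),
  tape_at (tnth ts' main_tape) [::] (None :: map (bit_cell X) (rev u ++ s)),
  same_but (pred1 main_tape) ts ts1 & same_but (pred1 main_tape) ts1 ts']).
  have [ts1 [ts2 [run1 run2 at2 same1 same2]]] := H.
  have [ts3 [run3 main3 same3]] := move_mainE MoveR ts2.
  exists ts3; split.
  - apply: runs_weaken (runs_seq run1 (runs_seq run2 run3)); lia.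
  - rewrite main3; have := tape_at_write (scan (tnth ts2 main_tape)) MoveR at2.
    apply: tape_at_ext => //= -[|i] //=; rewrite ?(tape_at_scan at2) ?nth_nil //.
  - by move=> i ne; rewrite same3 ?same2 ?same1.
elim: u s ts Hat => [|b u IH] s ts Hat;
  have [ts1 [run1 main1 same1]] := move_mainE MoveL ts.
- have at1 : tape_at (tnth ts1 main_tape) [::] (None :: map (bit_cell X) s).
    rewrite main1; have := tape_at_write (scan (tnth ts main_tape)) MoveL Hat.
    apply: tape_at_ext => //= -[|i] //=.
    by rewrite (tape_at_scan Hat) nth_head_behead.
  exists ts1, ts1; split=> //.
  by apply: runs_while_stop; rewrite tnth_map (tape_at_scan at1).
- have at1 : tape_at (tnth ts1 main_tape) (map (bit_cell X) u) (map (bit_cell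
  X) (b :: s)).
    rewrite main1; have := tape_at_write (scan (tnth ts main_tape)) MoveL Hat.
    apply: tape_at_ext => //= -[|i] //=.
    by rewrite (tape_at_scan Hat) nth_head_behead.
  have [ts2 [ts3 [run2 run3 at3 same2 same3]]] := IH _ _ at1.
  exists ts1, ts3; split=> //.
  + apply: runs_weaken (runs_while_step _ run2 run3); first by rewrite /=; lia.
    by rewrite tnth_map (tape_at_scan at1).
  + by rewrite rev_cons cat_rcons.
  + by move=> i ne; rewrite same3 ?same2.
Qed.

Definition simulates (c : config M) (ts : tapes_of) : Prop :=
  scan (tnth ts state_tape) = Some (inr (inr c.1)) /\
  forall i : 'I_m.+1, tape_at (tnth ts (work_tape i))
    (map emb_cell (lpart (tnth c.2 i)))
    (map emb_cell (scan (tnth c.2 i) :: rpart (tnth c.2 i))).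

Lemma emb_write t t' am :
  tape_at t' (map emb_cell (lpart t)) (map emb_cell (scan t :: rpart t)) ->
  let t1 := write_move t am in
  tape_at (write_move t' (emb_cell am.1, am.2))
    (map emb_cell (lpart t1)) (map emb_cell (scan t1 :: rpart t1)).
Proof.
have nthE (s : seq (cell (aux M))) j : nth None (map emb_cell s) j = emb_cell
  (nth None s j).
  case: (ltnP j (size s)) => lt; first by rewrite (nth_map None).
  by rewrite !nth_default ?size_map.
move=> H; case: t am H => l x r [a mv] /= /(tape_at_write (emb_cell a) mv).
apply: tape_at_ext; case: mv => //= i.
- by rewrite !nthE behead_map nthE.
- case: i => [|[|i]] //=.
  by rewrite -[emb_cell _]/(emb_cell (head None l)); case: (l).
- by case: r => [|y r] //=; case: i => [|i] //=; rewrite ?nth_nil.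
Qed.

Lemma simulate_step (c : config M) (ts : tapes_of) :
  ~~ halting c.1 -> simulates c ts -> exists ts',
  [/\ runs (Act simulate_actions) ts ts' 1, simulates (@Defs.step M c) ts' &
     same_but (fun i => (i == state_tape) || (i < m.+1)) ts ts'].
Proof.
case: c => q tsM /= nh [Hq Hts].
eexists; split; first exact: runs_act.
  have Eq : state_of (scan_all ts) = Some q by rewrite /state_of tnth_map Hq.
  rewrite /Defs.step /= (negbTE nh).
  have Esc : [tuple proj_cell (tnth (scan_all ts) (work_tape i)) | i < m.+1] =
      map_tuple (@scan _) tsM.
    apply: eq_from_tnth => i; rewrite tnth_mktuple !tnth_map.
    by rewrite (tape_at_scan (Hts i)) /= emb_cellK.
  rewrite /simulate_actions Eq Esc.
  case E: (delta q _) => [q' acts]; split=> /=.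
    by rewrite tnth_mktuple tnth_mktuple eqxx.
  move=> i; rewrite !tnth_mktuple eq_sym state_work /= ltn_ord inord_val.
  exact: emb_write.
move=> i /norP[n1 n2]; rewrite tnth_mktuple /simulate_actions.
rewrite /state_of tnth_map Hq; case: delta => q' acts.
by rewrite tnth_mktuple (negbTE n1) (negbTE n2) tnth_map; case: (tnth ts i).
Qed.

Lemma simulate_loop t (c : config M) (ts : tapes_of) :
  halting (iter t (@Defs.step M) c).1 -> simulates c ts -> exists ts',
  [/\ runs (While (fun sc => if state_of sc is Some q then ~~ halting q else false)
             (Act simulate_actions)) ts ts' (2 * t + 1),
     simulates (iter t (@Defs.step M) c) ts' &
     same_but (fun i => (i == state_tape) || (i < m.+1)) ts ts'].
Proof.
have stop c' ts' : halting c'.1 -> simulates c' ts' ->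
    runs (While (fun sc => if state_of sc is Some q then ~~ halting q else false)
             (Act simulate_actions)) ts' ts' 1.
  move=> h [Hq _]; apply: runs_while_stop.
  by rewrite /state_of tnth_map Hq h.
elim: t c ts => [|t IH] c ts h sim; first by exists ts; split=> //; apply: stop sim.
case: (boolP (halting c.1)) => hc.
  have E : iter t.+1 (@Defs.step M) c = c.
    by elim: (t.+1) => //= n ->; case: (c) hc => q tsM /= ->.
  exists ts; split; rewrite ?E //.
  by apply: runs_weaken (stop _ _ hc sim); lia.
have [ts1 [run1 sim1 same1]] := simulate_step hc sim.
rewrite iterSr in h *; have [ts2 [run2 sim2 same2]] := IH _ _ h sim1.
exists ts2; split=> //; last by move=> i ne; rewrite same2 ?same1.
apply: runs_weaken (runs_while_step _ run1 run2); first by lia.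
by case: sim => Hq _; rewrite /state_of tnth_map Hq.
Qed.

Lemma read_bits_split (s : seq (cell (aux M))) : exists rest,
  map emb_cell s = map (bit_cell X) (read_bits s) ++ rest /\
  is_bit (head None rest) = false.
Proof.
elim: s => [|[[b|a]|] s [rest [E nb]]]; first by exists [::].
- by exists rest; split=> //=; rewrite E.
- by exists (Some (inr (inl a)) :: map emb_cell s).
- by exists (None :: map emb_cell s).
Qed.

Lemma exec_load x y : exec load [:: [::]; rev y; [::]; [::]; rev x]
  (data (enc (x, y))) (11 * (size x + size y) + 8).
Proof.
have drain_load (k : 'I_5) (f : seq bool -> seq bool -> stacks) u :
    (forall u v, stack (f u v) k = u) ->
    (forall u v w, set_nth [::] (f u v) k w = f w v) ->
    (forall c u v, exec (Push sD c) (f u v) (f u (c :: v)) 2) ->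
    exec (drain k load_bit) (f (rev u) (enc ([::] : seq bool))) (f [::] (enc u))
      (11 * size u + 1).
  move=> gk uk P.
  have := @exec_drain k load_bit (seq bool) (fun u l => f u (enc l)) cons 8 _ _ _
    (rev u) [::].
  rewrite foldl_cons revK cats0 size_rev; apply=> // b v l.
  case: b.
    by apply: exec_weaken (exec_seq (P _ _ _) (exec_seq (P _ _ _)
      (exec_seq (P _ _ _) (P _ _ _)))).
  by apply: exec_weaken (exec_seq (P _ _ _) (P _ _ _)).
have H1 := drain_load sA (fun a d => [:: d; a; [::]; [::]; rev x]) y
  (fun _ _ => erefl) (fun _ _ _ => erefl) (fun _ _ _ => exec_push_eq erefl).
pose (ey := enc y).
have H2 := drain_load sE (fun e d => [:: d ++ ey; [::]; [::]; [::]; e]) x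
  (fun _ _ => erefl) (fun _ _ _ => erefl) (fun _ _ _ => exec_push_eq erefl).
apply: (@exec_weaken _ _ _ (2 + ((11 * size y + 1) + (2 + ((11 * size x + 1) +
  2)))));
  first by lia.
have P1 : exec (Push sD false) [:: [::]; rev y; [::]; [::]; rev x]
    [:: [:: false]; rev y; [::]; [::]; rev x] 2 by apply: exec_push_eq.
have P2 : exec (Push sD false) [:: enc y; [::]; [::]; [::]; rev x]
    [:: false :: enc y; [::]; [::]; [::]; rev x] 2 by apply: exec_push_eq.
apply: exec_seq P1 (exec_seq H1 (exec_seq P2 (exec_seq H2 _))).
exact: exec_push_eq.
Qed.

Variables (f : seq bool -> seq bool) (d : nat).
Hypothesis fM : forall w,
  let c := iter (size w ^ d + d) (@Defs.step M) (init M w) in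
  halting c.1 /\ Defs.output c = f w.

Variables (g : seq bool * seq bool -> bool) (hg : seq bool * seq bool -> nat).
Hypothesis cgP : forall p r, exec cg (data (enc p ++ r)) (data (enc (g p) ++
  r)) (hg p).

Definition composition_time (w : seq bool) : nat :=
  (5 * size w + 1) + ((2 * size w + 3) + ((1 + (2 * (size w ^ d + d) + 1)) +
    ((5 * size (f w) + 1) + ((11 * (size w + size (f w)) + 8 + hg (w, f w)) + 4)))).

Lemma answerP b (ts : tapes_of) : exists ts',
  runs (answer b) ts ts' 3 /\
  read_bits (scan (tnth ts' main_tape) :: rpart (tnth ts' main_tape)) = [:: b].
Proof.
eexists; split.
  exact: runs_seq (runs_act _ _) (runs_seq (runs_act _ _) (runs_act _ _)).
by do 3 rewrite act1E eqxx; case: (tnth ts main_tape) => l x r.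
Qed.

Lemma compositionP w : exists ts',
  runs composition (init (machine composition) w).2 ts' (composition_time w) /\
  read_bits (scan (tnth ts' main_tape) :: rpart (tnth ts' main_tape)) =
    [:: g (w, f w)].
Proof.
set ts0 := (init _ _).2.
have main0 : main_tape = ord0 by apply: val_inj.
have blank i : i != ord0 -> tape_at (tnth ts0 i) [::] [::].
  by move=> /negbTE ne; rewrite tnth_mktuple ne; split=> // -[|j] //=; rewrite
    nth_nil.
have at0 : tape_at (tnth ts0 main_tape) [::] (map (bit_cell X) w ++ [::]).
  rewrite main0 tnth_mktuple eqxx cats0; split=> // i /=.
  by rewrite nth_head_behead.
have rep0 : represents stack_tape ts0 [:: [::]; [::]; [::]; [::]; [::]].
  move=> j; have -> : stack [:: [::]; [::]; [::]; [::]; [::]] j = [::].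
    by case: j => -[|[|[|[|[|]]]]].
  by apply: blank; rewrite -main0 main_not_stack.
have [ts1 [run1 at1 rep1 same1]] := copy_mainP sE (rest := [::]) erefl at0 rep0.
rewrite cats0 -map_rev in at1.
have [ts2 [run2 at2 same2]] := rewind_mainP (s := [::]) at1.
rewrite revK cats0 in at2; rewrite size_rev in run2.
have rep2 := represents_same same2 main_not_stack rep1.
pose act0 := act1 state_tape (fun _ => (Some (inr (inr (start M))), Stay)) :
  scans X T -> actions X T.
pose ts3 := act_all ts2 (act0 (scan_all ts2)).
have same3 : same_but (pred1 state_tape) ts2 ts3.
  by move=> i /negbTE ne; rewrite act1E -[i == _]/(pred1 state_tape i) ne.
have sim3 : simulates (init M w) ts3.
  split; first by rewrite act1E eqxx.
  move=> i; rewrite same3 /= 1?eq_sym ?state_work // tnth_mktuple.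
  case: (eqVneq i ord0) => [->|ne].
    apply: tape_at_ext at2 => // j /=.
    case: w {ts0 blank at0 rep0 ts1 run1 at1 rep1 same1 ts2 run2 same2 rep2 ts3
      same3} => [|b s] /=.
      by rewrite nth_nil; case: j => //= j; rewrite nth_nil.
    by rewrite -map_comp.
  have nw : work_tape i != main_tape.
    by apply: contra ne => /eqP /(congr1 val) /= E; apply/eqP/val_inj.
  have -> : tnth ts2 (work_tape i) = tnth ts0 (work_tape i).
    rewrite same2 // same1 // negb_or nw /=.
    by apply/on_stackP => j; rewrite eq_sym stack_work.
  apply: tape_at_ext (blank _ _) => [j|j|] //=.
    by rewrite nth_nil; case: j => //= j; rewrite nth_nil.
have [halt outE] := fM w.
have [ts4 [run4 sim4 same4]] := simulate_loop halt sim3.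
have rep4 : represents stack_tape ts4 [:: [::]; [::]; [::]; [::]; rev w ++ [::]].
  apply: (represents_same same4) => [j|].
    by rewrite negb_or stack_state /= val_stack_tape -leqNgt; lia.
  by apply: (represents_same same3) rep2 => j; rewrite /= stack_state.
have [rest [splitE nb]] := read_bits_split
  (scan (tnth (iter (size w ^ d + d) (@Defs.step M) (init M w)).2 ord0) ::
   rpart (tnth (iter (size w ^ d + d) (@Defs.step M) (init M w)).2 ord0)).
have at4 := sim4.2 ord0; rewrite splitE -[read_bits _]/(Defs.output _) outE in at4.
have [ts5 [run5 _ rep5 _]] := copy_mainP sA nb at4 rep4.
rewrite /= !cats0 in rep5.
have [ts6 [rep6 run6 _]] := compileP stack_tape_inj
  (exec_seq (exec_load w (f w)) (eq_ind _ (fun z => exec cg (data z) _ _) (cgP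
    (w, f w) [::]) _ (cats0 _))) rep5.
have [ts7 [run7 ans7]] := answerP (g (w, f w)) ts6.
exists ts7; split=> //; rewrite /composition_time.
apply: runs_seq run1 _; apply: runs_seq run2 _.
apply: runs_seq; first exact: runs_seq (runs_act _ _) run4.
apply: runs_seq run5 _; apply: runs_seq run6 _.
apply: runs_if; rewrite (represents_top _ rep6) /= cats0.
by case: (g (w, f w)) run7.
Qed.

End Composition.

(** The bridge between the two notions of polynomial time: a reduction is given only as a Turing
    machine, whereas the decision procedure is given as a stack program. *)
Lemma polytime_compose (f : seq bool -> seq bool) (g : seq bool * seq bool ->
  bool) :
  polytime f -> FP g -> polytime (fun w => [:: g (w, f w)]).
Proof.
move=> pf [sg [cg [hg [ph Hg]]]]; have [e se] := polytime_size pf.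
have [M [d fM]] := pf.
have sw : pbound (fun w : seq bool => size w).
  by apply: pbound_le pbound_sz => w; apply: ltnW; apply: sz_size.
have sf : pbound (fun w => size (f w)) by apply: pbound_le se _; pb.
have shg : pbound (fun w => hg (w, f w)).
  apply: (pbound_comp (h := hg) (f := fun w => (w, f w))) => //.
  apply: (@pbound_le _ _ _ (fun w => (sz w + (4 * size (f w)).+1).+1)); last by pb.
  by move=> w; rewrite sz_pair ltnS leq_add2l; apply: sz_bits.
have [||D HD] := @pbound_polytime (seq bool) _ (composition_time f d hg)
  (fun w => size w).
- by move=> s; rewrite addn1; apply: sz_bits.
- by rewrite /composition_time; pb.
exists (machine (composition M cg)), D => w.
have [ts [rt out]] := compositionP fM Hg w.
have E := runs_machine (runs_weaken (HD w) rt).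
have -> : iter (size w ^ D + D) (@Defs.step (machine (composition M cg)))
  (init (machine (composition M cg)) w) = (None, ts) by exact: E.
split=> //; rewrite -out /Defs.output.
by have -> : ord0 = main_tape M by apply: val_inj.
Qed.

Lemma polytime_id : polytime id.
Proof.
pose M := @TM 0 unit void tt predT (fun q sc => (q, map_tuple (fun x => (x,
  Stay)) sc)).
exists M, 0 => w c; rewrite {}/c.
have -> : iter (size w ^ 0 + 0) (@Defs.step M) (init M w) = init M w.
  by elim: (size w ^ 0 + 0) => //= n ->.
split=> //; rewrite /Defs.output /= tnth_mktuple eqxx.
by case: w => // b s /=; elim: s => //= c s [->].
Qed.

(** * SAT in NP, and the algorithm obtained from hardness *)

Lemma NP_SAT : NP SAT.
Proof.
exists (fun w => [:: verify w]), 1; split.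
  apply: (polytime_compose (g := fun p => verify p.1) polytime_id).
  by apply: (FP_comp FP_verify); fp.
move=> x; rewrite SAT_verify; split=> -[y [le H]]; exists y; split=> //.
  by rewrite H.
by case: H.
Qed.

(** A reduction with output length at most n^d + d encodes fewer than 2^(n^d + d) vertices. For n
    between l and l^k all these numbers lie below the upper end of the gap. *)
Definition spectrum_gaps r (psi : sentence r) : Prop :=
  forall k d, exists2 l, 2 <= l &
    forall G : cgraph r, models G psi -> ~ (l < nvert G < 2 ^ ((l ^ k) ^ d + d)).

Lemma vertices_lt r (S : succinct r) : vertices S < 2 ^ size (enc_succinct S).
Proof.
apply: leq_trans (ltn_cbin _) _; rewrite leq_pexp2l //.
rewrite /enc_succinct size_cat; apply: leq_trans (leq_addr _ _).
rewrite /enc_nat -[X in X <= _](size_bin _ (vertices S)).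
by apply: ltnW; apply: size_enc_seq.
Qed.

Lemma decide_reduction r (psi : sentence r) (f : seq bool -> seq bool) :
  (forall G : cgraph r, models G psi -> 0 < nvert G) ->
  spectrum_gaps psi -> polytime f ->
  exists M, robust M /\
    forall w, M (size w) -> dynamics psi (f w) <-> decide psi (w, f w).
Proof.
move=> pos gaps /polytime_size[d sf].
(* A length is good if its own gap contains no model; the gap at [l] makes all lengths from l to l^k
   good. *)
exists (fun n => forall G : cgraph r, models G psi -> ~ (n < nvert G < 2 ^ (n ^
  d + d))).
split=> [k|w Mw].
  have [l l2 Hl] := gaps k d; exists l => // n /andP[ln nl] G /Hl no /andP[nG Gn].
  apply: no; rewrite (leq_ltn_trans ln nG) (leq_trans Gn) //.
  rewrite leq_pexp2l // leq_add2r.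
  by case: (d) => // e; rewrite leq_exp2r.
rewrite decideP; split=> [[S [E ok Mo]]|[S [E _ ok Mo]]]; exists S; split=> //.
rewrite (pos _ Mo) leqNgt; apply/negP => lt; apply: (Mw _ Mo); rewrite lt /=.
apply: leq_trans (vertices_lt S) _.
by rewrite leq_pexp2l // -E.
Qed.

Lemma hard_dynamics r (psi : sentence r) :
  (forall G : cgraph r, models G psi -> 0 < nvert G) ->
  spectrum_gaps psi ->
  NP_hard (dynamics psi) \/ coNP_hard (dynamics psi) ->
  robustly_often_polynomial SAT.
Proof.
move=> pos gaps [hard|hard].
- have [f [pf fP]] := hard _ NP_SAT.
  have [M [rM HM]] := decide_reduction pos gaps pf.
  exists M, (fun w => [:: decide psi (w, f w)]); split=> //.
    exact: polytime_compose pf (FP_decide psi).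
  move=> w /HM E; rewrite fP E; by split=> [[]|->].
(* The complement of [SAT] is in coNP, so it reduces to [dynamics psi], and the decision for it is
   negated. *)
- have nn : (fun x => ~ ~ SAT x) = SAT.
    by apply/funext => x; apply/propext; split=> [/contrapT|s ns].
  have [f [pf fP]] : reduces (fun x => ~ SAT x) (dynamics psi).
    by apply: hard; rewrite /coNP nn; apply: NP_SAT.
  have [M [rM HM]] := decide_reduction pos gaps pf.
  exists M, (fun w => [:: ~~ decide psi (w, f w)]); split=> //.
    apply: (polytime_compose (g := fun p => ~~ decide psi p) pf).
    exact: FP_negb (FP_decide psi).
  move=> w /HM E; split=> [[/negP nd]|s].
    by apply: contrapT => /fP /E.
  by congr [:: _]; apply/negP => /E /fP.
Qed.

(** * The formula *)

Record board (V : finType) := Board {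
  par : rel V;   (* [par x y]: the parent of x is y *)
  lnk : rel V;   (* [lnk x y]: x and y are cousins, and y is next to x *)
  cS : pred V;   (* right children *)
  cRt : pred V;  (* the root *)
  cY : pred V;   (* first vertex of a row *)
  cZ : pred V;   (* last vertex of a row *)
  cF : pred V;   (* first vertex of a block *)
  cD : pred V;   (* finished blocks *)
  cP : pred V;   (* rows where an epoch starts *)
  cQ : pred V    (* parity of the epoch *)
}.

Section Rules.

Variables (V : finType) (B : board V).

Definition nxt : rel V := fun x y =>
  lnk B x y || [exists z, [&& par B x z, par B y z, ~~ cS B x & cS B y]].

Definition lkid (y : V) : bool := [exists x, par B x y && ~~ cS B x].
Definition rkid (y : V) : bool := [exists x, par B x y && cS B x].

(** In this order, counted from 0: rules 0 to 5 make a forest with one root in which every inner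
    vertex has exactly one left and one right child; 6 and 7 align the rows; 8 colors the root; 9
    and 10 mark the ends of rows; 11 and 12 split blocks; 13 to 15 govern epochs and their parity.
    Rules 16 to 19 advance the finished blocks. The first block is always finished, and in a
    starting row it is the only one. In any other row, a later block is finished if and only if the
    block before it was finished one row higher: this is read at the parent [z] of the last vertex
    [x] of the preceding block. Rule 20 is the condition on the last row. *)
Definition rules (x y z w : V) : seq bool :=
  [:: (cRt B x && cRt B y) ==> (x == y);
      cRt B x || [exists u, par B x u];
      cRt B x ==> ~~ par B x y;
      (par B x y && par B x z) ==> (y == z);
      par B x y ==> (lkid y && rkid y);
      (par B x z && (par B y z && (cS B x == cS B y))) ==> (x == y);
      nxt x y ==> (lkid x == lkid y);
      (nxt x y && (par B z x && (par B w y && (cS B z && ~~ cS B w)))) ==> lnk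
        B z w;
      cRt B x ==> (cY B x && (cZ B x && (cP B x && ~~ cQ B x)));
      par B x y ==> (cY B x == (cY B y && ~~ cS B x));
      par B x y ==> (cZ B x == (cZ B y && cS B x));
      cP B x ==> cF B x;
      (par B x y && ~~ cP B x) ==> (cF B x == (cF B y && ~~ cS B x));
      nxt x y ==> (cP B x == cP B y);
      (par B x y && cZ B x) ==> (cP B x == cD B y);
      par B x y ==> (cQ B x == ~~ (cQ B y == cP B x));
      cY B x ==> cD B x;
      (nxt x y && ~~ cF B y) ==> (cD B y == cD B x);
      (nxt x y && (cF B y && (~~ cP B y && par B x z))) ==> (cD B y == cD B z);
      (nxt x y && cP B y) ==> ~~ cD B y;
      ~~ lkid x ==> (cP B x && ~~ cQ B x)].

Definition board_ok : Prop :=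
  (exists x, cRt B x) /\ forall x y z w, all id (rules x y z w).

End Rules.

Section Formulas.

Variable r : nat.

Definition FOr n (a b : formula r n) := FNot (FAnd (FNot a) (FNot b)).
Definition FImp n (a b : formula r n) := FNot (FAnd a (FNot b)).
Definition FIff n (a b : formula r n) := FAnd (FImp a b) (FImp b a).
Definition FAll n (a : formula r n.+1) := FNot (FEx (FNot a)).
Definition FConj n (a : formula r n) (l : seq (formula r n)) := foldr (@FAnd r
  n) a l.

Variable G : cgraph r.
Notation hold := (@holds r G _).

Lemma holds_eq n (i j : 'I_n) s : hold (FEq r i j) s = (tnth s i == tnth s j).
Proof. by []. Qed.
Lemma holds_edge n (i j : 'I_n) s : hold (FEdge r i j) s = edge (tnth s i)
  (tnth s j).
Proof. by []. Qed.
Lemma holds_color n c (i : 'I_n) s : hold (FColor c i) s = color c (tnth s i).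
Proof. by []. Qed.
Lemma holds_not n (a : formula r n) s : hold (FNot a) s = ~~ hold a s.
Proof. by []. Qed.
Lemma holds_and n (a b : formula r n) s : hold (FAnd a b) s = hold a s && hold b s.
Proof. by []. Qed.
Lemma holds_ex n (a : formula r n.+1) s :
  hold (FEx a) s = [exists v, hold a [tuple of v :: s]].
Proof. by []. Qed.
Lemma holds_or n (a b : formula r n) s : hold (FOr a b) s = hold a s || hold b s.
Proof. by rewrite /= negb_and !negbK. Qed.
Lemma holds_imp n (a b : formula r n) s : hold (FImp a b) s = hold a s ==> hold b s.
Proof. by rewrite /= negb_and negbK implybE. Qed.
Lemma holds_iff n (a b : formula r n) s : hold (FIff a b) s = (hold a s == hold
  b s).
Proof. by rewrite holds_and !holds_imp; case: hold; case: hold. Qed.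
Lemma holds_all n (a : formula r n.+1) s :
  hold (FAll a) s = [forall v, hold a [tuple of v :: s]].
Proof. by rewrite /= negb_exists; apply: eq_forallb => v; rewrite negbK. Qed.
Lemma holds_conj n (a : formula r n) l s :
  hold (FConj a l) s = all (fun b => hold b s) l && hold a s.
Proof. by elim: l => //= b l ->; rewrite andbA. Qed.

Lemma tnth_cons0 T n (v : T) (s : n.-tuple T) : tnth [tuple of v :: s] ord0 = v.
Proof. by rewrite (tnth_nth v). Qed.
Lemma tnth_consS T n (v : T) (s : n.-tuple T) i :
  tnth [tuple of v :: s] (lift ord0 i) = tnth s i.
Proof. by rewrite !(tnth_nth v) /= add0n. Qed.

End Formulas.

Definition holdsE := (holds_eq, holds_edge, holds_color, holds_or, holds_imp,
  holds_iff, holds_all, holds_not, holds_and, holds_ex, tnth_cons0, tnth_consS).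

Notation ncolors := 11.
Definition col (i : nat) : 'I_ncolors := inord i.

Section Psi.

Definition C n i (x : 'I_n) : formula ncolors n := FColor (col i) x.

(* The level modulo 3 is given by the colors 0, 1 and 2. *)
Definition fpar n (x y : 'I_n) :=
  FAnd (FEdge _ x y) (FOr (FAnd (C 0 y) (C 1 x))
    (FOr (FAnd (C 1 y) (C 2 x)) (FAnd (C 2 y) (C 0 x)))).
Definition flnk n (x y : 'I_n) :=
  FAnd (FEdge _ x y) (FAnd (FOr (FAnd (C 0 x) (C 0 y))
    (FOr (FAnd (C 1 x) (C 1 y)) (FAnd (C 2 x) (C 2 y))))
    (FAnd (C 3 x) (FNot (C 3 y)))).

Local Notation up := (lift ord0).
Definition fnxt n (x y : 'I_n) :=
  FOr (flnk x y) (FEx (FAnd (fpar (up x) ord0) (FAnd (fpar (up y) ord0)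
    (FAnd (FNot (C 3 (up x))) (C 3 (up y)))))).
Definition flkid n (y : 'I_n) := FEx (FAnd (fpar ord0 (up y)) (FNot (C 3 ord0))).
Definition frkid n (y : 'I_n) := FEx (FAnd (fpar ord0 (up y)) (C 3 ord0)).

Definition axioms n (x y z w : 'I_n) : seq (formula ncolors n) :=
  [:: FImp (FAnd (C 4 x) (C 4 y)) (FEq _ x y);
      FOr (C 4 x) (FEx (fpar (up x) ord0));
      FImp (C 4 x) (FNot (fpar x y));
      FImp (FAnd (fpar x y) (fpar x z)) (FEq _ y z);
      FImp (fpar x y) (FAnd (flkid y) (frkid y));
      FImp (FAnd (fpar x z) (FAnd (fpar y z) (FIff (C 3 x) (C 3 y)))) (FEq _ x y);
      FImp (fnxt x y) (FIff (flkid x) (flkid y));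
      FImp (FAnd (fnxt x y) (FAnd (fpar z x) (FAnd (fpar w y)
        (FAnd (C 3 z) (FNot (C 3 w)))))) (flnk z w);
      FImp (C 4 x) (FAnd (C 5 x) (FAnd (C 6 x) (FAnd (C 9 x) (FNot (C 10 x)))));
      FImp (fpar x y) (FIff (C 5 x) (FAnd (C 5 y) (FNot (C 3 x))));
      FImp (fpar x y) (FIff (C 6 x) (FAnd (C 6 y) (C 3 x)));
      FImp (C 9 x) (C 7 x);
      FImp (FAnd (fpar x y) (FNot (C 9 x))) (FIff (C 7 x) (FAnd (C 7 y) (FNot
        (C 3 x))));
      FImp (fnxt x y) (FIff (C 9 x) (C 9 y));
      FImp (FAnd (fpar x y) (C 6 x)) (FIff (C 9 x) (C 8 y));
      FImp (fpar x y) (FIff (C 10 x) (FNot (FIff (C 10 y) (C 9 x))));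
      FImp (C 5 x) (C 8 x);
      FImp (FAnd (fnxt x y) (FNot (C 7 y))) (FIff (C 8 y) (C 8 x));
      FImp (FAnd (fnxt x y) (FAnd (C 7 y) (FAnd (FNot (C 9 y)) (fpar x z))))
        (FIff (C 8 y) (C 8 z));
      FImp (FAnd (fnxt x y) (C 9 y)) (FNot (C 8 y));
      FImp (FNot (flkid x)) (FAnd (C 9 x) (FNot (C 10 x)))].

Definition psi : sentence ncolors :=
  FAnd (FEx (C 4 ord0))
    (FAll (FAll (FAll (FAll (FConj (FEq _ ord0 ord0)
      (axioms (up (up (up ord0))) (up (up ord0)) (up ord0) ord0)))))).

(** In the intended models adjacent vertices lie at most one row apart, so the level modulo 3 tells
    parent, child and cousin apart although edges are undirected; color 3 orients the links between
    cousins. The rules speak of the board alone and so apply to arbitrary structures. *)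
Definition board_of (G : cgraph ncolors) : board 'I_(nvert G) :=
  let c i := @color _ G (col i) in
  {| par := fun x y => edge x y && [|| c 0 y && c 1 x, c 1 y && c 2 x | c 2 y
    && c 0 x];
     lnk := fun x y => edge x y && ([|| c 0 x && c 0 y, c 1 x && c 1 y | c 2 x
       && c 2 y]
              && (c 3 x && ~~ c 3 y));
     cS := c 3; cRt := c 4; cY := c 5; cZ := c 6; cF := c 7; cD := c 8;
     cP := c 9; cQ := c 10 |}.

Section Models.

Variable G : cgraph ncolors.
Notation hold := (@holds ncolors G _).
Notation B := (board_of G).

Lemma holds_par n (x y : 'I_n) s : hold (fpar x y) s = par B (tnth s x) (tnth s y).
Proof. by rewrite /fpar !holdsE. Qed.

Lemma holds_lnk n (x y : 'I_n) s : hold (flnk x y) s = lnk B (tnth s x) (tnth s y).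
Proof. by rewrite /flnk !holdsE. Qed.

Lemma holds_nxt n (x y : 'I_n) s : hold (fnxt x y) s = nxt B (tnth s x) (tnth s y).
Proof.
rewrite /fnxt holds_or holds_lnk; congr orb; rewrite holdsE.
by apply: eq_existsb => v; rewrite !(holds_and, holds_par) !holdsE.
Qed.

Lemma holds_lkid n (y : 'I_n) s : hold (flkid y) s = lkid B (tnth s y).
Proof.
rewrite holds_ex; apply: eq_existsb => v.
by rewrite !(holds_and, holds_par) !holdsE.
Qed.

Lemma holds_rkid n (y : 'I_n) s : hold (frkid y) s = rkid B (tnth s y).
Proof.
rewrite holds_ex; apply: eq_existsb => v.
by rewrite !(holds_and, holds_par) !holdsE.
Qed.

Lemma holds_parent n (x : 'I_n) s :
  hold (FEx (fpar (up x) ord0)) s = [exists u, par B (tnth s x) u].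
Proof.
by rewrite holds_ex; apply: eq_existsb => v; rewrite holds_par !holdsE.
Qed.

Lemma holds_axioms n (x y z w : 'I_n) s :
  all (fun a => hold a s) (axioms x y z w) =
  all id (rules B (tnth s x) (tnth s y) (tnth s z) (tnth s w)).
Proof.
rewrite -(all_map _ id) /axioms /map; congr all.
rewrite !(holds_iff, holds_imp, holds_or, holds_and, holds_not, holds_parent,
  holds_par,
  holds_lnk, holds_nxt, holds_lkid, holds_rkid) !holdsE.
by [].
Qed.

Lemma models_psi : models G psi <-> board_ok B.
Proof.
rewrite /models /psi holds_and holds_ex.
have HA : hold (FAll (FAll (FAll (FAll (FConj (FEq _ ord0 ord0)
      (axioms (up (up (up ord0))) (up (up ord0)) (up ord0) ord0)))))) [tuple] <->
    forall x y z w, all id (rules B x y z w).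
  have E x y z w : hold (FConj (FEq _ ord0 ord0)
      (axioms (up (up (up ord0))) (up (up ord0)) (up ord0) ord0))
      [tuple of w :: [tuple of z :: [tuple of y :: [tuple of x :: [tuple]]]]] =
      all id (rules B x y z w).
    by rewrite holds_conj holds_axioms !holdsE eqxx andbT.
  rewrite holds_all; split=> [/forallP H x y z w|H].
    have := H x; rewrite holds_all => /forallP/(_ y).
    by rewrite holds_all => /forallP/(_ z); rewrite holds_all => /forallP/(_
      w); rewrite E.
  apply/forallP => x; rewrite holds_all; apply/forallP => y.
  rewrite holds_all; apply/forallP => z; rewrite holds_all.
  by apply/forallP => w; rewrite E.
split=> [/andP[/existsP[x Rx] /HA H]|[[x Rx] /HA H]].
  by split=> //; exists x; move: Rx; rewrite !holdsE.
by apply/andP; split=> //; apply/existsP; exists x; rewrite !holdsE.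
Qed.

End Models.

End Psi.

(** * Numeric description of the grid *)

(* The vertex with heap number a has the parent a/2, and lies on row lg a. *)
Definition lg (a : nat) : nat := trunc_log 2 a.

Lemma lg_bounds a : 0 < a -> 2 ^ lg a <= a < 2 ^ (lg a).+1.
Proof. by move=> a0; rewrite trunc_logP // trunc_log_ltn. Qed.

Lemma lg_eq n a : 2 ^ n <= a < 2 ^ n.+1 -> lg a = n.
Proof. by apply: trunc_log_eq. Qed.

Lemma lg_half x : 1 < x -> lg x = (lg x./2).+1.
Proof.
move=> x1; apply: lg_eq.
have y0 : 0 < x./2 by rewrite half_gt0.
have /andP[le lt] := lg_bounds y0.
by rewrite !(expnS _ (lg _).+1) !expnS in lt le *; move: (odd_double_half x); lia.
Qed.

Lemma lg_lt n a : 0 < a -> (lg a < n) = (a < 2 ^ n).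
Proof.
move=> a0; have /andP[le lt] := lg_bounds a0; apply/idP/idP => H.
  by apply: leq_trans lt _; rewrite leq_pexp2l.
by rewrite -(ltn_exp2l _ _ (m := 2)) // (leq_ltn_trans le).
Qed.

Lemma half_lt a n : 1 < a -> a < 2 ^ n.+1 -> 0 < a./2 < 2 ^ n.
Proof. by move=> a1; rewrite half_gt0 a1 expnS mul2n ltn_half_double. Qed.

Lemma kid_lt a n (b : bool) : a < 2 ^ n -> b + a.*2 < 2 ^ n.+1.
Proof. by rewrite expnS; case: b; lia. Qed.

(* [ck j] is the first row of epoch j, which has 2 ^ ck j blocks and lasts as
   many rows. *)
Fixpoint ck (j : nat) : nat := if j is j'.+1 then ck j' + 2 ^ ck j' else 0.

Fixpoint epoch (i : nat) : nat :=
  if i is i'.+1 then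
    if i == ck (epoch i').+1 then (epoch i').+1 else epoch i'
  else 0.

(** Row i consists of 2^([est i]) blocks of 2^([age i]) vertices each. *)
Definition est (i : nat) : nat := ck (epoch i).
Definition age (i : nat) : nat := i - est i.

Lemma ckS j : ck j.+1 = ck j + 2 ^ ck j.
Proof. by []. Qed.

Lemma epoch_next i :
  epoch i.+1 = if i.+1 == ck (epoch i).+1 then (epoch i).+1 else epoch i.
Proof. by []. Qed.

Lemma epochP i : ck (epoch i) <= i < ck (epoch i).+1.
Proof.
elim: i => // i /andP[le lt].
rewrite epoch_next; case: eqP => [E|/eqP ne].
  by rewrite -E leqnn ckS -E -[X in X < _]addn0 ltn_add2l expn_gt0.
by rewrite ltn_neqAle ne lt (leqW le).
Qed.

Lemma ck_ge j : j <= ck j.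
Proof.
elim: j => // j IH; rewrite ckS -addn1; apply: leq_add => //; exact: expn_gt0.
Qed.

Lemma ck_ltn : {homo ck : i j / i < j}.
Proof.
apply: homo_ltn; first exact: ltn_trans.
by move=> j; rewrite ckS -[X in X < _]addn0 ltn_add2l expn_gt0.
Qed.

Lemma ck_leq : {mono ck : i j / i <= j}.
Proof. exact: (leq_mono ck_ltn). Qed.

Lemma epoch_ck j : epoch (ck j) = j.
Proof.
have := epochP (ck j); rewrite (leqW_mono ck_leq) ck_leq ltnS => H.
by apply/eqP; rewrite eqn_leq.
Qed.

Lemma est_age i : est i + age i = i.
Proof. by have /andP[le _] := epochP i; rewrite /age subnKC. Qed.

Lemma age_lt i : age i < 2 ^ est i.
Proof. by have /andP[_ lt] := epochP i; rewrite -(ltn_add2l (est i)) est_age. Qed.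

Lemma age_eq0 i : (age i == 0) = (i == est i).
Proof. by have := est_age i; lia. Qed.

Lemma epochS i : epoch i.+1 = epoch i + (age i.+1 == 0).
Proof.
rewrite age_eq0 /est epoch_next; case: eqP => [E|_]; first by rewrite -E eqxx addn1.
by have /andP[le _] := epochP i; rewrite gtn_eqF ?addn0 // ltnS.
Qed.

Lemma est_same i : age i.+1 != 0 -> est i.+1 = est i /\ age i.+1 = (age i).+1.
Proof.
move=> ne; have E : est i.+1 = est i by rewrite /est epochS (negbTE ne) addn0.
by split=> //; have := est_age i; have := est_age i.+1; lia.
Qed.

Lemma age_start i : (age i.+1 == 0) = ((age i).+1 == 2 ^ est i).
Proof.
rewrite age_eq0 /est epoch_next -/(est i).
have Ei := est_age i.
case: ifP => [/eqP E|ne].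
  by rewrite -E eqxx; apply/esym/eqP; move: E; rewrite /= -/(est i); lia.
apply/idP/idP => [/eqP E|/eqP E].
  by have /andP[le _] := epochP i; rewrite -E ltnn in le.
by move: ne; rewrite /= -/(est i) -E; lia.
Qed.

(** The intended colors as predicates on heap numbers. The quotient of a by 2^age numbers the blocks
    of a row consecutively from 2^est; at age k exactly the first k + 1 of them are finished, which
    is [nD]. *)
Definition nY (a : nat) : bool := a == 2 ^ lg a.
Definition nZ (a : nat) : bool := a.+1 == 2 ^ (lg a).+1.
Definition nP (a : nat) : bool := age (lg a) == 0.
Definition nF (a : nat) : bool := 2 ^ age (lg a) %| a.
Definition nD (a : nat) : bool :=
  a %/ 2 ^ age (lg a) <= 2 ^ est (lg a) + age (lg a).
Definition nQ (a : nat) : bool := odd (epoch (lg a)).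

Lemma nY_half x : 1 < x -> nY x = nY x./2 && ~~ odd x.
Proof.
by move=> x1; rewrite /nY (lg_half x1) expnS; move: (odd_double_half x); lia.
Qed.

Lemma nZ_half x : 1 < x -> nZ x = nZ x./2 && odd x.
Proof.
by move=> x1; rewrite /nZ (lg_half x1) !(expnS _ (lg _).+1); move:
  (odd_double_half x); lia.
Qed.

Lemma nF_start a : nP a -> nF a.
Proof. by rewrite /nP /nF => /eqP ->; rewrite dvd1n. Qed.

Lemma nF_half x : 1 < x -> ~~ nP x -> nF x = nF x./2 && ~~ odd x.
Proof.
rewrite /nP /nF => x1; rewrite (lg_half x1) => /est_same[_ ->].
rewrite expnS; case: (boolP (odd x)) => ox.
  rewrite andbF; apply/negbTE; apply: contraL ox => /(dvdn_trans (dvdn_mulr _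
    (dvdnn 2))).
  by rewrite dvdn2.
by rewrite andbT; move: (age _) => k; rewrite -{1}(even_halfK ox) -muln2 [2 *
  _]mulnC dvdn_pmul2r.
Qed.

Lemma nP_last x : 1 < x -> nZ x -> nP x = nD x./2.
Proof.
move=> x1; rewrite nZ_half // => /andP[/eqP z _].
rewrite /nP /nD (lg_half x1) age_start; set y := x./2 in z *; set i := lg y in z *.
have Ei : i = est i + age i by rewrite est_age.
(* The parent of the last vertex lies in the last block of its row, which is finished exactly at the
   maximal age 2^est - 1. *)
have -> : y %/ 2 ^ age i = (2 ^ est i).*2.-1.
  have p : 0 < 2 ^ age i by rewrite expn_gt0.
  have q : 0 < 2 ^ est i by rewrite expn_gt0.
  have -> : y = (2 ^ est i).*2.-1 * 2 ^ age i + (2 ^ age i).-1.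
    have : y.+1 = (2 ^ est i).*2 * 2 ^ age i.
      by rewrite z {1}Ei -addSn expnD expnS mul2n.
    by case: (2 ^ est i) q => // u _; rewrite doubleS /= !mulSn; lia.
  by rewrite divnMDl // divn_small ?addn0 // prednK.
have q : 0 < 2 ^ est i by rewrite expn_gt0.
by have := age_lt i; lia.
Qed.

Lemma nQ_half x : 1 < x -> nQ x = ~~ (nQ x./2 == nP x).
Proof.
move=> x1; rewrite /nQ /nP (lg_half x1) epochS oddD oddb.
by case: odd; case: eqP.
Qed.

Lemma nD_first a : 0 < a -> nY a -> nD a.
Proof.
move=> a0 /eqP E; rewrite /nD.
have -> : a %/ 2 ^ age (lg a) = 2 ^ est (lg a).
  by rewrite {1}E -{1}(est_age (lg a)) expnD mulnK // expn_gt0.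
exact: leq_addr.
Qed.

Lemma nD_next a : lg a = lg a.+1 -> ~~ nF a.+1 -> nD a.+1 = nD a.
Proof.
rewrite /nF /nD => <- nd; congr (_ <= _).
by rewrite divnS ?expn_gt0 // (negbTE nd).
Qed.

(** Compared with the parent of a, the block of a + 1 has a number larger by one, and the age in the
    bound has also grown by one. *)
Lemma nD_block a : 1 < a -> lg a = lg a.+1 -> nF a.+1 -> ~~ nP a.+1 -> nD a.+1
  = nD a./2.
Proof.
rewrite /nF /nP /nD => a1 <-; rewrite (lg_half a1) => d /est_same[E1 E2].
rewrite E1 E2 in d *; rewrite divnS ?expn_gt0 // d add1n expnS divnMA divn2.
by rewrite addnS ltnS.
Qed.

Lemma nD_start a : 0 < a -> lg a = lg a.+1 -> nP a.+1 -> ~~ nD a.+1.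
Proof.
rewrite /nP /nD => a0 <- /eqP k0; have := est_age (lg a).
rewrite k0 addn0 expn0 divn1 addn0 => ->; rewrite -ltnNge ltnS.
by case/andP: (lg_bounds a0).
Qed.

(** * Boards are grids *)

Section Soundness.

Variables (V : finType) (B : board V) (r0 : V).
Hypotheses (Rr0 : cRt B r0) (Hrules : forall x y z w, all id (rules B x y z w)).

Notation par := (par B).
Notation nxt := (nxt B).
Notation S := (cS B).

Lemma rule k x y z w : nth true (rules B x y z w) k.
Proof.
case: (ltnP k (size (rules B x y z w))) => [lt|le]; last by rewrite nth_default.
exact: (all_nthP true (Hrules x y z w)).
Qed.

Lemma root_uniq x : cRt B x -> x = r0.
Proof. by move=> Rx; have /= := rule 0 x r0 x x; rewrite Rx Rr0 => /eqP. Qed.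

Lemma parent_ex x : x != r0 -> exists y, par x y.
Proof.
move=> ne; have /= := rule 1 x x x x => /orP[/root_uniq E|/existsP//].
by rewrite E eqxx in ne.
Qed.

Lemma root_orphan y : ~~ par r0 y.
Proof. by have /= := rule 2 r0 y r0 r0; rewrite Rr0. Qed.

Lemma parent_uniq x y z : par x y -> par x z -> y = z.
Proof. by move=> H1 H2; have /= := rule 3 x y z x; rewrite H1 H2 => /eqP. Qed.

Lemma par_kids x y : par x y -> lkid B y && rkid B y.
Proof. by move=> H; have /= := rule 4 x y x x; rewrite H. Qed.

Lemma kid_uniq x y z : par x z -> par y z -> S x = S y -> x = y.
Proof.
by move=> H1 H2 E; have /= := rule 5 x y z x; rewrite H1 H2 E eqxx => /eqP.
Qed.

Lemma nxt_kids x y : nxt x y -> lkid B x = lkid B y.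
Proof. by move=> H; have /= := rule 6 x y x x; rewrite H => /eqP. Qed.

Definition lc y := odflt r0 [pick x | par x y && ~~ S x].
Definition rc y := odflt r0 [pick x | par x y && S x].

Lemma lcP y : lkid B y -> par (lc y) y /\ S (lc y) = false.
Proof.
move=> /existsP[x Hx]; rewrite /lc; case: pickP => [z /andP[pz /negbTE]//|/(_ x)].
by rewrite Hx.
Qed.

Lemma rcP y : lkid B y -> par (rc y) y /\ S (rc y).
Proof.
move=> /lcP[/par_kids/andP[_ /existsP[x Hx]] _].
by rewrite /rc; case: pickP => [z /andP[]//|/(_ x)]; rewrite Hx.
Qed.

Lemma nxt_siblings y : lkid B y -> nxt (lc y) (rc y).
Proof.
move=> Hy; have [pl Sl] := lcP Hy; have [pr Sr] := rcP Hy.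
by apply/orP; right; apply/existsP; exists y; rewrite pl pr Sl Sr.
Qed.

Lemma nxt_cousins x y : nxt x y -> lkid B x -> nxt (rc x) (lc y).
Proof.
move=> H Hx; have Hy : lkid B y by rewrite -(nxt_kids H).
have [pl Sl] := lcP Hy; have [pr Sr] := rcP Hx.
by have /= := rule 7 x y (rc x) (lc y); rewrite H pl pr Sl Sr /= /nxt => ->.
Qed.

Lemma kid_cases x y : par x y -> x = if S x then rc y else lc y.
Proof.
move=> H; have /andP[Hy _] := par_kids H.
have [pl Sl] := lcP Hy; have [pr Sr] := rcP Hy.
by case: ifP => Sx; apply: (kid_uniq H) => //; rewrite Sx.
Qed.

(* A row, cyclic or not, is larger than the row of its parents: parent chains
   cannot cycle, so every vertex descends from the root. *)
Definition adjacent : rel V := fun x y => nxt x y || nxt y x.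

Definition row x : {set V} := [set y | connect adjacent x y].

(** A step within a row lifts to two steps in the row below: from the left to the right child, then
    across to the next left child. Rule 6 guarantees that these children exist. *)
Lemma connect_kids x y z : par x y -> connect adjacent y z ->
  lkid B z && connect adjacent x (lc z).
Proof.
move=> H /connectP[p]; have /andP[Hy _] := par_kids H.
have Ky : lkid B y && connect adjacent x (lc y).
  rewrite Hy /=; have := kid_cases H; case: ifP => _ -> //.
  by apply: connect1; rewrite /adjacent nxt_siblings ?orbT.
elim: p y {H Hy} Ky => [|u p IH] y Ky /=; first by move=> _ ->.
case/andP => /orP adj; apply: IH; case/andP: Ky => Hy Cy.
case: adj => N.
- have Hu : lkid B u by rewrite -(nxt_kids N).
  rewrite Hu /=; apply: connect_trans Cy _.
  apply: (@connect_trans _ _ (rc y)); apply: connect1.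
    by rewrite /adjacent nxt_siblings.
  by rewrite /adjacent nxt_cousins.
- have Hu : lkid B u by rewrite (nxt_kids N).
  rewrite Hu /=; apply: connect_trans Cy _.
  apply: (@connect_trans _ _ (rc u)); apply: connect1.
    by rewrite /adjacent nxt_cousins ?orbT.
  by rewrite /adjacent nxt_siblings ?orbT.
Qed.

(** The map [lc] embeds the row of [y] into the row of [x] and misses [rc y]. *)
Lemma row_parent x y : par x y -> #|row y| < #|row x|.
Proof.
move=> H; have K z : z \in row y -> lkid B z && connect adjacent x (lc z).
  by rewrite inE; apply: connect_kids.
have yy : y \in row y by rewrite inE connect0.
have inj : {in row y &, injective lc}.
  move=> z u /K/andP[Hz _] /K/andP[Hu _] E.
  by have [pz _] := lcP Hz; have [pu _] := lcP Hu; apply: parent_uniq pz _;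
    rewrite E.
rewrite -(card_in_imset inj); apply: proper_card; apply/properP; split.
  by apply/fintype.subsetP => _ /imsetP[z /K/andP[_ Cz] ->]; rewrite inE.
have /andP[Hy Cy] := K y yy.
exists (rc y).
  rewrite inE (connect_trans Cy) // connect1 // /adjacent nxt_siblings //.
apply/imsetP => -[z /K/andP[Hz _] E].
by have [_ Sr] := rcP Hy; have [_ Sl] := lcP Hz; rewrite E Sl in Sr.
Qed.

Fixpoint node_at (i a : nat) : V :=
  if i is i'.+1 then (if odd a then rc else lc) (node_at i' a./2) else r0.

Definition node (a : nat) : V := node_at (lg a) a.

Lemma nodeE a : 1 < a -> node a = (if odd a then rc else lc) (node a./2).
Proof. by move=> a1; rewrite /node (lg_half a1). Qed.

Definition full (i : nat) : Prop := forall a, 0 < a < 2 ^ i -> lkid B (node a).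

Lemma node_par i a : full i -> 1 < a < 2 ^ i.+1 ->
  par (node a) (node a./2) /\ S (node a) = odd a.
Proof.
move=> fi /andP[a1 lt]; have Ha := fi _ (half_lt a1 lt).
by rewrite nodeE //; case: (odd a); [case: (rcP Ha)|case: (lcP Ha)].
Qed.

(** An even [a] is followed by its sibling. An odd [a] is followed by a cousin, and the parents are
    consecutive, so the induction hypothesis applies to them. *)
Lemma node_nxt i a : full i -> 0 < a -> a.+1 < 2 ^ i.+1 -> lg a = lg a.+1 ->
  nxt (node a) (node a.+1).
Proof.
move=> fi; elim/ltn_ind: a => a IH a0 lt E.
have a1 : 1 < a by case: a a0 {IH lt} E => [|[|]].
have Ha := fi _ (half_lt a1 (ltnW lt)).
case: (boolP (odd a)) => oa; last first.
  rewrite [node a.+1]nodeE // [node a]nodeE //= (negbTE oa) /= uphalf_half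
    (negbTE oa).
  exact: nxt_siblings.
rewrite [node a.+1]nodeE // [node a]nodeE //= oa /= uphalf_half oa add1n.
apply: nxt_cousins => //; apply: IH; first by lia.
- by rewrite half_gt0.
- have a2 : 1 < a.+1 by [].
  have := half_lt a2 lt; rewrite /= uphalf_half oa add1n => /andP[_ lt2].
  by apply: leq_trans lt2 _; rewrite leq_pexp2l.
- have := lg_half a1; rewrite E; have a2 : 1 < a.+1 by [].
  by rewrite (lg_half a2) /= uphalf_half oa add1n => -[].
Qed.

Lemma node_kids i a : full i -> lg a = i -> 0 < a ->
  lkid B (node a) = lkid B (node (2 ^ i)).
Proof.
move=> fi; elim: a => // a IH E _.
have /andP[le lt] := @lg_bounds a.+1 isT; rewrite E in le lt.
case: (eqVneq a.+1 (2 ^ i)) => [->//|ne].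
have a0 : 2 ^ i <= a by rewrite -ltnS ltn_neqAle eq_sym ne le.
have Ea : lg a = i by apply: lg_eq; rewrite a0 ltnW.
have a1 : 0 < a by apply: leq_trans a0; rewrite expn_gt0.
rewrite -IH //; apply/esym/nxt_kids; apply: (node_nxt fi) => //.
by rewrite Ea E.
Qed.

(** A vertex determines its parent and, by its color [cS], the parity of its number; the root is
    recognized by having no parent. *)
Lemma node_inj i a b : full i -> 0 < a < 2 ^ i.+1 -> 0 < b < 2 ^ i.+1 ->
  node a = node b -> a = b.
Proof.
move=> fi; elim/ltn_ind: a b => a IH b /andP[a0 la] /andP[b0 lb] E.
have one c : 1 < c < 2 ^ i.+1 -> node c <> r0.
  by move=> /(node_par fi)[Hp _] Ec; rewrite Ec (negbTE (root_orphan _)) in Hp.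
case: (ltngtP a 1) => a1; first by lia.
- case: (ltngtP b 1) => b1; first by lia.
  + have [pa Sa] := node_par fi (introT andP (conj a1 la)).
    have [pb Sb] := node_par fi (introT andP (conj b1 lb)).
    have Eh : a./2 = b./2.
      apply: IH; first by lia.
      + by have /andP[-> /= l] := half_lt a1 la; apply: leq_trans l _; rewrite
        leq_pexp2l.
      + by have /andP[-> /= l] := half_lt b1 lb; apply: leq_trans l _; rewrite
        leq_pexp2l.
      + by apply: parent_uniq pa _; rewrite E.
    by rewrite -(odd_double_half a) -(odd_double_half b) -Sa -Sb E Eh.
  + by case: (one a); rewrite ?a1 // E b1.
- case: (ltngtP b 1) => b1; [by lia| |by rewrite a1 b1].
  by case: (one b); rewrite ?b1 // -E a1.
Qed.

(** Otherwise all rows would be full, and [node] would inject more numbers than there are vertices.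
    Since a row is uniform by [node_kids], it suffices to test its first vertex. *)
Lemma height_ex : exists2 h, full h & ~~ lkid B (node (2 ^ h)).
Proof.
apply: contrapT => no.
have all_full i : full i.
  elim: i => [|i IH] a; first by rewrite expn0; case: a.
  move=> /andP[a0 lt]; case: (ltnP a (2 ^ i)) => [lt'|ge]; first by apply: IH;
    rewrite a0.
  rewrite (node_kids IH) //; last by apply: lg_eq; rewrite ge.
  by apply: contrapT => /negP nk; apply: no; exists i.
have b (k : 'I_#|V|.+1) : 0 < k.+1 < 2 ^ #|V|.+2.
  apply: leq_ltn_trans (ltn_ord k) _.
  by apply: leq_trans (ltn_expl #|V|.+1 (ltnSn 1)) _; rewrite leq_exp2l.
have inj : injective (fun k : 'I_#|V|.+1 => node k.+1).
  by move=> k l /(node_inj (all_full _) (b k) (b l)) E; apply/val_inj/succn_inj.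
by have := leq_card _ inj; rewrite card_ord ltnn.
Qed.

Variable h : nat.
Hypotheses (fh : full h) (nh : ~~ lkid B (node (2 ^ h))).

(** Induction on the size of the row, which strictly decreases towards the parent. The parent cannot
    lie in row [h], whose vertices have no children. *)
Lemma node_surj x : exists2 a, 0 < a < 2 ^ h.+1 & x = node a.
Proof.
have [n] := ubnP #|row x|; elim: n x => // n IH x; rewrite ltnS => le.
case: (eqVneq x r0) => [->|/parent_ex[y H]].
  by exists 1 => //=; rewrite -{1}(expn0 2) ltn_exp2l.
have [a /andP[a0 la] Ey] := IH y (leq_trans (row_parent H) le).
have /andP[Hy _] := par_kids H.
have la' : a < 2 ^ h.
  rewrite ltnNge; apply/negP => ge.
  have Ea : lg a = h by apply: lg_eq; rewrite ge.
  by rewrite Ey (node_kids fh Ea a0) (negbTE nh) in Hy.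
exists (S x + a.*2).
  rewrite expnS mul2n; case: (S x) => /=; rewrite ?add0n; lia.
rewrite nodeE; last by lia.
by rewrite oddD odd_double addbF oddb half_bit_double -Ey;
  have := kid_cases H; case: (S x).
Qed.

Lemma card_board : #|V| = (2 ^ h.+1).-1.
Proof.
pose f := fun k : 'I_(2 ^ h.+1).-1 => node k.+1.
have b (k : 'I_(2 ^ h.+1).-1) : 0 < k.+1 < 2 ^ h.+1.
  by have := ltn_ord k; lia.
have inj : injective f.
  by move=> k l /(node_inj fh (b k) (b l)) E; apply/val_inj/succn_inj.
rewrite -[RHS]card_ord -(card_codom inj); apply/esym/eq_card => x.
have [a /andP[a0 la] ->] := node_surj x.
have lt : a.-1 < (2 ^ h.+1).-1 by lia.
by rewrite inE; apply/codomP; exists (Ordinal lt); rewrite /f /= prednK.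
Qed.

Lemma root_colors : [/\ cY B r0, cZ B r0, cP B r0, cQ B r0 = false & cF B r0 /\
  cD B r0].
Proof.
have /= := rule 8 r0 r0 r0 r0; rewrite Rr0 => /and4P[Y1 Z1 P1 /negbTE Q1].
have /= := rule 11 r0 r0 r0 r0; rewrite P1 /= => F1.
have /= := rule 16 r0 r0 r0 r0; rewrite Y1 /= => D1.
by [].
Qed.

Lemma node_borders a : 0 < a < 2 ^ h.+1 ->
  cY B (node a) = nY a /\ cZ B (node a) = nZ a.
Proof.
elim/ltn_ind: a => a IH /andP[a0 la].
have [Y1 Z1 _ _ _] := root_colors.
case: (ltngtP a 1) => [|a1|->]; [by lia| |by rewrite /node /= Y1 Z1].
have [pa Sa] := node_par fh (introT andP (conj a1 la)).
have ly : 0 < a./2 < 2 ^ h.+1 by rewrite half_gt0 a1 /=; lia.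
have [EY EZ] := IH a./2 ltac:(lia) ly.
have /= := rule 9 (node a) (node a./2) r0 r0; rewrite pa => /eqP ->.
have /= := rule 10 (node a) (node a./2) r0 r0; rewrite pa => /eqP ->.
by rewrite EY EZ Sa (nY_half a1) (nZ_half a1).
Qed.

Lemma node_prev a : 0 < a < 2 ^ h.+1 -> ~~ nY a ->
  [/\ 1 < a.-1, lg a.-1 = lg a & nxt (node a.-1) (node a)].
Proof.
move=> /andP[a0 la] nY; have /andP[le lt] := lg_bounds a0.
have le' : 2 ^ lg a <= a.-1.
  by move: nY; rewrite /nY; have : 0 < 2 ^ lg a; rewrite ?expn_gt0 //; lia.
have E : lg a.-1 = lg a by apply: lg_eq; rewrite le' /=; lia.
have a1 : 1 < a.-1.
  case: a a0 la nY le lt le' E => [|[|[|a]]] //.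
have aS : a.-1.+1 = a by rewrite prednK.
split=> //; rewrite -{2}aS; apply: (node_nxt fh); rewrite ?aS //; exact: ltnW.
Qed.

Lemma node_epoch a b : lg a = lg b -> 0 < a -> a <= b < 2 ^ h.+1 ->
  cP B (node a) = cP B (node b).
Proof.
move=> E a0 /andP[]; elim: b E => [|b IH] E; first by lia.
rewrite leq_eqVlt => /orP[/eqP->//|ab] lb.
have /andP[le _] := lg_bounds a0.
have nY : ~~ nY b.+1 by rewrite /nY -E gtn_eqF // (leq_ltn_trans le).
have [_ E' N] := @node_prev b.+1 (introT andP (conj isT lb)) nY.
rewrite IH //=; [|by rewrite E E'|exact: ltnW].
by have /= := rule 13 (node b) (node b.+1) r0 r0; rewrite N => /eqP.
Qed.

Lemma node_colors a : 0 < a < 2 ^ h.+1 ->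
  [/\ cP B (node a) = nP a, cF B (node a) = nF a, cD B (node a) = nD a &
      cQ B (node a) = nQ a].
Proof.
elim/ltn_ind: a => a IH /andP[a0 la].
case: (ltngtP a 1) => [|a1|->]; [by lia| |]; last first.
  have [_ _ P1 Q1 [F1 D1]] := root_colors; by rewrite /node /= P1 Q1 F1 D1.
have [pa Sa] := node_par fh (introT andP (conj a1 la)).
have ly : 0 < a./2 < 2 ^ h.+1 by rewrite half_gt0 a1 /=; lia.
have [EP EF ED EQ] := IH a./2 ltac:(lia) ly.
have [EY _] := node_borders (introT andP (conj a0 la)).
(* Rule 14 fixes the color only at the last vertex [b] of the row, and rule 13 carries it to [a].
   The parent of [b] has a number below [a], so the induction hypothesis covers it. *)
have HP : cP B (node a) = nP a.
  have /andP[le lt] := lg_bounds a0.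
  have [b bS] : exists b, b.+1 = 2 ^ (lg a).+1.
    by exists (2 ^ (lg a).+1).-1; rewrite prednK // expn_gt0.
  have ab : a <= b by rewrite -ltnS bS.
  have Eb : lg b = lg a by apply: lg_eq; rewrite (leq_trans le ab) -bS leqnn.
  have lb : b < 2 ^ h.+1.
    by rewrite bS leq_pexp2l // ltnS -ltnS lg_lt.
  have b1 : 1 < b := leq_trans a1 ab.
  have Zb : nZ b by rewrite /nZ Eb bS.
  have hb : b./2 < a.
    apply: leq_trans le; have := half_lt b1 (n := lg a); rewrite -bS ltnS leqnn.
    by case/(_ isT)/andP.
  have [_ Z] := node_borders (introT andP (conj (ltnW b1) lb)).
  have [pb _] := node_par fh (introT andP (conj b1 lb)).
  have [_ _ Db _] : [/\ cP B (node b./2) = nP b./2, cF B (node b./2) = nF b./2,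
      cD B (node b./2) = nD b./2 & cQ B (node b./2) = nQ b./2].
    by apply: (IH _ hb); rewrite half_gt0 b1 /= (leq_ltn_trans (leq_trans (ltnW
      hb) ab)).
  rewrite (node_epoch (esym Eb) a0 (introT andP (conj ab lb))).
  have /= := rule 14 (node b) (node b./2) r0 r0; rewrite pb Z Zb => /eqP ->.
  by rewrite Db -(nP_last b1 Zb) /nP Eb.
have HF : cF B (node a) = nF a.
  case: (boolP (nP a)) => Pa.
    by have /= := rule 11 (node a) r0 r0 r0; rewrite HP Pa nF_start.
  have /= := rule 12 (node a) (node a./2) r0 r0; rewrite pa HP Pa => /eqP ->.
  by rewrite EF Sa (nF_half a1 Pa).
split=> //; last first.
  have /= := rule 15 (node a) (node a./2) r0 r0; rewrite pa => /eqP ->.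
  by rewrite EQ HP (nQ_half a1).
case: (boolP (nY a)) => Ya.
  by have /= := rule 16 (node a) r0 r0 r0; rewrite EY Ya nD_first.
have [b1 Eb N] := node_prev (introT andP (conj a0 la)) Ya.
have aS : a.-1.+1 = a by rewrite prednK.
have ltp : a.-1 < a by rewrite ltn_predL.
have lh : a.-1./2 <= a.-1 by rewrite leq_half_double -addnn -addnS leq_addr.
have lb : 0 < a.-1 < 2 ^ h.+1.
  by apply/andP; split; [exact: ltnW b1|exact: leq_ltn_trans (leq_pred a) la].
case: (boolP (nP a)) => Pa.
  have /= := rule 19 (node a.-1) (node a) r0 r0; rewrite N HP Pa => /negbTE ->.
  by apply/esym/negbTE; rewrite -aS nD_start ?aS // ltnW.
case: (boolP (nF a)) => Fa; last first.
  have /= := rule 17 (node a.-1) (node a) r0 r0; rewrite N HF Fa => /eqP ->.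
  have [_ _ -> _] := IH a.-1 ltp lb.
  by rewrite -nD_next aS.
have [pb _] := node_par fh (introT andP (conj b1 (proj2 (andP lb)))).
have /= := rule 18 (node a.-1) (node a) (node a.-1./2) r0.
rewrite N HF Fa HP Pa pb => /eqP ->.
have lb2 : 0 < a.-1./2 < 2 ^ h.+1.
  by rewrite half_gt0 b1 (leq_ltn_trans lh (proj2 (andP lb))).
have [_ _ -> _] := IH a.-1./2 (leq_ltn_trans lh ltp) lb2.
have := nD_block b1; rewrite aS => -> //.
Qed.

Lemma height_checkpoint : exists j, h = ck j.*2.
Proof.
have p : 0 < 2 ^ h by rewrite expn_gt0.
have lt : 0 < 2 ^ h < 2 ^ h.+1 by apply/andP; split=> //; rewrite ltn_exp2l.
have /= := rule 20 (node (2 ^ h)) r0 r0 r0; rewrite (negbTE nh) /=.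
have [-> _ _ ->] := node_colors lt.
have Eh : lg (2 ^ h) = h by apply: lg_eq; rewrite leqnn /= ltn_exp2l.
rewrite /nP /nQ Eh age_eq0 => /andP[/eqP E ev].
by exists (epoch h)./2; rewrite even_halfK.
Qed.

End Soundness.

Lemma board_card (V : finType) (B : board V) : board_ok B ->
  exists j, #|V| = (2 ^ (ck j.*2).+1).-1.
Proof.
move=> [[r0 Rr0] Hrules]; have [h fh nh] := height_ex Rr0 Hrules.
have [j E] := height_checkpoint Rr0 Hrules fh nh.
by exists j; rewrite -E; apply: card_board Rr0 Hrules h fh nh.
Qed.

Lemma models_card (G : cgraph ncolors) : models G psi ->
  exists j, nvert G = (2 ^ (ck j.*2).+1).-1.
Proof.
by move=> /models_psi/board_card[j E]; exists j; rewrite -E card_ord.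
Qed.

(** * Gaps between the sizes of models *)

Lemma leq_exp_mul t c : c.*2 <= t -> t.+1 * c <= 2 ^ t.
Proof.
move=> ct; have H : t * t.+1 <= 2 ^ t.+1.
  elim: t {ct} => // t IH; rewrite expnS; case: (leqP t 1) => [|t1]; first by
    case: t {IH} => [|[|]].
  by nia.
by rewrite expnS in H; nia.
Qed.

Lemma psi_gaps : spectrum_gaps psi.
Proof.
(* The lower end l = 2^(t+1) is one more than the number of vertices at height t. The choice of [c]
   gives (l^k)^d + d <= 2^((t+1)c), and [c.*2 <= t] bounds this by 2^(2^t). *)
move=> k d; pose c := k * d + d; pose t := ck c.*2.
have ct : c.*2 <= t by apply: ck_ge.
have l2 : 2 <= 2 ^ t.+1 by rewrite -{1}(expn1 2) leq_pexp2l.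
exists (2 ^ t.+1) => // G /models_card[j ->] /andP[gt lt].
have p n : 0 < 2 ^ n by rewrite expn_gt0.
have cj : c < j.
  rewrite ltnNge; apply/negP => jc.
  have : ck j.*2 <= t by rewrite ck_leq leq_double.
  rewrite leqNgt; case/negP; rewrite -ltnS -(ltn_exp2l _ _ (m := 2)) //.
  by have := p (ck j.*2).+1; lia.
(* The next admissible height is two epochs later, and each epoch contributes one exponentiation. *)
have H1 : 2 ^ 2 ^ t <= ck j.*2.
  apply: (@leq_trans (ck c.+1.*2)); last by rewrite ck_leq leq_double.
  rewrite doubleS ckS; apply: leq_trans (leq_addl _ _).
  by rewrite leq_pexp2l // ckS leq_addl.
move: lt; apply/negP; rewrite -leqNgt.
apply: (@leq_trans (2 ^ ck j.*2)); last first.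
  by rewrite expnS; have := p (ck j.*2); lia.
rewrite leq_pexp2l //; apply: leq_trans H1.
rewrite -!expnM; set m := t.+1 * (k * d).
apply: (@leq_trans (2 ^ (m + d))).
  rewrite expnD; move: (p m) (ltn_expl d (ltnSn 1)).
  move: (2 ^ m) (2 ^ d) => u [|v] // u0 dv.
  by rewrite mulnS leq_add2l; apply: (@leq_trans v) => //; rewrite leq_pmull.
rewrite leq_pexp2l //; apply: leq_trans (leq_exp_mul ct).
by rewrite /c mulnDr leq_add2l leq_pmull.
Qed.

Lemma psi_pos (G : cgraph ncolors) : models G psi -> 0 < nvert G.
Proof.
move=> /models_card[j ->]; rewrite expnS.
by have : 0 < 2 ^ ck j.*2; rewrite ?expn_gt0 //; lia.
Qed.

(** * The grids *)

Definition nchild (b a : nat) : bool := (1 < b) && (b./2 == a).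
Definition nlink (a b : nat) : bool := [&& odd a, b == a.+1 & lg a == lg b].
Definition nadj (a b : nat) : bool :=
  [|| nchild a b, nchild b a, nlink a b | nlink b a].

Definition ncolor (i a : nat) : bool :=
  match i with
  | 0 | 1 | 2 => lg a %% 3 == i
  | 3 => odd a
  | 4 => a == 1
  | 5 => nY a
  | 6 => nZ a
  | 7 => nF a
  | 8 => nD a
  | 9 => nP a
  | _ => nQ a
  end.

Section Grid.

Variable h : nat.

(* The vertex v has heap number v + 1. *)
Definition grid : cgraph ncolors :=
  @CGraph ncolors (2 ^ h.+1).-1 (fun u v => nadj u.+1 v.+1)
    (fun c u => ncolor c u.+1).

Notation vertex := 'I_(2 ^ h.+1).-1.
Notation B := (board_of grid).

Lemma vertex_lt (u : vertex) : u.+1 < 2 ^ h.+1.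
Proof. by have := ltn_ord u; lia. Qed.

Lemma vertex_of a : 0 < a < 2 ^ h.+1 -> exists u : vertex, u.+1 = a.
Proof.
move=> /andP[a0 la]; have lt : a.-1 < (2 ^ h.+1).-1 by lia.
by exists (Ordinal lt); rewrite /= prednK.
Qed.

Lemma nchild_lg b a : nchild b a -> lg b = (lg a).+1.
Proof. by case/andP => b1 /eqP <-; apply: lg_half. Qed.

Lemma nlink_lg a b : nlink a b -> lg a = lg b.
Proof. by case/and3P => _ _ /eqP. Qed.

(** Shaped like the disjunctions in [board_of], so that they can be folded by conversion; here [m]
    is the level of the parent and [n] that of the child. *)
Definition succ3 (m n : nat) : bool :=
  [|| (m %% 3 == 0) && (n %% 3 == 1), (m %% 3 == 1) && (n %% 3 == 2)
    | (m %% 3 == 2) && (n %% 3 == 0)].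

Definition same3 (m n : nat) : bool :=
  [|| (m %% 3 == 0) && (n %% 3 == 0), (m %% 3 == 1) && (n %% 3 == 1)
    | (m %% 3 == 2) && (n %% 3 == 2)].

Lemma succ3E n :
  [/\ succ3 n n.+1, succ3 n.+1 n = false, succ3 n n = false &
      [/\ same3 n n, same3 n n.+1 = false & same3 n.+1 n = false]].
Proof. by rewrite /succ3 /same3; split; [lia|lia|lia|split; lia]. Qed.

Lemma grid_par u v : par B u v = nchild u.+1 v.+1.
Proof.
rewrite /= !inordK //= /nadj -/(succ3 _ _).
case E: (nchild u.+1 v.+1); first by rewrite (nchild_lg E); case: (succ3E (lg
  v.+1)) => ->.
case E1: (nchild v.+1 u.+1) => /=.
  by rewrite (nchild_lg E1); case: (succ3E (lg u.+1)) => _ ->.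
case L: (nlink u.+1 v.+1) => /=.
  by rewrite (nlink_lg L); case: (succ3E (lg v.+1)) => _ _ ->.
case L': (nlink v.+1 u.+1) => //=.
by rewrite (nlink_lg L'); case: (succ3E (lg u.+1)) => _ _ ->.
Qed.

Lemma grid_lnk u v : lnk B u v = nlink u.+1 v.+1.
Proof.
rewrite /= !inordK //= /nadj -/(same3 _ _).
case E: (nchild u.+1 v.+1).
  have -> : nlink u.+1 v.+1 = false.
    by apply/negP => /nlink_lg; rewrite (nchild_lg E) => /eqP; rewrite gtn_eqF.
  rewrite (nchild_lg E).
  by case: (succ3E (lg v.+1)) => _ _ _ [_ _ ->].
case E1: (nchild v.+1 u.+1) => /=.
  have -> : nlink u.+1 v.+1 = false.
    by apply/negP => /nlink_lg; rewrite (nchild_lg E1) => /eqP; rewrite ltn_eqF.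
  rewrite (nchild_lg E1).
  by case: (succ3E (lg u.+1)) => _ _ _ [_ -> _].
case L: (nlink u.+1 v.+1) => /=.
  rewrite (nlink_lg L); case: (succ3E (lg v.+1)) => _ _ _ [-> _ _].
  by case/and3P: L => /= ou /eqP [->] _; rewrite ou /= ou.
case L': (nlink v.+1 u.+1) => //=.
by case/and3P: L' => /= ov /eqP [->] _; rewrite /= ov !andbF.
Qed.

Lemma grid_colors : [/\ cS B =1 (fun u => odd u.+1), cRt B =1 (fun u => u.+1 == 1),
  cY B =1 (fun u => nY u.+1), cZ B =1 (fun u => nZ u.+1) &
  [/\ cF B =1 (fun u => nF u.+1), cD B =1 (fun u => nD u.+1),
   cP B =1 (fun u => nP u.+1) & cQ B =1 (fun u => nQ u.+1)]].
Proof. by split=> [u|u|u|u|]; last split=> u; rewrite /= inordK. Qed.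

Lemma grid_nxt u v : nxt B u v -> v.+1 = u.+2 /\ lg u.+1 = lg v.+1.
Proof.
have [cS _ _ _ _] := grid_colors.
case/orP => [|/existsP[w]]; first by rewrite grid_lnk => /and3P[_ /eqP -> /eqP ->].
rewrite !grid_par !cS => /and4P[/andP[u1 /eqP Eu] /andP[v1 /eqP Ev] eu ov].
split; last by rewrite (lg_half u1) (lg_half v1) Eu Ev.
by rewrite -(odd_double_half v.+1) -(odd_double_half u.+1) Eu Ev ov (negbTE eu).
Qed.

Lemma grid_kid u (b : bool) :
  [exists x, par B x u && (cS B x == b)] = (u.+1 < 2 ^ h).
Proof.
have [cS _ _ _ _] := grid_colors.
apply/existsP/idP => [[x]|lt].
  rewrite grid_par => /andP[/andP[x1 /eqP <-] _].
  by have /andP[] := half_lt x1 (vertex_lt x).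
have lt' : 0 < b + u.+1.*2 < 2 ^ h.+1 by rewrite kid_lt // doubleS addnS.
have [x Ex] := vertex_of lt'; exists x.
rewrite grid_par cS Ex /nchild half_bit_double eqxx oddD odd_double addbF oddb eqxx.
by rewrite !andbT; case: (b).
Qed.

Lemma grid_lkid u : lkid B u = (u.+1 < 2 ^ h).
Proof.
by rewrite -(grid_kid u false); apply: eq_existsb => x; case: (cS B x).
Qed.

Lemma grid_rkid u : rkid B u = (u.+1 < 2 ^ h).
Proof.
by rewrite -(grid_kid u true); apply: eq_existsb => x; case: (cS B x).
Qed.

Lemma grid_rules j x y z w : h = ck j.*2 -> all id (rules B x y z w).
Proof.
move=> Eh; have := grid_colors; have := grid_par; have := grid_lnk.
have := grid_nxt; have := grid_lkid; have := grid_rkid.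
(* The board is generalized and only its numeric description kept, so that simplification does not
   unfold it. The items below follow the order of [rules]. *)
move: B => b rkidE lkidE nxtP lnkE parE [cS cRt cY cZ [cF cD cP cQ]].
have P (u v : vertex) : par b u v -> 1 < u.+1 /\ v.+1 = u.+1./2.
  by rewrite parE => /andP[-> /eqP ->].
rewrite /rules /= !(cS, cRt, cY, cZ, cF, cD, cP, cQ, lkidE, rkidE) andbT.
do ! [apply/andP; split].
- by apply/implyP => /andP[/eqP Ex /eqP Ey]; apply/eqP/val_inj/succn_inj;
  rewrite Ex.
- case: eqP => //= ne; apply/existsP.
  have x1 : 1 < x.+1 by case: (x : nat) ne.
  have lt : 0 < x.+1./2 < 2 ^ h.+1.
    have le : x.+1./2 <= x.+1 by rewrite leq_half_double -addnn -addnS leq_addr.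
    by rewrite half_gt0 x1 (leq_ltn_trans le (vertex_lt x)).
  by have [u Eu] := vertex_of lt; exists u; rewrite parE /nchild x1 Eu eqxx.
- by apply/implyP => /eqP E; rewrite parE /nchild E.
- apply/implyP => /andP[/P[_ Ey] /P[_ Ez]]; apply/eqP/val_inj/succn_inj.
  by rewrite Ey Ez.
- by apply/implyP => /P[x1 ->]; have /andP[_ ->] := half_lt x1 (vertex_lt x).
- apply/implyP => /and3P[/P[_ Ex] /P[_ Ey] /eqP E]; apply/eqP/val_inj/succn_inj.
  by rewrite -(odd_double_half x.+1) -(odd_double_half y.+1) E -Ex Ey.
- by apply/implyP => /nxtP[_ E]; rewrite -!lg_lt // E.
- apply/implyP => /and5P[/nxtP[Exy El] /P[z1 Ez] /P[w1 Ew] oz ew].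
  rewrite lnkE /nlink oz (lg_half z1) (lg_half w1) -Ez -Ew El eqxx andbT.
  rewrite -(odd_double_half w.+1) -(odd_double_half z.+1) -Ez -Ew Exy oz
    (negbTE ew).
  by rewrite doubleS add0n add1n eqxx.
- by apply/implyP => /eqP ->.
- by apply/implyP => /P[x1 ->]; rewrite nY_half.
- by apply/implyP => /P[x1 ->]; rewrite nZ_half.
- by apply/implyP => /nF_start.
- by apply/implyP => /andP[/P[x1 ->] nP]; rewrite nF_half.
- by apply/implyP => /nxtP[_ E]; rewrite /nP E.
- by apply/implyP => /andP[/P[x1 ->] Z]; rewrite nP_last.
- by apply/implyP => /P[x1 ->]; rewrite nQ_half.
- by apply/implyP; apply: nD_first.
- by apply/implyP => /andP[/nxtP[-> E] F]; rewrite nD_next // ?E.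
- apply/implyP => /and4P[/nxtP[Exy E] F nPy /P[x1 ->]].
  by rewrite Exy in E F nPy *; rewrite nD_block.
- by apply/implyP => /andP[/nxtP[Exy E]]; rewrite Exy in E *; apply: nD_start.
- apply/implyP; rewrite -leqNgt => le.
  have Ex : lg x.+1 = ck j.*2 by rewrite -Eh; apply: lg_eq; rewrite le vertex_lt.
  by rewrite /nP /nQ age_eq0 /est Ex epoch_ck eqxx odd_double.
Qed.

Lemma grid_models j : h = ck j.*2 -> models grid psi.
Proof.
move=> Eh; apply/models_psi; split; last first.
  by move=> x y z w; apply: grid_rules Eh.
have lt : 0 < 1 < 2 ^ h.+1 := leq_ltn_trans (ltn0Sn h) (ltn_expl h.+1 (ltnSn 1)).
have [u Eu] := vertex_of lt; exists u.
by have [_ -> _ _ _] := grid_colors; rewrite Eu.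
Qed.

Lemma grid_simple : simple_graph grid.
Proof.
split=> [u v|u] /=; rewrite /nadj.
  by rewrite orbCA; congr (_ || (_ || _)); apply: orbC.
by rewrite /nchild /nlink; apply/negbTE; lia.
Qed.

Lemma grid_degree : max_degree_le 4 grid.
Proof.
move=> v; rewrite cardE -(size_map (fun u : vertex => u.+1)).
(* The possible neighbors are the parent, two children and a single cousin, to the right of an odd
   number and to the left of an even one. *)
pose a := v.+1; apply: (@uniq_leq_size _ _ [:: a./2; a.*2; a.*2.+1;
  if odd a then a.+1 else a.-1]).
  rewrite map_inj_uniq ?enum_uniq // => x y; by move/succn_inj/val_inj.
move=> x /mapP[u]; rewrite mem_enum => /or4P H ->.
move: (u.+1) H => b; rewrite -/a => H; rewrite !inE.
case: H => [/andP[_ /eqP ->]|/andP[_ /eqP E]|/and3P[oa /eqP -> _]|/and3P[ob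
  /eqP E _]].
- by rewrite eqxx.
- by rewrite -(odd_double_half b) E; case: (odd b); rewrite eqxx !orbT.
- by rewrite oa eqxx !orbT.
- by rewrite E /= ob eqxx !orbT.
Qed.

Lemma grid_arc (u v : vertex) : u < v -> @edge _ grid u v ->
  (lg v.+1 = lg u.+1 /\ v.+1 = u.+2) \/
  (lg v.+1 = (lg u.+1).+1 /\ u.+1 = v.+1./2).
Proof.
move=> uv /or4P[/andP[u1 /eqP E]|H|/and3P[_ /eqP -> /eqP ->]|/and3P[_ /eqP E _]].
- by move: uv; rewrite -ltnS -E ltnNge leq_half_double -addnn -addnS leq_addr.
- by right; rewrite (nchild_lg H); case/andP: H => _ /eqP ->.
- by left.
- by move: uv; rewrite -ltnS E ltnNge leqnSn.
Qed.

End Grid.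

Section Drawing.

Variables (R : realType) (h : nat).

Notation vertex := 'I_(2 ^ h.+1).-1.
Import Order.TTheory GRing.Theory Num.Theory numFieldNormedType.Exports.
Local Open Scope ring_scope.

Definition position (u : vertex) : R * R := (u.+1%:R, (lg u.+1)%:R).

Definition segment (u v : vertex) (t : R) : R * R :=
  ((1 - t) * u.+1%:R + t * v.+1%:R, (1 - t) * (lg u.+1)%:R + t * (lg v.+1)%:R).

Lemma natr_between (m n : nat) (s : R) : 0 < s < 1 -> m%:R + s <> n%:R.
Proof.
move=> /andP[s0 s1] E.
have lt : (m < n)%N by rewrite -(ltr_nat R) -E ltrDl.
have : m.+1%:R <= n%:R :> R by rewrite ler_nat.
by rewrite -natr1 -E lerD2l leNgt s1.
Qed.

Lemma natr_frac (m n : nat) (s t : R) : 0 < s < 1 -> 0 < t < 1 ->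
  m%:R + s = n%:R + t -> m = n.
Proof.
move=> /andP[s0 s1] /andP[t0 t1] E; case: (ltngtP m n) => // lt.
- have : m.+1%:R <= n%:R :> R by rewrite ler_nat.
  by rewrite -natr1 => H; exfalso; lra.
- have : n.+1%:R <= m%:R :> R by rewrite ler_nat.
  by rewrite -natr1 => H; exfalso; lra.
Qed.

Lemma continuous_segment u v : continuous (segment u v).
Proof.
have H (a b : R) : continuous (fun t : R => (1 - t) * a + t * b).
  move=> t; apply: cvgD; apply: cvgM; try exact: cvg_cst; last exact: cvg_id.
  by apply: cvgB; [exact: cvg_cst|exact: cvg_id].
move=> t.
by apply: (@cvg_pair _ _ _ _ (nbhs ((1 - t) * u.+1%:R + t * v.+1%:R))
  (nbhs ((1 - t) * (lg u.+1)%:R + t * (lg v.+1)%:R))); apply: H.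
Qed.

Lemma segment_inj (u v : vertex) : (u < v)%N -> injective (segment u v).
Proof.
move=> uv s t [E _].
have lt : u.+1%:R < v.+1%:R :> R by rewrite ltr_nat.
have : (v.+1%:R - u.+1%:R) * (s - t) = 0 :> R by lra.
by move/eqP; rewrite mulf_eq0 subr_eq0 gt_eqF //= subr_eq0 => /eqP.
Qed.

Lemma grid_planar : planar R (grid h).
Proof.
exists position, segment; split.
- by move=> u v [/eqP]; rewrite eqr_nat eqSS => /eqP/val_inj.
- move=> u v /andP[uv _]; split.
  + exact/continuous_subspaceT/continuous_segment.
  + by move=> s t _ _; apply: segment_inj.
  + by rewrite /segment subr0 !mul1r !mul0r !addr0.
  + by rewrite /segment subrr !mul1r !mul0r !add0r.
(* Vertices have integral coordinates. The interior of a link has no integral abscissa, and the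
   interior of a tree edge no integral ordinate. *)
- move=> u v w /andP[uv /(grid_arc uv) arc] t; rewrite in_itv /= => t01 [Ex Ey].
  case: arc => [[El Ev]|[El Eu]].
    rewrite Ev in Ex; apply: (@natr_between u.+1 w.+1 t t01).
    by rewrite -Ex -(natr1 u.+1); ring.
  rewrite El in Ey; apply: (@natr_between (lg u.+1) (lg w.+1) t t01).
  by rewrite -Ey -(natr1 (lg _)); ring.
- move=> u v u' v' /andP[uv /(grid_arc uv) arc] /andP[uv' /(grid_arc uv') arc']
  ne t t'.
  rewrite !in_itv /= => t01 t01' [Ex Ey]; apply: ne.
  case: arc arc' => [[El Ev]|[El Eu]] [[El' Ev']|[El' Eu']].
  (* Two links: each spans one unit, so the integral part of a common abscissa identifies the
     link. *)
  + rewrite Ev Ev' in Ex.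
    have E : u.+1 = u'.+1.
      apply: (@natr_frac _ _ t t') => //.
      by rewrite -(natr1 u.+1) -(natr1 u'.+1) in Ex; lra.
    have Eu : u = u' by apply/val_inj/succn_inj.
    by rewrite Eu; congr pair; apply/val_inj/succn_inj; rewrite Ev Ev' Eu.
  (* A link lies at integral height, the interior of a tree edge strictly between two rows. *)
  + rewrite El El' in Ey.
    case: (@natr_between (lg u'.+1) (lg u.+1) t' t01').
    by rewrite -(natr1 (lg u'.+1)) in Ey; lra.
  + rewrite El El' in Ey.
    case: (@natr_between (lg u.+1) (lg u'.+1) t t01).
    by rewrite -(natr1 (lg u.+1)) in Ey; lra.
  (* Two tree edges: a common height forces the same rows and the same parameter. As halving is
     monotone, the parents are ordered weakly like the children, so the abscissae at this parameter
     are strictly ordered like the children. *)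
  + rewrite El El' -!(natr1 (lg _)) in Ey.
    have E : lg u.+1 = lg u'.+1 by apply: (@natr_frac _ _ t t') => //; lra.
    have Et : t = t' by rewrite E in Ey; lra.
    have lt (w x w' x' : vertex) : w.+1 = x.+1./2 -> w'.+1 = x'.+1./2 ->
        (x < x')%N -> (1 - t) * w.+1%:R + t * x.+1%:R <
                  (1 - t) * w'.+1%:R + t * x'.+1%:R :> R.
      move=> Ew Ew' xx; case/andP: t01 => t0 t1.
      have le1 : w.+1%:R <= w'.+1%:R :> R by rewrite ler_nat Ew Ew' half_leq //
        ltnS ltnW.
      have lt1 : x.+1%:R < x'.+1%:R :> R by rewrite ltr_nat ltnS.
      by rewrite ler_ltD // ?ltr_pM2l // ler_wpM2l // subr_ge0 ltW.
    rewrite -Et in Ex.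
    have Ev : v = v'.
      apply/val_inj; case: (ltngtP v v') => // l.
        by have := lt _ _ _ _ Eu Eu' l; rewrite Ex ltxx.
      by have := lt _ _ _ _ Eu' Eu l; rewrite Ex ltxx.
    by rewrite Ev; congr pair; apply/val_inj/succn_inj; rewrite Eu Eu' Ev.
Qed.

End Drawing.

Definition edgeless (n : nat) : cgraph ncolors :=
  @CGraph ncolors n (fun _ _ => false) (fun _ _ => false).

Lemma isomorphic_nvert r (G H : cgraph r) : isomorphic G H -> nvert G = nvert H.
Proof. by move=> [f [/bij_eq_card]]; rewrite !card_ord. Qed.

Lemma edgeless_planar (R : realType) n : planar R (edgeless n).
Proof.
exists (fun u => (u%:R, 0)%R), (fun _ _ _ => (0, 0)%R).
split=> [u v [/eqP]|u v|u v w|u v u' v']; rewrite /= ?andbF //.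
by rewrite Num.Theory.eqr_nat => /eqP/val_inj.
Qed.

Theorem theorem4 (R : realType) :
  exists (r : nat) (psi : sentence r),
    [/\ infinitely_many (fun G : cgraph r =>
          [/\ simple_graph G, planar R G, max_degree_le 4 G & models G psi]),
        infinitely_many (fun G : cgraph r =>
          [/\ simple_graph G, planar R G, max_degree_le 4 G & ~~ models G psi]) &
        NP_hard (dynamics psi) \/ coNP_hard (dynamics psi) ->
        robustly_often_polynomial SAT].
Proof.
exists ncolors, psi; split; last exact: hard_dynamics psi_pos psi_gaps.
- exists (fun j => grid (ck j.*2)); split=> [j|i j ne /isomorphic_nvert /= E].
    split; [exact: grid_simple|exact: grid_planar|exact: grid_degree|].
    exact: grid_models.
  apply: ne; apply/double_inj/(incn_inj ck_leq)/succn_inj/eqP.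
  by rewrite -(eqn_exp2l _ _ (ltnSn 1)) -(prednK (expn_gt0 2 _)) E prednK ?expn_gt0.
(* Counter-models by parity: every model has an odd number of vertices. *)
- exists (fun n => edgeless n.*2); split=> [n|i j ne /isomorphic_nvert
  /double_inj //].
  split; [by split|exact: edgeless_planar|by move=> v; rewrite eq_card0|].
  apply/negP => /models_card[j] /= E; have := odd_double n.
  by rewrite E expnS; have : 0 < 2 ^ ck j.*2; rewrite ?expn_gt0 //; lia.
Qed.
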